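(* (a) Let $L$ be an oriented singular link and let $D$, $D'$ be two oriented singular link diagrams representing $L$ (that is, diagrams of isotopic oriented singular links). Then $(-A)^{-3w(D)}\langle D\rangle_s = (-A)^{-3w(D')}\langle D'\rangle_s$ in $\mathbb{Z}[A,A^{-1},B,B^{-1}]$. In other words, $V^s_L(A,B) := (-A)^{-3w(D)}\langle D\rangle_s$ is an isotopy invariant of oriented singular links. (b) Let $L$ be an oriented singular link with a distinguished component, and let $D$, $D'$ be two oriented singular link diagrams representing $L$ in which the distinguished component is drawn as a long component (that is, diagrams of isotopic oriented singular links with distinguished component). Then the state sums $\Delta^s_D(A,B)$ and $\Delta^s_{D'}(A,B)$ are equal in $\mathbb{Z}[A,A^{-1},B]$. In other words, $\Delta^s_L(A,B) := \Delta^s_D(A,B)$ is an isotopy invariant of oriented singular links with a distinguished component.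
   Context: **Singular links.** A singular link is an oriented smooth link in 3-space which is allowed to have a finite number of rigid ordinary double points. It is represented by an oriented singular link diagram: a generic oriented planar link diagram whose vertices are either ordinary crossings (with over/under information) or double points. Two diagrams represent the same (isotopic) singular link if and only if they are related by a finite sequence of planar isotopies, ordinary Reidemeister moves I, II, III, and the following two types of moves, with all orientations and crossing choices allowed: $SII$, where a crossing between the two strands through a double point $p$, adjacent to $p$ (so that the crossing and $p$ form a bigon), is moved to the opposite side of $p$ (in braid-like form: $\sigma^{\pm1}x = x\sigma^{\pm1}$, where $x$ is the double point and $\sigma$ the crossing of the two strands); and $SIII$, where a strand is moved entirely over, or entirely under, a double point. If $L$ has a distinguished component, that component is represented as a long knot: it is opened at a point different from the double points so that it becomes a properly embedded line, coinciding outside a compact set with a fixed line in the plane and oriented from left to right; the other components are closed. **Writhe.** $w(D)$ is the sum of the signs of the ordinary crossings of $D$ (double points do not contribute). **Singular Kauffman bracket $\langle D\rangle_s$.** At each crossing and each double point there are two planar smoothings: the oriented smoothing (the one compatible with the orientations) and the non-oriented smoothing (the other one). A state $s$ is a choice of one smoothing at every crossing and every double point; let $c(s)$ be the number of resulting circles. Weights: at a positive crossing the oriented smoothing has weight $A$ and the non-oriented smoothing has weight $A^{-1}$; at a negative crossing the oriented smoothing has weight $A^{-1}$ and the non-oriented smoothing has weight $A$ (this is the usual Kauffman bracket); at a double point the oriented smoothing has weight $B$ and the non-oriented smoothing has weight $B^{-1}$, where $B$ is a new independent variable. Then $\langle D\rangle_s = \sum_s (\text{product of the weights})\cdot(-A^2-A^{-2})^{c(s)-1}$.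 **Kauffman states and $\Delta^s_D$.** Let $D$ be a diagram with the distinguished component drawn as a long component. The two unbounded regions of the complement of $D$ which are adjacent to the infinite ends of the long component (above it and below it) are the star regions. A Kauffman state $T$ is an assignment to each vertex of $D$ (crossing or double point) of one of the four corners at that vertex, marked by a dot, such that the star regions contain no dot and every other region of the complement of $D$ contains exactly one dot. (If there are no Kauffman states, the state sum is $0$; for the diagram without vertices consisting of the line only, it is $1$.) At a vertex, rotate the picture so that both strands point upwards, and call the four corners $N$ (between the two outgoing edges), $S$ (between the two incoming edges), $W$ (left) and $E$ (right). The contribution of a dot is: - positive crossing: $W\mapsto 1$, $E\mapsto 1$, $N\mapsto A$, $S\mapsto -A^{-1}$; - negative crossing: $W\mapsto 1$, $E\mapsto 1$, $N\mapsto A^{-1}$, $S\mapsto -A$; - double point: $W\mapsto 1$, $E\mapsto 1$, $N\mapsto B$, $S\mapsto B-A-A^{-1}$, where $B$ is a new independent variable. $\Delta^s_D(A,B)\in\mathbb{Z}[A,A^{-1},B]$ is the sum over all Kauffman states $T$ of the product of the contributions of the dots of $T$. *)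

(* Defs.v *)
From HB Require Import structures.
From mathcomp Require Import all_boot all_order all_algebra.
From Stdlib Require Import Relation_Operators.

Set Implicit Arguments.
Unset Strict Implicit.
Unset Printing Implicit Defensive.

Import GRing.Theory.

(* A plane diagram is read by sweeping a vertical line from left to right.  In
   generic position the sweep line meets the diagram in finitely many strands,
   numbered from bottom to top, and passes one event at a time: a left turning
   point (Cup), a right turning point (Cap) or a vertex.  The diagram is the
   sequence of its slices (i, e), where i is the number of strands below the
   event e.  [Mark] is a base point on a strand; it is used only to single out
   a component.

   [Crossing b] is an ordinary crossing; b is true iff the strand which climbs
   from left to right is the overpass.

   A cross-section is the sequence of the directions of the strands met by the
   sweep line (true = from left to right).  [Cup b] creates a lower strand of
   direction b and an upper one of direction ~~ b. *)
Inductive vertex_kind := Crossing of bool | DoublePoint.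

Inductive event := Cup of bool | Cap | Vertex of vertex_kind | Mark.

Definition slice := (nat * event)%type.
Definition word := seq slice.

Definition inputs (e : event) : nat :=
  match e with Cup _ => 0 | Cap => 2 | Vertex _ => 2 | Mark => 1 end.

Definition outputs (e : event) : nat :=
  match e with Cup _ => 2 | Cap => 0 | Vertex _ => 2 | Mark => 1 end.

Definition turn (e : event) (s : seq bool) : seq bool :=
  match e with
  | Cup b => [:: b; ~~ b]
  | Cap => [::]
  | Vertex _ => rev s
  | Mark => s
  end.

Definition sweep (s : seq bool) (x : slice) : seq bool :=
  take x.1 s ++ turn x.2 (take (inputs x.2) (drop x.1 s))
             ++ drop (x.1 + inputs x.2) s.

Definition legal_slice (s : seq bool) (x : slice) : bool :=
  (x.1 + inputs x.2 <= size s) &&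
  (if x.2 is Cap then nth true s x.1 != nth true s x.1.+1 else true).

Fixpoint legal (s : seq bool) (w : word) : bool :=
  if w is x :: w' then legal_slice s x && legal (sweep s x) w' else true.

Definition tangle (s t : seq bool) (w : word) : bool :=
  legal s w && (foldl sweep s w == t).

Definition is_mark (e : event) : bool := if e is Mark then true else false.
Definition is_vertex (e : event) : bool := if e is Vertex _ then true else false.

Definition marks (w : word) : nat := count (fun x : slice => is_mark x.2) w.

Definition link_diagram (w : word) : bool :=
  tangle [::] [::] w && (marks w == 0).

Definition long_diagram (w : word) : bool :=
  tangle [:: true] [:: true] w && (marks w == 0).

(* Joins the two ends of the long component by an arc passing above the
   diagram, and marks the resulting closed component. *)
Definition close_up (w : word) : word :=
  [:: (0, Cup true); (0, Mark)] ++ w ++ [:: (0, Cap)].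

Definition mirror (v : vertex_kind) : vertex_kind :=
  if v is Crossing b then Crossing (~~ b) else DoublePoint.

(* [local_move l r]: the piece l of a diagram may be replaced by r.  The directions
   of the strands entering the piece are arbitrary, so that each clause stands
   for all the orientations of the move. *)
Inductive local_move : word -> word -> Prop :=
(* planar isotopy in one-parameter families: two events exchange their
   abscissas, two turning points cancel, or one of the strands through a vertex
   becomes vertical there and its turning point passes through the vertex
   (which then sees the strand climbing instead of descending) *)
| move_exchange i k e f :
    local_move [:: (i, e); (i + outputs e + k, f)] [:: (i + inputs e + k, f); (i, e)]
| move_zigzag_up i b : local_move [:: (i, Cup b); (i.+1, Cap)] [::]
| move_zigzag_down i b : local_move [:: (i.+1, Cup b); (i, Cap)] [::]
| move_vertex_cap i v :
    local_move [:: (i, Vertex v); (i.+1, Cap)] [:: (i.+1, Vertex (mirror v)); (i, Cap)]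
| move_vertex_cup i b v :
    local_move [:: (i.+1, Cup b); (i, Vertex v)]
         [:: (i, Cup b); (i.+1, Vertex (mirror v))]
(* Reidemeister I *)
| move_R1_up i b c :
    local_move [:: (i.+1, Cup b); (i, Vertex (Crossing c)); (i.+1, Cap)] [::]
| move_R1_down i b c :
    local_move [:: (i, Cup b); (i.+1, Vertex (Crossing c)); (i, Cap)] [::]
(* Reidemeister II *)
| move_R2 i c :
    local_move [:: (i, Vertex (Crossing c)); (i, Vertex (Crossing (~~ c)))] [::]
(* Reidemeister III and SIII: the bottom (resp. top, middle) strand of three
   passes entirely over or entirely under the vertex v of the other two, which
   is an ordinary crossing or a double point *)
| move_R3_bottom i c v :
    local_move [:: (i, Vertex (Crossing c)); (i.+1, Vertex (Crossing c)); (i, Vertex v)]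
         [:: (i.+1, Vertex v); (i, Vertex (Crossing c)); (i.+1, Vertex (Crossing c))]
| move_R3_top i c v :
    local_move [:: (i, Vertex v); (i.+1, Vertex (Crossing c)); (i, Vertex (Crossing c))]
         [:: (i.+1, Vertex (Crossing c)); (i, Vertex (Crossing c)); (i.+1, Vertex v)]
| move_R3_middle i c v :
    local_move [:: (i, Vertex (Crossing c)); (i.+1, Vertex v); (i, Vertex (Crossing (~~ c)))]
         [:: (i.+1, Vertex (Crossing (~~ c))); (i, Vertex v); (i.+1, Vertex (Crossing c))]
(* SII *)
| move_S2 i c :
    local_move [:: (i, Vertex (Crossing c)); (i, Vertex DoublePoint)]
         [:: (i, Vertex DoublePoint); (i, Vertex (Crossing c))]
(* the mark only remembers the component on which it lies: it slides freely
   along it, also through vertices *)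
| move_mark_cup i b :
    local_move [:: (i, Cup b); (i, Mark)] [:: (i, Cup b); (i.+1, Mark)]
| move_mark_cap i : local_move [:: (i, Mark); (i, Cap)] [:: (i.+1, Mark); (i, Cap)]
| move_mark_climb i v :
    local_move [:: (i, Mark); (i, Vertex v)] [:: (i, Vertex v); (i.+1, Mark)]
| move_mark_descend i v :
    local_move [:: (i.+1, Mark); (i, Vertex v)] [:: (i, Vertex v); (i, Mark)].

Inductive one_move : word -> word -> Prop :=
| One_move u l r v of local_move l r
    & tangle [::] [::] (u ++ l ++ v) & tangle [::] [::] (u ++ r ++ v) :
    one_move (u ++ l ++ v) (u ++ r ++ v).

(* Two closed diagrams represent the same oriented singular link. *)
Definition isotopic : word -> word -> Prop := clos_refl_sym_trans word one_move.

(* Two long diagrams represent the same oriented singular link with a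
   distinguished component.  The point at which that component was opened is
   not part of the link. *)
Definition long_isotopic (w w' : word) : Prop :=
  isotopic (close_up w) (close_up w').

Definition slice_at (w : word) (j : nat) : slice := nth (0, Mark) w j.

Definition vertices (w : word) : {set 'I_(size w)} :=
  [set j : 'I_(size w) | is_vertex (slice_at w j).2].

Section Sections.
(* the cross-section at the left end: [::] for closed and [:: true] for long
   diagrams *)
Variables (s : seq bool) (w : word).

(* Level l is the sweep line between the slices l.-1 and l. *)
Definition level (l : nat) : seq bool := foldl sweep s (take l w).

(* the directions, at slice j, of the climbing and of the descending strand *)
Definition climbing (j : nat) : bool := nth true (level j) (slice_at w j).1.
Definition descending (j : nat) : bool := nth true (level j) (slice_at w j).1.+1.

Definition parallel (j : nat) : bool := climbing j == descending j.

(* With both strands pointing to the right, the crossing is positive iff the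
   descending strand is the overpass. *)
Definition positive (j : nat) (c : bool) : bool := c != parallel j.

Definition crossing_sign (j : nat) : int :=
  if (slice_at w j).2 is Vertex (Crossing c) then
    if positive j c then 1%R else (-1)%R
  else 0%R.

Definition writhe : int := (\sum_(j < size w) crossing_sign j)%R.

(* Points (l, p): the p-th strand at level l. *)
Definition point := {l : 'I_(size w).+1 & 'I_(size (level l))}.

Definition arc_at (j : nat) (x : slice) (a b : nat * nat) : bool :=
  let: (i, e) := x in let: (l, p) := a in let: (l', q) := b in
  [&& l == j, l' == j.+1 &
    [|| (p < i) && (q == p),
        (i + inputs e <= p) && (q + inputs e == p + outputs e)
      | match e with
        | Vertex _ => ((p == i) && (q == i.+1)) || ((p == i.+1) && (q == i))
        | Mark => (p == i) && (q == i)
        | _ => false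
        end]]
  || match e with
     | Cup _ => [&& l == j.+1, l' == j.+1, p == i & q == i.+1]
     | Cap => [&& l == j, l' == j, p == i & q == i.+1]
     | _ => false
     end.

Definition joined (a b : point) : bool :=
  [exists j : 'I_(size w),
    arc_at j (slice_at w j) (tag a : nat, tagged a : nat)
                            (tag b : nat, tagged b : nat)].

(* the number of components of the curve, strands going straight through the
   vertices *)
Definition components : nat := n_comp [rel a b | joined a b || joined b a] predT.

(* Cells (l, g): the g-th interval, from bottom to top, of the complement of
   the diagram in the sweep line at level l.  The regions of the complement of
   the diagram are the classes of cells under [same_region]. *)
Definition cell := {l : 'I_(size w).+1 & 'I_(size (level l)).+1}.

Definition mkcell (l g : nat) : cell :=
  Tagged (fun l : 'I_(size w).+1 => 'I_(size (level l)).+1)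
    (inord g : 'I_(size (level (inord l : 'I_(size w).+1))).+1).

Definition adjacent (a b : cell) : bool :=
  let: (i, e) := slice_at w (tag a) in
  let g : nat := tagged a in let g' : nat := tagged b in
  (tag b == (tag a).+1 :> nat) &&
  ((g <= i) && (g' == g) ||
   (i + inputs e <= g) && (g' + inputs e == g + outputs e)).

Definition same_region : rel cell :=
  connect [rel a b | adjacent a b || adjacent b a].

End Sections.

(* Equalities in Z[A,A^-1,B,B^-1] are stated in its fraction field Q(A,B). *)
Definition K : fieldType := {fraction {poly {poly int}}}.
Definition vA : K := tofrac ('X%:P)%R.
Definition vB : K := tofrac 'X%R.

Local Open Scope ring_scope.

(* A state is given by the set S of the vertices which receive the oriented
   smoothing.  In a slice the two smoothings of a vertex are two horizontal
   arcs, i.e. nothing, and a right turning point followed by a left one; the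
   former is the oriented smoothing iff the strands are parallel.  Smoothed
   words are used without their orientations. *)
Definition smooth_at (w : word) (S : {set 'I_(size w)}) (j : 'I_(size w)) : word :=
  let: (i, e) := slice_at w j in
  if e is Vertex _ then
    if (j \in S) == parallel [::] w j then [::] else [:: (i, Cap); (i, Cup true)]
  else [:: (i, e)].

Definition smooth (w : word) (S : {set 'I_(size w)}) : word :=
  flatten [seq smooth_at S j | j <- enum 'I_(size w)].

Definition circles (w : word) (S : {set 'I_(size w)}) : nat :=
  components [::] (smooth S).

Definition smoothing_weight (w : word) (S : {set 'I_(size w)}) (j : 'I_(size w)) : K :=
  match (slice_at w j).2 with
  | Vertex (Crossing c) =>
      if positive [::] w j c == (j \in S) then vA else vA^-1
  | Vertex DoublePoint => if j \in S then vB else vB^-1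
  | _ => 1
  end.

(* [circles S] is positive except for the empty diagram. *)
Definition bracket (w : word) : K :=
  \sum_(S : {set 'I_(size w)} | S \subset vertices w)
    (\prod_(j in vertices w) smoothing_weight S j) *
    (- vA ^+ 2 - vA ^- 2) ^+ (circles S).-1.

Inductive corner := North | South | West | East.

Definition corner_code (c : corner) : bool * bool :=
  match c with
  | North => (true, true) | South => (true, false)
  | West => (false, true) | East => (false, false)
  end.

Definition corner_decode (b : bool * bool) : corner :=
  match b with
  | (true, true) => North | (true, false) => South
  | (false, true) => West | (false, false) => East
  end.

Lemma corner_codeK : cancel corner_code corner_decode.
Proof. by case. Qed.

HB.instance Definition _ := Finite.copy corner (can_type corner_codeK).

Inductive side := Leftward | Rightward | Upward | Downward.

(* Where the corner c lies in the plane, for strands of directions d (climbing)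
   and d' (descending). *)
Definition corner_side (d d' : bool) (c : corner) : side :=
  match d, d', c with
  | true, true, North => Rightward | true, true, South => Leftward
  | true, true, West => Upward     | true, true, East => Downward
  | false, false, North => Leftward | false, false, South => Rightward
  | false, false, West => Downward  | false, false, East => Upward
  | true, false, North => Upward    | true, false, South => Downward
  | true, false, West => Leftward   | true, false, East => Rightward
  | false, true, North => Downward  | false, true, South => Upward
  | false, true, West => Rightward  | false, true, East => Leftward
  end.

Section Alexander.
Variable w : word.

(* a cell of the region in which a dot at the corner c of the vertex j lies *)
Definition corner_cell (j : nat) (c : corner) : cell [:: true] w :=
  let i := (slice_at w j).1 in
  match corner_side (climbing [:: true] w j) (descending [:: true] w j) c with
  | Leftward => mkcell [:: true] w j i.+1
  | Rightward => mkcell [:: true] w j.+1 i.+1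
  | Upward => mkcell [:: true] w j i.+2
  | Downward => mkcell [:: true] w j i
  end.

Definition vertex := {j : 'I_(size w) | j \in vertices w}.

Definition dots := {ffun vertex -> corner}.

(* The cells (0, 0) and (0, 1) lie below and above the left end of the line. *)
Definition in_star (a : cell [:: true] w) : bool :=
  same_region (mkcell [:: true] w 0 0) a || same_region (mkcell [:: true] w 0 1) a.

Definition kauffman_state (T : dots) : bool :=
  [forall a : cell [:: true] w,
    #|[set j : vertex | same_region (corner_cell (val j) (T j)) a]| == ~~ in_star a :> nat].

Definition dot_weight (j : nat) (c : corner) : K :=
  match (slice_at w j).2, c with
  | _, West | _, East => 1
  | Vertex (Crossing b), North => if positive [:: true] w j b then vA else vA^-1
  | Vertex (Crossing b), South => if positive [:: true] w j b then - vA^-1 else - vA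
  | Vertex DoublePoint, North => vB
  | Vertex DoublePoint, South => vB - vA - vA^-1
  | _, _ => 1
  end.

Definition Delta : K :=
  \sum_(T : dots | kauffman_state T) \prod_(j : vertex) dot_weight (val j) (T j).

End Alexander.

(* Main.v *)
Require Import Defs.
From mathcomp Require Import all_boot all_order all_algebra.
From mathcomp Require Import ring zify.
From Stdlib Require Import Relation_Operators FunctionalExtensionality.

Set Implicit Arguments.
Unset Strict Implicit.
Unset Printing Implicit Defensive.

Import GRing.Theory.

Local Open Scope ring_scope.

(* Both state sums are turned into transfer matrices along the sweep line, and
   invariance becomes a list of identities between pieces of diagrams.

   For Delta, the sweep line carries one bit per cell, telling whether the
   region of the cell still expects its dot from the right.  Each slice acts
   linearly on the functions of these bits, both sides of every local move act
   in the same way, and an operator which adds one missing dot commutes with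
   all slices; this takes care of the two ends of the diagram, and makes the
   value of a closed diagram independent of the place where it is opened.  That
   the evaluation of the operators is the sum over Kauffman states is shown by
   naming the regions met by the sweep line.  The only obstruction is a right
   turning point which joins a region to itself: then the state sum is empty,
   there being too many regions, and the evaluation vanishes because removing a
   missing dot gives the same result at all the cells of a region.

   For the bracket, 2 ^ (number of circles) counts the two-colourings of the
   circles, a transfer matrix again, which gives the Temperley-Lieb relations
   between flat pieces.  The moves then follow by expanding their vertices. *)

(** A missing dot is recorded at the cell through which it will enter its region, so a vector has a
    value for every choice of such cells, and the global condition of one dot per region becomes
    local: a right turning point only has to reconcile the two cells on its sides. The operators
    that add or remove a missing dot obey the sign rule of an exterior algebra on the cells. Adding
    has two independent solutions, whose weights change by A or by A^-1 across a strand pointing to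
    the right. Each of them gives zero at the right end of a closed diagram; their difference is A -
    A^-1 times the equality of the values for two openings, hence the need to cancel A - A^-1. At
    every kind of vertex the weight of S is that of N minus A + A^-1. So the weight of N can be kept
    as an unknown, and SIII is proved together with Reidemeister III. For the bracket, the number of
    circles is not itself a sum over slices. Two flat pieces are compared through their transfer
    matrices up to a factor 2^k, and a logarithm turns this into k additional circles in any
    surrounding diagram. *)

Local Notation label := (nat * nat)%type.

(** * Lists *)

Lemma cut3 (T : Type) (t : seq T) i : (i.+2 < size t)%N ->
  exists P x y z Q, t = P ++ [:: x, y, z & Q] /\ size P = i.
Proof.
move=> lt_i; case def_t: (drop i t) => [|x [|y [|z Q]]];
  try by have := congr1 size def_t; rewrite size_drop /=; lia.
exists (take i t), x, y, z, Q; rewrite -def_t cat_take_drop size_takel //; lia.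
Qed.

Lemma cut1 (T : Type) (t : seq T) i : (i < size t)%N ->
  exists P x Q, t = P ++ x :: Q /\ size P = i.
Proof.
move=> lt_i; case def_t: (drop i t) => [|x Q];
  first by have := congr1 size def_t; rewrite size_drop /=; lia.
exists (take i t), x, Q; rewrite -def_t cat_take_drop size_takel //; lia.
Qed.

Lemma nth_split (T : Type) (x0 : T) P Q k : nth x0 (P ++ Q) (size P + k) = nth x0 Q k.
Proof. by rewrite nth_cat ltnNge leq_addr addKn. Qed.

Lemma take_split (T : Type) (P Q : seq T) k : take (size P + k) (P ++ Q) = P ++ take k Q.
Proof. by rewrite takeD take_size_cat // drop_size_cat. Qed.

Lemma drop_split (T : Type) (P Q : seq T) k : drop (size P + k) (P ++ Q) = drop k Q.
Proof. by rewrite addnC -drop_drop drop_size_cat. Qed.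

Lemma take1_split (T : Type) P (x : T) Q : take (size P).+1 (P ++ x :: Q) = P ++ [:: x].
Proof. by rewrite -addn1 take_split /= take0. Qed.

Lemma drop2_split (T : Type) P (x y : T) Q : drop (size P).+2 (P ++ [:: x, y & Q]) = Q.
Proof. by rewrite -addn2 drop_split /= drop0. Qed.

Lemma drop3_split (T : Type) P (x y z : T) Q : drop (size P).+3 (P ++ [:: x, y, z & Q]) = Q.
Proof. by rewrite -addn3 drop_split /= drop0. Qed.

Lemma nth_cut (T : Type) (x0 : T) (t u : seq T) i g : (i < size t)%N ->
  nth x0 (take i.+1 t ++ u) g = if (g <= i)%N then nth x0 t g else nth x0 u (g - i.+1).
Proof.
by move=> lt_i; rewrite nth_cat size_takel // ltnS; case: ifP => // le_gi; rewrite nth_take.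
Qed.

(** * Slices *)

Lemma sweep_cons c s i e : sweep (c :: s) (i.+1, e) = c :: sweep s (i, e).
Proof. by []. Qed.

Lemma sweep_cup b' s : sweep s (0%N, Cup b') = [:: b', ~~ b' & s].
Proof. by rewrite /sweep /= take0 drop0. Qed.

Lemma sweep_cap c d s : sweep [:: c, d & s] (0%N, Cap) = s.
Proof. by rewrite /sweep /= drop0. Qed.

Lemma sweep_vertex c d s v : sweep [:: c, d & s] (0%N, Vertex v) = [:: d, c & s].
Proof. by rewrite /sweep /= take0 drop0. Qed.

Lemma sweep_mark c s : sweep (c :: s) (0%N, Mark) = c :: s.
Proof. by rewrite /sweep /= take0 drop0. Qed.

Definition sweepE := (sweep_cons, sweep_cup, sweep_cap, sweep_vertex, sweep_mark).

Lemma sweep_Mark s i : (i < size s)%N -> sweep s (i, Mark) = s.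
Proof.
move=> lt_is; rewrite /sweep /= -[RHS](cat_take_drop i) (drop_nth true) //=.
by rewrite take0 addn1.
Qed.

Lemma size_sweep s x : legal_slice s x ->
  (size (sweep s x) + inputs x.2 = size s + outputs x.2)%N.
Proof.
case: x => i e; rewrite /legal_slice /sweep !size_cat !size_drop /= => /andP[le_i _].
rewrite size_takel; last by lia.
have size_in : size (take (inputs e) (drop i s)) = inputs e.
  by rewrite size_takel // size_drop; lia.
by case: e le_i size_in => [b0||v|] /= le_i size_in; rewrite ?size_rev ?size_in; lia.
Qed.

Lemma legal_cat s u v : legal s (u ++ v) = legal s u && legal (foldl sweep s u) v.
Proof. by elim: u s => //= x u IH s; rewrite IH andbA. Qed.

Definition shift (k : nat) (w : word) : word := [seq (k + x.1, x.2)%N | x <- w].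

Lemma sweep_cat P s i e : sweep (P ++ s) (size P + i, e)%N = P ++ sweep s (i, e).
Proof. by elim: P => //= c P IH; rewrite addSn sweep_cons IH. Qed.

Lemma legal_slice_cat P s i e :
  legal_slice (P ++ s) (size P + i, e)%N = legal_slice s (i, e).
Proof. by elim: P. Qed.

Lemma sweeps_shift P s w : foldl sweep (P ++ s) (shift (size P) w) = P ++ foldl sweep s w.
Proof. by elim: w s => //= -[i e] w IH s; rewrite sweep_cat IH. Qed.

Lemma legal_shift P s w : legal (P ++ s) (shift (size P) w) = legal s w.
Proof. by elim: w s => //= -[i e] w IH s; rewrite sweep_cat legal_slice_cat IH. Qed.

Lemma legal_size s x w : legal s (x :: w) ->
  [/\ (x.1 + inputs x.2 <= size s)%N,
      (size (sweep s x) + inputs x.2 = size s + outputs x.2)%N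
    & legal (sweep s x) w].
Proof. by move=> /= /andP[legx ->]; rewrite size_sweep //; case/andP: legx. Qed.

Ltac legal_sizes H :=
  lazymatch type of H with
  | is_true (legal _ [::]) => clear H
  | _ => let le := fresh "le" in let sz := fresh "sz" in let H' := fresh "leg" in
    have := legal_size H; rewrite [_.1]/= [_.2]/=; case=> le sz H'; clear H; legal_sizes H'
  end.

Lemma first_slice x : legal_slice [::] x -> exists c, x = (0%N, Cup c).
Proof.
by case: x => [[|i] [c||v|]]; rewrite /legal_slice //= ?addn0 //; exists c.
Qed.

Lemma last_slice s x : legal_slice s x -> sweep s x = [::] ->
  x = (0%N, Cap) /\ size s = 2.
Proof.
move=> legx end0; have := size_sweep legx; rewrite end0 => sz; move: legx.
case: x {end0} sz => i [c||v|]; rewrite /legal_slice /= => sz /andP[le_i _]; try lia.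
by split; [congr (_, _)|]; lia.
Qed.

(** To the left of the first slice there is no strand, and every other move needs one. These cases
    are singled out because the value of a closed diagram ignores its first slice. *)
Lemma local_move_nil l r : local_move l r -> legal [::] l -> legal [::] r ->
  (exists c d, l = [:: (0, Cup c); (2, Cup d)]%N /\ r = [:: (0, Cup d); (0, Cup c)]%N) \/
  (exists c, l = [:: (0, Cup c); (0, Mark)]%N /\ r = [:: (0, Cup c); (1, Mark)]%N).
Proof.
case=> {l r}.
- move=> i k e g legl legr; left; have := legl => /= /andP[/first_slice[c [_ ->]] _].
  have := legr => /= /andP[/first_slice[d [eqk ->]] _]; exists c, d.
  by have [-> ->] : i = 0%N /\ k = 0%N by lia.
all: try (by move=> i b0 legl _; legal_sizes legl; simpl in *; lia).
all: try (by move=> i b0 c legl _; legal_sizes legl; simpl in *; lia).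
- move=> i c legl _; right; exists c; legal_sizes legl; simpl in *.
  by have -> : i = 0%N by lia.
- by move=> i legl _; legal_sizes legl; simpl in *; lia.
Qed.

(** Counterpart at the right end, where the last slice is ignored: all other moves leave a strand
    behind. *)
Lemma local_move_end s l r : local_move l r -> legal s l -> legal s r ->
  foldl sweep s l = [::] ->
  [/\ size s = 4, l = [:: (0, Cap); (0, Cap)]%N & r = [:: (2, Cap); (0, Cap)]%N] \/
  (exists i, l = [:: (i, Mark); (i, Cap)] /\ r = [:: (i.+1, Mark); (i, Cap)]).
Proof.
case=> {l r}.
- move=> i k e g legl _ /(congr1 size) /= sz0; legal_sizes legl; left; simpl in *.
  move: le le0 sz sz0 sz1; case: e => [c||v|] /=; case: g => [d||v'|] /= *; try lia.
  have [-> ->] : i = 0%N /\ k = 0%N by lia.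
  by split=> //; lia.
all: try (by move=> i b0 legl _ /(congr1 size) /= sz0; legal_sizes legl; simpl in *; lia).
all: try (by move=> i b0 c legl _ /(congr1 size) /= sz0; legal_sizes legl; simpl in *; lia).
all: move=> i.
all: try (by move=> legl _ /(congr1 size) /= sz0; legal_sizes legl; simpl in *; lia).
by move=> _ _ _; right; exists i.
Qed.

(** * The transfer operators *)

Section Transfer.
Variables (R : comNzRingType) (a a' b : R).
Hypothesis aa : a * a' = 1.
Local Notation vec := (seq bool -> R).
Local Notation operator := (vec -> vec).

(* Vectors at a level with m strands are functions of m.+1 bits, one for each
   cell from bottom to top; a bit is set when the region of the cell still
   expects its dot from the right.  [at_pos i F] is F acting on the cells from
   the i-th on; it is 0 on lists which are too short. *)
Fixpoint at_pos (i : nat) (F : operator) (f : vec) (n : seq bool) : R :=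
  match i, n with
  | 0, _ => F f n
  | i'.+1, c :: n' => at_pos i' F (fun m => f (c :: m)) n'
  | _, _ => 0
  end.

(** The bits [n] are those after the slice. The middle cell starts a new region, which has no dot
    yet, so [y] must be set; the two outer cells belong to one region, which expects at most one
    dot. *)
Definition cup_op : operator := fun f n =>
  if n is [:: x, y, z & q] then
    if y && ~~ (x && z) then f ((x || z) :: q) else 0
  else 0.

(** The regions of the outer cells merge. If the result still expects its dot, neither of them has
    one yet; otherwise exactly one of them has. No dot can enter through the enclosed cell any
    more. *)
Definition cap_op : operator := fun f n =>
  if n is x :: q then
    if x then f [:: true, false, true & q]
    else f [:: false, false, true & q] + f [:: true, false, false & q]
  else 0.

(** The middle cell after the vertex is a new region. If it no longer expects its dot, the dot of
    the vertex lies there, on the right; otherwise that dot goes to one of the three older cells,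
    and an upper or lower cell which receives it cannot be set afterwards as well. *)
Definition vertex_op (wt : side -> R) : operator := fun f n =>
  if n is [:: x, y, z & q] then
    if y then
      wt Leftward * f [:: x, true, z & q]
      + (if z then 0 else wt Upward * f [:: x, false, true & q])
      + (if x then 0 else wt Downward * f [:: true, false, z & q])
    else wt Rightward * f [:: x, false, z & q]
  else 0.

(* a, a' and b stand for A, A^-1 and B; likewise b' below for B^-1. *)
Definition north_weight (d d' : bool) (v : vertex_kind) : R :=
  match v with
  | Crossing c => if c != (d == d') then a else a'
  | DoublePoint => b
  end.

(* [x - a - a'] is - A^-1, - A or B - A - A^-1 according to the vertex. *)
Definition side_weight (d d' : bool) (v : vertex_kind) (sd : side) : R :=
  let x := north_weight d d' v in
  let y := x - a - a' in
  match d, d', sd with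
  | true, true, Rightward | false, false, Leftward => x
  | true, true, Leftward | false, false, Rightward => y
  | true, false, Upward | false, true, Downward => x
  | true, false, Downward | false, true, Upward => y
  | _, _, _ => 1
  end.

Definition slice_op (s : seq bool) (x : slice) : operator :=
  match x.2 with
  | Cup _ => at_pos x.1 cup_op
  | Cap => at_pos x.1 cap_op
  | Vertex v => at_pos x.1 (vertex_op (side_weight (nth true s x.1) (nth true s x.1.+1) v))
  | Mark => id
  end.

Fixpoint eval (s : seq bool) (w : word) (f : vec) : vec :=
  if w is x :: w' then eval (sweep s x) w' (slice_op s x f) else f.

(** * Local identities between transfer operators *)

Definition same_op (l r : word) : Prop := forall s f n,
  legal s l -> legal s r -> size n = (size (foldl sweep s l)).+1 ->
  eval s l f n = eval s r f n.

Lemma same_zigzag_up b0 : same_op [:: (0, Cup b0); (1, Cap)]%N [::].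
Proof.
by move=> [|a1 s] f n; rewrite /= /slice_op /legal_slice ?sweepE ?andbF //=;
   case: n => [|[] [|[] n]] //=; rewrite ?addr0 ?add0r.
Qed.

Lemma same_zigzag_down b0 : same_op [:: (1, Cup b0); (0, Cap)]%N [::].
Proof.
by move=> [|a1 s] f n; rewrite /= /slice_op /legal_slice ?sweepE ?andbF //=;
   case: n => [|[] [|[] n]] //=; rewrite ?addr0 ?add0r.
Qed.

Lemma same_R2 c : same_op [:: (0, Vertex (Crossing c)); (0, Vertex (Crossing (~~ c)))]%N [::].
Proof.
move=> [|a1 [|a2 s]] f n; rewrite /= /slice_op /legal_slice ?sweepE ?andbF //=.
move=> _ _; case: n => [|n0 [|n1 [|n2 n]]] //= _.
by case: c; case: a1; case: a2; rewrite /side_weight /vertex_op /=; case: n0; case: n1; case: n2 => /=; ring: aa.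
Qed.

Lemma same_S2 c : same_op [:: (0, Vertex (Crossing c)); (0, Vertex DoublePoint)]%N
         [:: (0, Vertex DoublePoint); (0, Vertex (Crossing c))]%N.
Proof.
move=> [|a1 [|a2 s]] f n; rewrite /= /slice_op /legal_slice ?sweepE ?andbF //=.
move=> _ _; case: n => [|n0 [|n1 [|n2 n]]] //= _.
by case: c; case: a1; case: a2; rewrite /side_weight /vertex_op /=; case: n0; case: n1; case: n2 => /=; ring: aa.
Qed.

Lemma same_vertex_cap v :
  same_op [:: (0, Vertex v); (1, Cap)]%N [:: (1, Vertex (mirror v)); (0, Cap)]%N.
Proof.
move=> [|a1 [|a2 [|a3 s]]] f n; rewrite /= /slice_op /legal_slice ?sweepE ?andbF //= !andbT => ne _.
case: n => [|n0 [|n1 n]] //= _.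
by case: v => [c|]; [case: c|]; move: ne; case: a1; case: a2; case: a3 => //= _;
  rewrite /side_weight /vertex_op /=; case: n0; case: n1 => /=; ring: aa.
Qed.

Lemma same_vertex_cup b0 v :
  same_op [:: (1, Cup b0); (0, Vertex v)]%N [:: (0, Cup b0); (1, Vertex (mirror v))]%N.
Proof.
move=> [|a1 s] f n; rewrite /= /slice_op /legal_slice ?sweepE ?andbF //= => _ _.
case: n => [|n0 [|n1 [|n2 [|n3 n]]]] //= _.
by case: v => [c|]; [case: c|]; case: a1; case: b0;
  rewrite /side_weight /vertex_op /=; case: n0; case: n1; case: n2; case: n3 => /=; ring: aa.
Qed.

Lemma same_R1_up b0 c :
  same_op [:: (1, Cup b0); (0, Vertex (Crossing c)); (1, Cap)]%N [::].
Proof.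
move=> [|a1 s] f n; rewrite /= /slice_op /legal_slice ?sweepE ?andbF //= !andbT => ne _.
case: n => [|n0 [|n1 n]] //= _; move: ne.
by case: c; case: a1; case: b0 => //= _;
  rewrite /side_weight /vertex_op /=; case: n0; case: n1 => /=; ring: aa.
Qed.

Lemma same_R1_down b0 c :
  same_op [:: (0, Cup b0); (1, Vertex (Crossing c)); (0, Cap)]%N [::].
Proof.
move=> [|a1 s] f n; rewrite /= /slice_op /legal_slice ?sweepE ?andbF //= !andbT => ne _.
case: n => [|n0 [|n1 n]] //= _; move: ne.
by case: c; case: a1; case: b0 => //= _;
  rewrite /side_weight /vertex_op /=; case: n0; case: n1 => /=; ring: aa.
Qed.

Lemma same_R3_bottom c v :
  same_op [:: (0, Vertex (Crossing c)); (1, Vertex (Crossing c)); (0, Vertex v)]%N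
          [:: (1, Vertex v); (0, Vertex (Crossing c)); (1, Vertex (Crossing c))]%N.
Proof.
move=> [|a1 [|a2 [|a3 s]]] f n; rewrite /= /slice_op /legal_slice ?sweepE ?andbF //= => _ _.
case: n => [|n0 [|n1 [|n2 [|n3 n]]]] //= _.
(* The vertex [v] enters only through [p] and [p - a - a']; with [p] kept general, ordinary
   crossings and double points are treated at once. *)
rewrite /side_weight; set p := north_weight a2 a3 v.
by case: c; case: a1; case: a2 @p => p; case: a3 @p => p;
   rewrite /vertex_op /=; case: n0; case: n1; case: n2; case: n3 => /=; ring: aa.
Qed.

Lemma same_R3_top c v :
  same_op [:: (0, Vertex v); (1, Vertex (Crossing c)); (0, Vertex (Crossing c))]%N
          [:: (1, Vertex (Crossing c)); (0, Vertex (Crossing c)); (1, Vertex v)]%N.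
Proof.
move=> [|a1 [|a2 [|a3 s]]] f n; rewrite /= /slice_op /legal_slice ?sweepE ?andbF //= => _ _.
case: n => [|n0 [|n1 [|n2 [|n3 n]]]] //= _.
rewrite /side_weight; set p := north_weight a1 a2 v.
by case: c; case: a1 @p => p; case: a2 @p => p; case: a3;
   rewrite /vertex_op /=; case: n0; case: n1; case: n2; case: n3 => /=; ring: aa.
Qed.

Lemma same_R3_middle c v :
  same_op [:: (0, Vertex (Crossing c)); (1, Vertex v); (0, Vertex (Crossing (~~ c)))]%N
          [:: (1, Vertex (Crossing (~~ c))); (0, Vertex v); (1, Vertex (Crossing c))]%N.
Proof.
move=> [|a1 [|a2 [|a3 s]]] f n; rewrite /= /slice_op /legal_slice ?sweepE ?andbF //= => _ _.
case: n => [|n0 [|n1 [|n2 [|n3 n]]]] //= _.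
rewrite /side_weight; set p := north_weight a1 a3 v.
by case: c; case: a1 @p => p; case: a2; case: a3 @p => p;
   rewrite /vertex_op /=; case: n0; case: n1; case: n2; case: n3 => /=; ring: aa.
Qed.

(** * Translation and linearity of the operators *)

Lemma at_pos_cat p i F (f : vec) n :
  at_pos (size p + i) F f (p ++ n) = at_pos i F (fun m => f (p ++ m)) n.
Proof. by elim: p f => //= c p IH f; rewrite IH. Qed.

Lemma slice_op_cat P s i e (f : vec) p n : size p = size P ->
  slice_op (P ++ s) (size P + i, e)%N f (p ++ n)
  = slice_op s (i, e) (fun m => f (p ++ m)) n.
Proof.
by move=> eq_pP; case: e => [b0||v|] //=; rewrite /slice_op /= -eq_pP ?at_pos_cat //
  eq_pP -!addnS !nth_cat !ltnNge !leq_addr /= !addKn.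
Qed.

Lemma eval_shift P s w (f : vec) p n : size p = size P ->
  eval (P ++ s) (shift (size P) w) f (p ++ n) = eval s w (fun m => f (p ++ m)) n.
Proof.
move=> eq_pP; elim: w s f => //= -[i e] w IH s f; rewrite sweep_cat IH.
by congr (eval _ _ _ _); apply: functional_extensionality => m; rewrite slice_op_cat.
Qed.

Lemma same_op_shift i l r : same_op l r -> forall s f n, (i <= size s)%N ->
  legal s (shift i l) -> legal s (shift i r) ->
  size n = (size (foldl sweep s (shift i l))).+1 ->
  eval s (shift i l) f n = eval s (shift i r) f n.
Proof.
move=> lr s f n le_is.
have [P [Q [-> <-]]] : exists P Q, s = P ++ Q /\ size P = i.
  by exists (take i s), (drop i s); rewrite cat_take_drop size_takel.
rewrite !legal_shift sweeps_shift size_cat -addnS => legl legr size_n.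
have [p [q [def_n size_p]]] : exists p q, n = p ++ q /\ size p = size P.
  exists (take (size P) n), (drop (size P) n).
  by rewrite cat_take_drop size_takel // size_n leq_addr.
rewrite def_n !eval_shift //; apply: lr => //.
by apply/(@addnI (size p)); rewrite -size_cat -def_n size_n size_p.
Qed.

Definition linear_op (F : operator) : Prop := forall k f g n,
  F (fun m => k * f m + g m) n = k * F f n + F g n.

Section Linear.
Variables (F : operator).
Hypothesis linF : linear_op F.

Lemma linear_opD f g n : F (fun m => f m + g m) n = F f n + F g n.
Proof.
rewrite -[F f n]mul1r -linF; congr (F _ n).
by apply: functional_extensionality => m; rewrite mul1r.
Qed.

Lemma linear_op0 n : F (fun=> 0) n = 0.
Proof.
by apply: (addrI (F (fun=> 0) n)); rewrite -linear_opD !addr0.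
Qed.

Lemma linear_opZ k f n : F (fun m => k * f m) n = k * F f n.
Proof.
rewrite -[RHS]addr0 -(linear_op0 n) -linF; congr (F _ n).
by apply: functional_extensionality => m; rewrite addr0.
Qed.

Lemma linear_at_pos i : linear_op (at_pos i F).
Proof. by elim: i => [|i IH] k f g [|c n] //=; rewrite mulr0 addr0. Qed.

End Linear.

Lemma linear_cup_op : linear_op (cup_op).
Proof.
by move=> k f g [|x [|y [|z n]]] /=; rewrite ?mulr0 ?addr0 //; case: ifP; rewrite ?mulr0 ?addr0.
Qed.

Lemma linear_cap_op : linear_op (cap_op).
Proof.
by move=> k f g [|x n] /=; rewrite ?mulr0 ?addr0 //; case: ifP => // _; ring.
Qed.

Lemma linear_vertex_op wt : linear_op (vertex_op wt).
Proof.
move=> k f g [|x [|y [|z n]]] /=; rewrite ?mulr0 ?addr0 //.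
by case: x y z => [] [] [] /=; ring.
Qed.

Lemma linear_slice_op s x : linear_op (slice_op s x).
Proof.
rewrite /slice_op; case: x => i [b0||v|] //=; apply: linear_at_pos.
- exact: linear_cup_op.
- exact: linear_cap_op.
- exact: linear_vertex_op.
Qed.

Lemma linear_eval s w : linear_op (eval s w).
Proof.
elim: w s => //= x w IH s k f g n; rewrite -IH; congr (eval _ _ _ _).
by apply: functional_extensionality => m; rewrite linear_slice_op.
Qed.

(** * Distant slices commute *)

Inductive basic_op : operator -> Prop :=
| basic_cup : basic_op (cup_op)
| basic_cap : basic_op (cap_op)
| basic_vertex wt : basic_op (vertex_op wt).

Lemma linear_basic_op F : basic_op F -> linear_op F.
Proof.
by case=> [||wt]; [apply: linear_cup_op | apply: linear_cap_op | apply: linear_vertex_op].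
Qed.

Definition linE F (hF : basic_op F) i :=
  let linF := linear_at_pos (linear_basic_op hF) i in
  (linear_op0 linF, linear_opD linF, linear_opZ linF).

Ltac case_bits := repeat match goal with t : bool |- _ => destruct t end; simpl.

(** For positive [k] the two operators act on disjoint cells and linearity is enough. For [k = 0]
    they share one cell, the top one of the Cup and the bottom one of [F], and the bits are examined
    one by one; likewise in the next two lemmas. *)
Lemma at_pos_cup k F f n : basic_op F ->
  at_pos k.+2 F (cup_op f) n = cup_op (at_pos k F f) n.
Proof.
move=> hF; case: n => [|x [|y [|z n]]] //=.
- by case: k => //=; case: hF.
- case: k => [|k] /=; last by case: ifP; rewrite ?(linE hF).
  by case: hF => [||wt]; case: n => [|t [|u n]]; case: x y z => [] [] [] //=;
    case_bits; try ring.
Qed.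

Lemma at_pos_cap k F f n : basic_op F ->
  at_pos k F (cap_op f) n = cap_op (at_pos k.+2 F f) n.
Proof.
move=> hF; case: n => [|x n] /=.
- by case: k => //=; case: hF.
- case: k => [|k] /=; last by case: ifP; rewrite ?(linE hF).
  by case: hF => [||wt]; case: n => [|t [|u n]]; case: x => //=; case_bits; try ring.
Qed.

Lemma at_pos_vertex k F wt f n : basic_op F ->
  at_pos k.+2 F (vertex_op wt f) n = vertex_op wt (at_pos k.+2 F f) n.
Proof.
move=> hF; case: n => [|x [|y [|z n]]] //=.
- by case: k => //=; case: hF.
- case: k => [|k] /=; last by case: x y z => [] [] []; rewrite ?(linE hF).
  by case: hF => [||wt']; case: n => [|t [|u n]]; case: x y z => [] [] [] //=;
    case_bits; try ring.
Qed.

Lemma same_exchange k e g :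
  same_op [:: (0, e); (outputs e + k, g)]%N [:: (inputs e + k, g); (0, e)]%N.
Proof.
have [->|[F hF defF]] : g = Mark \/ exists2 F : bool -> bool -> operator,
    forall c d, basic_op (F c d)
    & forall s i, slice_op s (i, g) = at_pos i (F (nth true s i) (nth true s i.+1)).
- case: g => [b0||v|]; [right|right|right|by left].
  + by exists (fun _ _ => cup_op) => [c d|s i] //; constructor.
  + by exists (fun _ _ => cap_op) => [c d|s i] //; constructor.
  + by exists (fun c d => vertex_op (side_weight c d v)) => [c d|s i] //; constructor.
- move=> s f n /=; case: e => [b0||v|] //=; rewrite /legal_slice /= => /and3P[_ _ _] /andP[/andP[lt_ks _] _] _.
  by rewrite sweep_Mark //; lia.
case: e => [b0||v|] s f n; rewrite /= /legal_slice ?addn0 ?add0n ?add1n ?add2n ?addSn ?sweepE !defF.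
- by move=> _ _ _; apply: (at_pos_cup _ _ _ (hF _ _)).
- case: s => [|c1 [|c2 s]] //=; rewrite ?sweepE => _ _ _.
  exact: (at_pos_cap _ _ _ (hF _ _)).
- case: s => [|c1 [|c2 s]] //=; rewrite ?sweepE => _ _ _.
  exact: (at_pos_vertex _ _ _ _ (hF _ _)).
- by case: s => [|c1 s]; rewrite ?sweepE //=.
Qed.

(** * Adding a missing dot *)

(* The factor by which the weight of an added dot changes across a strand of
   direction d; u = true, false are two independent solutions. *)
Definition step (u d : bool) : R :=
  match u, d with
  | true, true => a | true, false => - a'
  | false, true => a' | false, false => - a
  end.

Fixpoint weights_above (u : bool) (z : R) (s : seq bool) : seq R :=
  if s is d :: s' then z * step u d :: weights_above u (z * step u d) s' else [::].

Definition weights u z s := z :: weights_above u z s.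

(* Adds one missing dot, in all possible ways: the j-th entry of v is its weight
   at the cell j, and each missing dot below it costs a sign. *)
Fixpoint create (v : seq R) (f : vec) (n : seq bool) : R :=
  match v, n with
  | z :: v', x :: n' =>
      if x then z * f (false :: n') - create v' (fun m => f (x :: m)) n'
      else create v' (fun m => f (x :: m)) n'
  | _, _ => 0
  end.

Lemma linear_create v : linear_op (create v).
Proof.
elim: v => [|z v IH] k f g [|[] n] /=; rewrite ?mulr0 ?addr0 ?IH //.
by ring.
Qed.

Lemma create_weightsN u z s f n :
  create (weights_above u (- z) s) f n = - create (weights_above u z s) f n.
Proof.
elim: s z f n => [|d s IH] z f [|x n] /=; rewrite ?oppr0 // !mulNr IH.
by case: x; ring.
Qed.

(** At a turning point the two directions are opposite and [step u d * step u (~~ d) = -1], so the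
    outer cells get opposite weights. This is what the sign rule demands: behind a Cup the missing
    dot of the middle cell separates them, and at a Cap the terms which would fill the merged region
    twice cancel. *)
Lemma create_slice_op u z s x (f : vec) n : legal_slice s x ->
  size n = (size (sweep s x)).+1 ->
  create (weights u z (sweep s x)) (slice_op s x f) n =
  slice_op s x (create (weights u z s) f) n.
Proof.
case: x => i e; elim: i s z f n => [|i IH] s z f n.
  have lin0 v := linear_op0 (linear_create v).
  have linD v := linear_opD (linear_create v).
  have linZ v := linear_opZ (linear_create v).
  case: e => [b0||v|].
  - rewrite sweepE => _; case: n => [|x [|y [|t n]]] //= _.
    have stepN : z * step u b0 * step u (~~ b0) = - z.
      by case: u b0 => [] []; rewrite /step /=; ring: aa.
    rewrite /slice_op /= stepN !create_weightsN.
    case: x y t => [] [] [] /=; rewrite ?lin0 //; ring.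
  - case: s => [|d [|d' s]]; rewrite ?sweepE // /legal_slice /= => ne.
    case: n => [|x n] //= _; rewrite /slice_op /=.
    have stepN : z * step u d * step u d' = - z.
      by move: ne; case: u d d' => [] [] [] //= _; ring: aa.
    rewrite stepN !create_weightsN.
    case: x => /=; rewrite ?lin0 ?linD; ring.
  - case: s => [|d [|d' s]]; rewrite ?sweepE // => _.
    case: n => [|x [|y [|t n]]] //= _.
    rewrite /slice_op /side_weight /=; set p := north_weight d d' v.
    have -> : z * step u d' * step u d = z * step u d * step u d' by ring.
    case: u d d' @p => [] [] [] p; case: x y t => [] [] [] /=; rewrite ?(lin0, linD, linZ); ring: aa.
  - by case: s => [|d s]; rewrite ?sweepE.
case: s => [|d s] //; case: n => [|x n] //; rewrite sweepE => legs [size_n].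
have slice_opE g y m : slice_op (d :: s) (i.+1, e) g (y :: m) =
    slice_op s (i, e) (fun m => g (y :: m)) m.
  by have := @slice_op_cat [:: d] s i e g [:: y] m erefl.
have linS := linear_slice_op s (i, e).
have ext g h m : g =1 h -> slice_op s (i, e) g m = slice_op s (i, e) h m.
  by move=> /functional_extensionality ->.
have ext' v g h m : g =1 h -> create v g m = create v h m.
  by move=> /functional_extensionality ->.
have createE t g y m : create (weights u z (d :: t)) g (y :: m) =
    if y then z * g (false :: m) - create (weights u (z * step u d) t) (fun m => g (y :: m)) m
    else create (weights u (z * step u d) t) (fun m => g (y :: m)) m by [].
rewrite slice_opE createE (ext' _ _ _ _ (slice_opE f x)) (IH s _ _ _ legs size_n).
case: x; last by apply: ext => m; rewrite createE.
rewrite slice_opE -mulN1r -(linear_opZ linS) addrC -linS; apply: ext => m.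
by rewrite createE mulN1r addrC.
Qed.

Lemma slice_op_ext s x (f g : vec) n :
  (forall m, (size m + outputs x.2 = size n + inputs x.2)%N -> f m = g m) ->
  slice_op s x f n = slice_op s x g n.
Proof.
case: x => i e; rewrite /slice_op /=.
case: e => [b0||v|] /=; last by apply.
- elim: i f g n => [|i IH] f g [|x n] //= fg; last by apply: IH => m /= sz; apply: fg; rewrite /=; lia.
  by case: n fg => [|y [|z n]] //= fg; case: ifP => // _; apply: fg => /=; lia.
- elim: i f g n => [|i IH] f g [|x n] //= fg; last by apply: IH => m /= sz; apply: fg; rewrite /=; lia.
  by rewrite !fg //=; lia.
- move: (side_weight _ _ _) => wt; elim: i f g n => [|i IH] f g [|x n] //= fg; last by apply: IH => m /= sz; apply: fg; rewrite /=; lia.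
  by case: n fg => [|y [|z n]] //= fg; rewrite !fg //=; lia.
Qed.

Lemma eval_cat s u v (f : vec) :
  eval s (u ++ v) f = eval (foldl sweep s u) v (eval s u f).
Proof. by elim: u s f => //= x u IH s f; rewrite IH. Qed.

Lemma eval_ext s w (f g : vec) n : legal s w ->
  size n = (size (foldl sweep s w)).+1 ->
  (forall m, size m = (size s).+1 -> f m = g m) ->
  eval s w f n = eval s w g n.
Proof.
elim: w s f g => [|x w IH] s f g /=; first by move=> _ sz; apply.
case/andP=> legx legw sz fg; apply: IH => // m sz_m.
by apply: slice_op_ext => m'; move: (size_sweep legx) sz_m fg => ? ? fg ?; apply: fg; lia.
Qed.

(** * The local moves preserve the operators *)

Definition same_ends (l r : word) : Prop := forall s,
  legal s l -> legal s r -> foldl sweep s l = foldl sweep s r.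

Lemma same_ends_shift i l r : same_ends l r -> forall s, (i <= size s)%N ->
  legal s (shift i l) -> legal s (shift i r) ->
  foldl sweep s (shift i l) = foldl sweep s (shift i r).
Proof.
move=> lr s le_is.
have [P [Q [-> <-]]] : exists P Q, s = P ++ Q /\ size P = i.
  by exists (take i s), (drop i s); rewrite cat_take_drop size_takel.
by rewrite !legal_shift !sweeps_shift => legl legr; rewrite (lr Q).
Qed.

Lemma sweep_comm k e g s : legal s [:: (0, e); (outputs e + k, g)]%N ->
  foldl sweep s [:: (0, e); (outputs e + k, g)]%N = foldl sweep s [:: (inputs e + k, g); (0, e)]%N.
Proof.
case: e => [b0||v|] /=; rewrite /legal_slice ?addn0 ?add0n ?add1n ?add2n ?addSn ?sweepE //.
- by case: s => [|c1 [|c2 s]]; rewrite ?sweepE.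
- by case: s => [|c1 [|c2 s]]; rewrite ?sweepE.
- by case: s => [|c1 s]; rewrite ?sweepE.
Qed.

Lemma local_moveP l r : local_move l r ->
  (forall s, legal s l -> legal s r -> foldl sweep s l = foldl sweep s r) /\
  (forall s f n, legal s l -> legal s r -> size n = (size (foldl sweep s l)).+1 ->
     eval s l f n = eval s r f n).
Proof.
(* Every move at height [i] is the translate of the same move at height 0, where the identities were
   checked. *)
have base i l0 r0 : (forall s, legal s (shift i l0) -> (i <= size s)%N) ->
  same_ends l0 r0 -> same_op l0 r0 ->
  (forall s, legal s (shift i l0) -> legal s (shift i r0) ->
     foldl sweep s (shift i l0) = foldl sweep s (shift i r0)) /\
  (forall s f n, legal s (shift i l0) -> legal s (shift i r0) ->
     size n = (size (foldl sweep s (shift i l0))).+1 ->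
     eval s (shift i l0) f n = eval s (shift i r0) f n).
  move=> le ends op; split=> [s legl legr|s f n legl legr sz].
    by apply: same_ends_shift (le _ legl) _ _.
  by apply: same_op_shift (le _ legl) _ _ _.
case=> {l r}.
- move=> i k e g.
  have := base i [:: (0, e); (outputs e + k, g)]%N [:: (inputs e + k, g); (0, e)]%N.
  rewrite /shift /= !addnA addn0; apply.
  + by move=> s; rewrite /legal_slice /=; lia.
  + by move=> s legl _; apply: sweep_comm.
  + exact: same_exchange.
- move=> i b0; have := base i [:: (0, Cup b0); (1, Cap)]%N [::].
  rewrite /shift /= addn0 addn1; apply; last exact: same_zigzag_up.
  + by move=> s; rewrite /legal_slice /=; lia.
  + by move=> [|c s]; rewrite /= ?sweepE // /legal_slice /=; case: b0 c => [] [].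
- move=> i b0; have := base i [:: (1, Cup b0); (0, Cap)]%N [::].
  rewrite /shift /= addn0 addn1; apply; last exact: same_zigzag_down.
  + by move=> s; rewrite /legal_slice /=; lia.
  + by move=> [|c s]; rewrite /= ?sweepE // /legal_slice /=; case: b0 c => [] [].
- move=> i v; have := base i [:: (0, Vertex v); (1, Cap)]%N [:: (1, Vertex (mirror v)); (0, Cap)]%N.
  rewrite /shift /= addn0 addn1; apply; last exact: same_vertex_cap.
  + by move=> s; rewrite /legal_slice /=; lia.
  + by move=> [|c [|d [|e s]]]; rewrite /= ?sweepE.
- move=> i b0 v; have := base i [:: (1, Cup b0); (0, Vertex v)]%N [:: (0, Cup b0); (1, Vertex (mirror v))]%N.
  rewrite /shift /= addn0 addn1; apply; last exact: same_vertex_cup.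
  + by move=> s; rewrite /legal_slice /=; lia.
  + by move=> [|c s]; rewrite /= ?sweepE.
- move=> i b0 c; have := base i [:: (1, Cup b0); (0, Vertex (Crossing c)); (1, Cap)]%N [::].
  rewrite /shift /= addn0 addn1; apply; last exact: same_R1_up.
  + by move=> s; rewrite /legal_slice /=; lia.
  + by move=> [|d s]; rewrite /= ?sweepE // /legal_slice /=; case: b0 d => [] [].
- move=> i b0 c; have := base i [:: (0, Cup b0); (1, Vertex (Crossing c)); (0, Cap)]%N [::].
  rewrite /shift /= addn0 addn1; apply; last exact: same_R1_down.
  + by move=> s; rewrite /legal_slice /=; lia.
  + by move=> [|d s]; rewrite /= ?sweepE // /legal_slice /=; case: b0 d => [] [].
- move=> i c; have := base i [:: (0, Vertex (Crossing c)); (0, Vertex (Crossing (~~ c)))]%N [::].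
  rewrite /shift /= addn0; apply; last exact: same_R2.
  + by move=> s; rewrite /legal_slice /=; lia.
  + by move=> [|d [|e s]]; rewrite /= ?sweepE.
- move=> i c v; have := base i [:: (0, Vertex (Crossing c)); (1, Vertex (Crossing c)); (0, Vertex v)]%N
    [:: (1, Vertex v); (0, Vertex (Crossing c)); (1, Vertex (Crossing c))]%N.
  rewrite /shift /= addn0 addn1; apply; last exact: same_R3_bottom.
  + by move=> s; rewrite /legal_slice /=; lia.
  + by move=> [|d [|e [|g s]]]; rewrite /= ?sweepE.
- move=> i c v; have := base i [:: (0, Vertex v); (1, Vertex (Crossing c)); (0, Vertex (Crossing c))]%N
    [:: (1, Vertex (Crossing c)); (0, Vertex (Crossing c)); (1, Vertex v)]%N.
  rewrite /shift /= addn0 addn1; apply; last exact: same_R3_top.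
  + by move=> s; rewrite /legal_slice /=; lia.
  + by move=> [|d [|e [|g s]]]; rewrite /= ?sweepE.
- move=> i c v; have := base i [:: (0, Vertex (Crossing c)); (1, Vertex v); (0, Vertex (Crossing (~~ c)))]%N
    [:: (1, Vertex (Crossing (~~ c))); (0, Vertex v); (1, Vertex (Crossing c))]%N.
  rewrite /shift /= addn0 addn1; apply; last exact: same_R3_middle.
  + by move=> s; rewrite /legal_slice /=; lia.
  + by move=> [|d [|e [|g s]]]; rewrite /= ?sweepE.
- move=> i c; have := base i [:: (0, Vertex (Crossing c)); (0, Vertex DoublePoint)]%N
    [:: (0, Vertex DoublePoint); (0, Vertex (Crossing c))]%N.
  rewrite /shift /= addn0; apply; last exact: same_S2.
  + by move=> s; rewrite /legal_slice /=; lia.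
  + by move=> [|d [|e s]]; rewrite /= ?sweepE.
- move=> i b0; have := base i [:: (0, Cup b0); (0, Mark)]%N [:: (0, Cup b0); (1, Mark)]%N.
  rewrite /shift /= addn0 addn1; apply.
  + by move=> s; rewrite /legal_slice /=; lia.
  + by move=> s; rewrite /= ?sweepE.
  + by move=> s.
- move=> i; have := base i [:: (0, Mark); (0, Cap)]%N [:: (1, Mark); (0, Cap)]%N.
  rewrite /shift /= addn0 addn1; apply.
  + by move=> s; rewrite /legal_slice /=; lia.
  + by move=> [|c [|d s]]; rewrite /= ?sweepE.
  + by move=> s.
- move=> i v; have := base i [:: (0, Mark); (0, Vertex v)]%N [:: (0, Vertex v); (1, Mark)]%N.
  rewrite /shift /= addn0 addn1; apply.
  + by move=> s; rewrite /legal_slice /=; lia.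
  + by move=> [|c [|d s]]; rewrite /= ?sweepE.
  + by move=> [|c [|d s]] f n; rewrite /= ?sweepE.
- move=> i v; have := base i [:: (1, Mark); (0, Vertex v)]%N [:: (0, Vertex v); (0, Mark)]%N.
  rewrite /shift /= addn0 addn1; apply.
  + by move=> s; rewrite /legal_slice /=; lia.
  + by move=> [|c [|d s]]; rewrite /= ?sweepE.
  + by move=> [|c [|d s]] f n; rewrite /= ?sweepE.
Qed.

(** * The value of a closed diagram *)

Hypothesis a_neq : forall x : R, (a - a') * x = 0 -> x = 0.

Definition vacuum : vec := fun n => (~~ has id n)%:R.

(* The first slice of a closed diagram is a Cup and the last one a Cap.  They are
   omitted, which opens the diagram at its leftmost strand: the regions on both
   sides of this strand are the star regions. *)
Definition closed_value (w : word) : R :=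
  if w is x :: w' then
    eval (sweep [::] x) (take (size w').-1 w') vacuum [:: false; false; false]
  else 0.

Lemma closed_valueE x w y :
  closed_value (x :: rcons w y) = eval (sweep [::] x) w vacuum [:: false; false; false].
Proof. by rewrite /closed_value size_rcons -cats1 take_size_cat. Qed.

Lemma create_nil v (f : vec) n : ~~ has id n -> create v f n = 0.
Proof. by elim: v n f => [|z v IH] [|[] n] f //= ?; apply: IH. Qed.

Lemma create_eval u z s w (f : vec) n : legal s w ->
  size n = (size (foldl sweep s w)).+1 ->
  create (weights u z (foldl sweep s w)) (eval s w f) n
  = eval s w (create (weights u z s) f) n.
Proof.
elim: w s f => //= x w IH s f /andP[legx legw] sz; rewrite IH //.
apply: eval_ext => // m sz_m; exact: create_slice_op.
Qed.

(** The bottom cell always lies in the outer region, a star region, which must never expect a dot;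
    the next lemma does the same for the top cell. Both serve for two Caps exchanged at the right
    end. *)
Lemma head_support s x (f : vec) n : legal_slice s x ->
  (forall m, f (true :: m) = 0) -> slice_op s x f (true :: n) = 0.
Proof.
move=> _ f0; case: x => [i [c||v|]]; rewrite /slice_op /=; last exact: f0.
- case: i => [|i] /=; last first.
    by rewrite (functional_extensionality _ _ f0); apply: linear_op0 (linear_at_pos (linear_cup_op) _) _.
  by case: n => [|y [|z n]] //; case: ifP.
- case: i => [|i] /=; last first.
    by rewrite (functional_extensionality _ _ f0); apply: linear_op0 (linear_at_pos (linear_cap_op) _) _.
  by rewrite f0.
- case: i => [|i] /=; last first.
    by rewrite (functional_extensionality _ _ f0); apply: linear_op0 (linear_at_pos (linear_vertex_op _) _) _.
  by case: n => [|y [|z n]] //; rewrite !f0; case: y z => [] []; ring.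
Qed.

Lemma last_support s x (f : vec) n :
  (forall m, f (rcons m true) = 0) -> slice_op s x f (rcons n true) = 0.
Proof.
case: x => i e f0; rewrite /slice_op /=; case: e => [c||v|] //=.
- elim: i f n f0 => [|i IH] f [|x n] f0 //=; last 2 first.
  + by case: i {IH}.
  + by apply: IH => m; rewrite -rcons_cons f0.
  case: n => [|y n] //=; case: n => [|z n] //=.
    by rewrite andbT orbT (f0 [::]) if_same.
  by rewrite -rcons_cons f0 if_same.
- elim: i f n f0 => [|i IH] f [|x n] f0 //=; last 2 first.
  + by case: i {IH}.
  + by apply: IH => m; rewrite -rcons_cons f0.
  + exact: (f0 [:: true; false]).
  by rewrite -!rcons_cons !f0 addr0 if_same.
- move: (side_weight _ _ _) => wt.
  elim: i f n f0 => [|i IH] f [|x n] f0 //=; last 2 first.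
  + by case: i {IH}.
  + by apply: IH => m; rewrite -rcons_cons f0.
  case: n => [|y n] //=; case: n => [|z n] //=.
    rewrite (f0 [:: x; true]) (f0 [:: x; false]) (f0 [:: true; false]).
    by case: x y => [] []; ring.
  by rewrite -!rcons_cons !f0; case: x y z => [] [] []; ring.
Qed.

Lemma eval_support s w (f : vec) : legal s w ->
  (forall m, f (true :: m) = 0) -> (forall m, f (rcons m true) = 0) ->
  (forall m, eval s w f (true :: m) = 0) /\ (forall m, eval s w f (rcons m true) = 0).
Proof.
elim: w s f => //= x w IH s f /andP[legx legw] f0 f1; apply: IH => // m.
  exact: head_support.
exact: last_support.
Qed.

(** The exchange changes the strand at which the diagram is opened: the outer region remains a star
    region, but the other star region is now the one inside the other Cup. On the left the upper Cup
    remains a slice of the opened diagram, on the right the lower one. *)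
Lemma closed_value_cups v c d :
  legal [::] ([:: (0, Cup c); (2, Cup d)]%N ++ v) ->
  foldl sweep [::] ([:: (0, Cup c); (2, Cup d)]%N ++ v) = [::] ->
  closed_value ([:: (0, Cup c); (2, Cup d)]%N ++ v) =
  closed_value ([:: (0, Cup d); (0, Cup c)]%N ++ v).
Proof.
case/lastP: v => [|v y]; first by rewrite /= !sweepE.
have catE x1 x2 : [:: x1; x2] ++ rcons v y = x1 :: rcons (x2 :: v) y by [].
rewrite !catE !closed_valueE /= !sweepE.
rewrite -cats1 legal_cat foldl_cat /= andbT.
set s := [:: c, _ & _] => /andP[legv legy] endy.
have [_ size_s] := last_slice legy endy.
(* Times a - a', the difference of the two sides is a difference of vectors with
   an added dot, and these evaluate to 0 at the right end. *)
have kill u : eval s v (create (weights u 1 s) vacuum) [:: false; false; false] = 0.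
  by rewrite -create_eval ?size_s // create_nil.
have linE := linear_eval s v.
apply/eqP; rewrite -subr_eq0; apply/eqP/a_neq.
have -> : 0 = eval s v (create (weights false 1 s) vacuum) [:: false; false; false]
            - eval s v (create (weights true 1 s) vacuum) [:: false; false; false].
  by rewrite !kill subr0.
rewrite mulrBr -!(linear_opZ linE) -![- eval _ _ _ _]mulN1r -!(linear_opZ linE) -!(linear_opD linE).
apply: eval_ext; rewrite ?size_s // => -[|n0 [|n1 [|n2 [|n3 [|n4 [|n5 n]]]]]] //= _.
rewrite /slice_op /vacuum /=.
case: c d @s {legv legy endy size_s kill linE} => [] [] s; case: n0 n1 n2 n3 n4 => [] [] [] [] [] /=; ring: aa.
Qed.

Lemma one_move_value w w' : one_move w w' -> closed_value w = closed_value w'.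
Proof.
case=> u l r v lm.
rewrite /tangle !legal_cat !foldl_cat => /andP[/and3P[legu legl legv] /eqP end_l].
case/andP=> /and3P[_ legr _] /eqP end_r.
have [ends evals] := local_moveP lm.
case: u legu legl legr legv end_l end_r => [|x u] legu legl legr legv end_l end_r.
  have [[c [d [def_l def_r]]]|[c [def_l def_r]]] := local_move_nil lm legl legr.
    rewrite def_l def_r; apply: closed_value_cups.
      by rewrite -def_l legal_cat legl.
    by rewrite -def_l foldl_cat.
  by rewrite def_l def_r; case: v {legv end_l end_r} => [|x v]; rewrite //= !sweepE.
have {legu} /andP[legx legu] : legal_slice [::] x && legal (sweep [::] x) u := legu.
case/lastP: v legv end_l end_r => [|v y].
  move=> _ end_l _.
  have eq2 y z : (x :: u) ++ [:: y; z] ++ [::] = x :: rcons (u ++ [:: y]) z.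
    by rewrite -cats1 -catA cat_cons.
  have [[size_s def_l def_r]|[i [def_l def_r]]] := local_move_end lm legl legr end_l; last first.
    by rewrite def_l def_r !eq2 !closed_valueE !eval_cat.
  rewrite def_l def_r !eq2 !closed_valueE !eval_cat /= /slice_op /=.
  have vac1 m : vacuum (true :: m) = 0 by [].
  have vac2 m : vacuum (rcons m true) = 0 by rewrite /vacuum has_rcons.
  have [supp1 supp2] := eval_support legu vac1 vac2.
  (* Each Cap gives two terms. The one with a dot missing in the outer region vanishes, and on both
     sides the value with the missing dot between the two Caps remains. *)
  by rewrite supp1 (supp2 [:: false; false; false; false]) addr0 add0r.
rewrite !cat_cons -!rcons_cat !closed_valueE !eval_cat -cats1 legal_cat foldl_cat /=.
case/andP=> legv /andP[legy _] end_l _; rewrite ends //.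
have [_ size_s] := last_slice legy end_l.
apply: eval_ext => //; rewrite -?ends // ?size_s // => m sz_m.
by apply: evals.
Qed.
Lemma isotopic_value w w' : isotopic w w' -> closed_value w = closed_value w'.
Proof.
elim=> [x y|//|x y _ ->|x y z _ -> _ ->] //; exact: one_move_value.
Qed.

Lemma slice_op_rcons P Q d e (f : vec) n c : legal_slice (P ++ Q) (size P, e) ->
  size n = (size (sweep (P ++ Q) (size P, e))).+1 ->
  slice_op (rcons (P ++ Q) d) (size P, e) f (rcons n c) =
  slice_op (P ++ Q) (size P, e) (fun m => f (rcons m c)) n.
Proof.
rewrite -[size P]addn0 legal_slice_cat sweep_cat size_cat -addnS => legQ size_n.
have [p [q [def_n size_p]]] : exists p q, n = p ++ q /\ size p = size P.
  exists (take (size P) n), (drop (size P) n).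
  by rewrite cat_take_drop size_takel // size_n leq_addr.
have {size_n} : size q = (size (sweep Q (0%N, e))).+1.
  by apply/(@addnI (size p)); rewrite -size_cat -def_n size_n size_p.
rewrite def_n !rcons_cat !slice_op_cat //.
have -> : (fun m => f (rcons (p ++ m) c)) = (fun m => f (p ++ rcons m c)).
  by apply: functional_extensionality => m; rewrite rcons_cat.
move: legQ; rewrite /slice_op /legal_slice; case: e => [b0||v|] /=.
- by rewrite sweepE => _; case: q {def_n} => [|x [|y [|z q]]].
- by case: q {def_n} => [|x q].
- case: Q => [|x [|y Q]] //; rewrite sweepE => _.
  by case: q {def_n} => [|? [|? [|? q]]].
- by [].
Qed.

(** Applied to the closing arc, a strand above the whole diagram: no slice meets it, so the bit of
    the cell above it is only carried along. *)
Lemma eval_rcons s w d (f : vec) n c : legal s w ->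
  size n = (size (foldl sweep s w)).+1 ->
  eval (rcons s d) w f (rcons n c) = eval s w (fun m => f (rcons m c)) n.
Proof.
elim: w s f => //= -[i e] w IH s f /andP[legx legw] sz.
have [P [Q [def_s def_i]]] : exists P Q, s = P ++ Q /\ size P = i.
  exists (take i s), (drop i s); rewrite cat_take_drop size_takel //.
  by move: legx; rewrite /legal_slice /=; lia.
have -> : sweep (rcons s d) (i, e) = rcons (sweep s (i, e)) d.
  rewrite def_s -def_i rcons_cat -[size P]addn0 !sweep_cat rcons_cat; congr cat.
  have leQ : (inputs e <= size Q)%N.
    by move: legx; rewrite def_s -def_i /legal_slice size_cat /=; lia.
  case: e {legx legw sz} leQ => [b0||v|]; rewrite ?sweepE //.
  - by case: Q {def_s} => [|x [|y Q]] // _; rewrite !rcons_cons ?sweepE.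
  - by case: Q {def_s} => [|x [|y Q]]; rewrite ?rcons_cons ?sweepE ?sweepE.
  - case: Q {def_s} => [|x Q] // _.
    exact: etrans (sweep_mark _ _) (congr1 (rcons^~ d) (esym (sweep_mark _ _))).
rewrite IH //; apply: eval_ext => // m sz_m.
by move: legx sz_m; rewrite def_s -def_i => legx sz_m; rewrite slice_op_rcons.
Qed.

Lemma closed_value_close_up w : long_diagram w ->
  closed_value (close_up w) = eval [:: true] w vacuum [:: false; false].
Proof.
case/andP=> /andP[legw /eqP end_w] _.
have -> : close_up w = (0%N, Cup true) :: rcons ((0%N, Mark) :: w) (0%N, Cap).
  by rewrite /close_up -cats1.
rewrite closed_valueE /= !sweepE.
rewrite -[[:: true; ~~ true]]/(rcons [:: true] false) -[[:: false; false; false]]/(rcons [:: false; false] false).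
rewrite eval_rcons ?end_w //; congr (eval _ _ _ _).
apply: functional_extensionality => m.
by rewrite -[LHS]/(vacuum (rcons m false)) /vacuum has_rcons.
Qed.

(** * Vectors of placed dots *)

(* A region is named by the level and the height of a cell of it; names are
   identified when a Cap turns out to join two regions. *)
Definition identify (p q x : label) : label := if x == q then p else x.

Definition relabel (ls : seq label) (x : slice) : label -> label :=
  if x.2 is Cap then identify (nth (0, 0)%N ls x.1) (nth (0, 0)%N ls x.1.+2) else id.

Definition next_labels (l : nat) (ls : seq label) (x : slice) : seq label :=
  match x.2 with
  | Cup _ => take x.1.+1 ls ++ (l.+1, x.1.+1) :: drop x.1 ls
  | Vertex _ => take x.1.+1 ls ++ (l.+1, x.1.+1) :: drop x.1.+2 ls
  | Cap => map (relabel ls x) (take x.1.+1 ls ++ drop x.1.+3 ls)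
  | Mark => ls
  end.

(* the Cap joins a region to itself *)
Definition bad_cap (ls : seq label) (x : slice) : bool :=
  if x.2 is Cap then nth (0, 0)%N ls x.1 == nth (0, 0)%N ls x.1.+2 else false.

Definition next_classes (l : nat) (ls rs : seq label) (x : slice) : seq label :=
  match x.2 with
  | Cup _ | Vertex _ => (l.+1, x.1.+1) :: rs
  | Cap => if bad_cap ls x then rs else [seq r <- rs | r != nth (0, 0)%N ls x.1.+2]
  | Mark => rs
  end.

Definition side_label (l : nat) (ls : seq label) (i : nat) (sd : side) : label :=
  match sd with
  | Leftward => nth (0, 0)%N ls i.+1
  | Rightward => (l.+1, i.+1)
  | Upward => nth (0, 0)%N ls i.+2
  | Downward => nth (0, 0)%N ls i
  end.

(* Every region of rs contains exactly one of the dots D. *)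
Definition good (rs D : seq label) : bool := all (fun r => count_mem r D == 1%N) rs.

(** [D] lists the regions of the dots already placed, and the bits of [n] choose the cells through
    which the remaining dots enter. *)
Definition dot_vector (ls rs D : seq label) : vec := fun n => (good rs (D ++ mask n ls))%:R.

Lemma good_perm rs D D' : perm_eq D D' -> good rs D = good rs D'.
Proof. by move=> /permP eqD; apply: eq_all => r; rewrite eqD. Qed.

Lemma good_dup rs c D : c \in rs -> good rs [:: c, c & D] = false.
Proof.
move=> c_rs; apply/negP => /allP/(_ c c_rs) /=.
by rewrite eqxx.
Qed.

Lemma good_notin rs c D : c \notin rs -> good rs (c :: D) = good rs D.
Proof.
move=> c_rs; apply: eq_in_all => r r_rs /=.
by have -> : (c == r) = false by apply: contraNF c_rs => /eqP ->.
Qed.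

Lemma good_rem rs c D : c \in rs ->
  good rs D = (count_mem c D == 1%N) && good [seq r <- rs | r != c] D.
Proof.
move=> c_rs; apply/idP/andP => [good_D|[c1 /allP good_D]].
  split; first exact: (allP good_D).
  by apply/allP => r; rewrite mem_filter => /andP[_ /(allP good_D)].
apply/allP => r r_rs; have [->//|ne] := eqVneq r c.
by apply: good_D; rewrite mem_filter ne.
Qed.

Lemma count_identify_other p q r D : p != q -> r != p -> r != q ->
  count_mem r (map (identify p q) D) = count_mem r D.
Proof.
move=> pq rp rq; rewrite count_map; apply: eq_count => x /=; rewrite /identify.
by have [->|//] := eqVneq x q; rewrite ![_ == r]eq_sym (negbTE rp) (negbTE rq).
Qed.

Lemma count_identify p q D : p != q ->
  count_mem p (map (identify p q) D) = (count_mem p D + count_mem q D)%N.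
Proof.
move=> pq; elim: D => //= x D ->; rewrite /identify.
have [->|xq] := eqVneq x q; first by rewrite eqxx [q == p]eq_sym (negbTE pq); lia.
by lia.
Qed.

(** The merged region has one dot when one of its parts has one and the other none; adding the
    absent dot makes both parts good. This is the branch of [cap_op] with two terms, which
    [good_exclusive] turns from a disjunction into a sum; [good_identify2] is the other branch. *)
Lemma good_identify rs p q D : p \in rs -> q \in rs -> p != q ->
  good [seq r <- rs | r != q] (map (identify p q) D) =
  good rs (p :: D) || good rs (q :: D).
Proof.
move=> p_rs q_rs pq.
have p_rs' : p \in [seq r <- rs | r != q] by rewrite mem_filter pq.
rewrite (good_rem (p :: D) q_rs) (good_rem (q :: D) q_rs) !(good_rem _ p_rs').
rewrite count_identify //= !eqxx (negbTE pq) [q == p]eq_sym (negbTE pq).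
set rs' := [seq _ <- _ | _ != p].
have notp : p \notin rs' by rewrite mem_filter eqxx.
have notq : q \notin rs' by rewrite !mem_filter eqxx andbF.
rewrite !good_notin //.
have -> : good rs' (map (identify p q) D) = good rs' D.
  apply: eq_in_all => r; rewrite !mem_filter => /and3P[rp rq _].
  by rewrite count_identify_other.
case: (good rs' D); lia.
Qed.

Lemma good_identify2 rs p q D : p \in rs -> q \in rs -> p != q ->
  good [seq r <- rs | r != q] (p :: map (identify p q) D) = good rs [:: p, q & D].
Proof.
move=> p_rs q_rs pq.
have p_rs' : p \in [seq r <- rs | r != q] by rewrite mem_filter pq.
rewrite (good_rem [:: p, q & D] q_rs) !(good_rem _ p_rs').
rewrite /= count_identify //= !eqxx (negbTE pq) [q == p]eq_sym (negbTE pq).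
set rs' := [seq _ <- _ | _ != p].
have notp : p \notin rs' by rewrite mem_filter eqxx.
have notq : q \notin rs' by rewrite !mem_filter eqxx andbF.
rewrite !good_notin //.
have -> : good rs' (map (identify p q) D) = good rs' D.
  apply: eq_in_all => r; rewrite !mem_filter => /and3P[rp rq _].
  by rewrite count_identify_other.
case: (good rs' D); lia.
Qed.

Lemma good_exclusive rs p q D : p \in rs -> q \in rs -> p != q ->
  good rs (p :: D) && good rs (q :: D) = false.
Proof.
move=> p_rs q_rs pq; rewrite (good_rem (p :: D) p_rs) (good_rem (q :: D) p_rs) /=.
by rewrite eqxx [q == p]eq_sym (negbTE pq); lia.
Qed.

(** The bound on [r.1] makes the names introduced by the next slice fresh. The list [rs] may exceed
    [ls]: regions already closed must still be found to have one dot. *)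
Definition consistent (l : nat) (s : seq bool) (ls rs : seq label) : Prop :=
  [/\ size ls = (size s).+1, {subset ls <= rs}, uniq rs
    & {in rs, forall r, (r.1 <= l)%N}].

Lemma next_consistent l s ls rs x : consistent l s ls rs -> legal_slice s x ->
  consistent l.+1 (sweep s x) (next_labels l ls x) (next_classes l ls rs x).
Proof.
case: x => i e [size_ls ls_rs uniq_rs rs_l] legx.
have size_s' := size_sweep legx; move: legx size_s'.
have fresh k : (l.+1, k) \notin rs.
  by apply/negP => /rs_l /=; rewrite ltnn.
have rs_l1 k : {in (l.+1, k) :: rs, forall r, (r.1 <= l.+1)%N}.
  by move=> r; rewrite inE => /predU1P[-> //|/rs_l /leqW].
have new_sub k j j' : {subset take j ls ++ (l.+1, k) :: drop j' ls <= (l.+1, k) :: rs}.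
  move=> r; rewrite mem_cat !inE => /or3P[/mem_take/ls_rs ->|->|/mem_drop/ls_rs ->] //;
  by rewrite orbT.
rewrite /legal_slice /next_labels /next_classes /bad_cap /= => /andP[le_i _].
case: e le_i => [c||v|] /= le_i size_s'.
- split=> //=; rewrite ?fresh // size_cat /= size_takel ?size_drop; lia.
- have sub r : r \in take i.+1 ls ++ drop i.+3 ls -> r \in rs.
    by rewrite mem_cat => /orP[/mem_take/ls_rs|/mem_drop/ls_rs].
  have in_rs k : (k < size ls)%N -> nth (0, 0)%N ls k \in rs by move=> ?; apply/ls_rs/mem_nth.
  rewrite /relabel /=; set p := nth _ _ i; set q := nth _ _ _.
  split.
  + rewrite size_map size_cat size_takel ?size_drop; lia.
  + move=> r /mapP[t /sub t_rs ->]; rewrite /identify.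
    have p_rs : p \in rs by apply: in_rs; lia.
    have [_|tq] := eqVneq t q; case: eqVneq => [pq|pq] //.
    * by rewrite mem_filter pq.
    * by rewrite mem_filter tq.
  + by case: ifP => // _; apply: filter_uniq.
  + by move=> r; case: ifP => _; [move/rs_l/leqW | rewrite mem_filter => /andP[_ /rs_l/leqW]].
- split=> //=; rewrite ?fresh // size_cat /= size_takel ?size_drop; lia.
- by split=> //; [lia | move=> r /rs_l /leqW].
Qed.

Lemma dot_vector_cat P L rs D p m : size p = size P ->
  dot_vector (P ++ L) rs D (p ++ m) = (good rs (mask m L ++ D ++ mask p P))%:R.
Proof.
move=> size_p; rewrite /dot_vector mask_cat //; congr (nat_of_bool _)%:R.
by apply: good_perm; rewrite catA perm_catC.
Qed.

Lemma at_pos_split F p m (f : vec) : at_pos (size p) F f (p ++ m) = F (fun m => f (p ++ m)) m.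
Proof. by rewrite -[size p]addn0 at_pos_cat. Qed.

Lemma dot_vector_cat_cons P L rs c D p m : size p = size P ->
  dot_vector (P ++ L) rs (c :: D) (p ++ m) = (good rs (c :: mask m L ++ D ++ mask p P))%:R.
Proof.
move=> size_p; rewrite dot_vector_cat //; congr (nat_of_bool _)%:R.
by apply: good_perm; rewrite cat_cons -cat1s perm_catCA.
Qed.

Lemma good_swap rs x y D : good rs [:: x, y & D] = good rs [:: y, x & D].
Proof. by apply: good_perm; rewrite -[[:: x, y & D]]/([:: x] ++ [:: y] ++ D) perm_catCA. Qed.

(** Each operator reproduces the change of the condition [good] caused by its slice. A bad Cap is
    excluded because the formula of [cap_op] presumes that the outer cells lie in two regions, each
    with a dot of its own. *)
Lemma slice_op_dot_vector l s ls rs D x n : consistent l s ls rs -> legal_slice s x ->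
  {subset D <= rs} -> ~~ bad_cap ls x -> size n = (size (sweep s x)).+1 ->
  slice_op s x (dot_vector ls rs D) n =
  if x.2 is Vertex v then
    \sum_(sd <- [:: Leftward; Rightward; Upward; Downward])
      side_weight (nth true s x.1) (nth true s x.1.+1) v sd *
      dot_vector (next_labels l ls x) (next_classes l ls rs x) (side_label l ls x.1 sd :: D) n
  else dot_vector (next_labels l ls x) (next_classes l ls rs x) (map (relabel ls x) D) n.
Proof.
case: x => i e [size_ls ls_rs uniq_rs rs_l] legx D_rs good_cap size_n.
have := size_sweep legx; move: size_n legx good_cap; move: (sweep s (i, e)) => s' size_n.
have fresh k : (l.+1, k) \notin rs.
  by apply/negP => /rs_l /=; rewrite ltnn.
rewrite /legal_slice /bad_cap /= => /andP[le_i _].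
case: e le_i => [c||v|] /= le_i good_cap size_s'.
- have [P [y [Q [def_ls def_i]]]] := @cut1 _ ls i ltac:(lia).
  have [p [x [t [z [q [def_n size_p]]]]]] := @cut3 _ n i ltac:(lia).
  subst i.
  rewrite /slice_op /next_labels /next_classes /relabel /= map_id.
  set new := (_, _).
  have -> : take (size P).+1 ls ++ new :: drop (size P) ls = P ++ [:: y, new, y & Q].
    by rewrite def_ls take1_split drop_size_cat // -catA.
  rewrite def_n -size_p at_pos_split def_ls /= !dot_vector_cat //.
  set E := D ++ mask p P.
  have E_rs : {subset mask q Q ++ E <= rs}.
    move=> r; rewrite !mem_cat => /or3P[/mem_mask|/D_rs//|/mem_mask] r_ls; apply: ls_rs;
    by rewrite def_ls mem_cat ?inE r_ls ?orbT.
  have y_rs : y \in rs by apply: ls_rs; rewrite def_ls mem_cat inE eqxx orbT.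
  have newE : new \notin mask q Q ++ E by apply/negP => /E_rs; apply/negP/fresh.
  have ny : (new == y) = false.
    by apply/negbTE/eqP => newy; move: (fresh (size P).+1); rewrite -/new newy y_rs.
  by case: x t z {def_n} => [] [] [] /=; rewrite ?(eq_sym y new) ?ny ?eqxx (count_memPn newE) //=;
     rewrite ?(good_swap _ y new) ?(good_notin _ (fresh _)) ?good_dup.
- have [P [y [z [t [Q [def_ls def_i]]]]]] := @cut3 _ ls i ltac:(lia).
  have [p [x [q [def_n size_p]]]] := @cut1 _ n i ltac:(lia).
  subst i.
  have nth_ls k : nth (0, 0)%N ls (size P + k) = nth (0, 0)%N [:: y, z, t & Q] k.
    by rewrite def_ls nth_split.
  have := nth_ls 0%N; have := nth_ls 2%N; rewrite addn2 addn0 /= => nth_t nth_y.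
  rewrite nth_t nth_y in good_cap.
  rewrite /slice_op /next_labels /next_classes /relabel /bad_cap /=.
  rewrite nth_t nth_y (negbTE good_cap).
  have -> : take (size P).+1 ls ++ drop (size P).+3 ls = P ++ y :: Q.
    by rewrite def_ls take1_split drop3_split -catA.
  rewrite map_cat /= def_n -size_p at_pos_split def_ls /= !dot_vector_cat ?size_map //.
  have -> : identify y t y = y by rewrite /identify (negbTE good_cap).
  rewrite /=.
  set F := mask q Q ++ D ++ mask p P.
  have defF : mask q (map (identify y t) Q) ++ map (identify y t) D ++ mask p (map (identify y t) P) = map (identify y t) F.
    by rewrite /F !map_cat !map_mask.
  have in_rs r : r \in [:: y; z; t] -> r \in rs.
    by move=> r_in; apply: ls_rs; rewrite def_ls mem_cat -[[:: y, z, t & Q]]/([:: y; z; t] ++ Q) mem_cat r_in orbT.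
  have y_rs : y \in rs by apply: in_rs; rewrite inE eqxx.
  have t_rs : t \in rs by apply: in_rs; rewrite !inE eqxx !orbT.
  case: x {def_n} => /=; rewrite defF; first by rewrite good_identify2.
  rewrite good_identify //; have := good_exclusive F y_rs t_rs good_cap.
  by case: (good rs _); case: (good rs _) => //= _; rewrite ?addr0 ?add0r.
- have [P [y [z [t [Q [def_ls def_i]]]]]] := @cut3 _ ls i ltac:(lia).
  have [p [x [d [u [q [def_n size_p]]]]]] := @cut3 _ n i ltac:(lia).
  subst i.
  have nth_ls k : nth (0, 0)%N ls (size P + k) = nth (0, 0)%N [:: y, z, t & Q] k.
    by rewrite def_ls nth_split.
  have := nth_ls 0%N; have := nth_ls 1%N; have := nth_ls 2%N; rewrite addn2 addn1 addn0 /= => nth_t nth_z nth_y.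
  rewrite /slice_op /next_labels /next_classes !big_cons big_nil /side_label /=.
  rewrite nth_t nth_z nth_y; set wt := side_weight _ _ v; set new := (_, _).
  have -> : take (size P).+1 ls ++ new :: drop (size P).+2 ls = P ++ [:: y, new, t & Q].
    by rewrite def_ls take1_split drop2_split -catA.
  rewrite def_n -size_p at_pos_split def_ls /= !dot_vector_cat_cons // !dot_vector_cat //.
  set E := D ++ mask p P.
  have E_rs : {subset mask q Q ++ E <= rs}.
    move=> r; rewrite !mem_cat => /or3P[/mem_mask|/D_rs//|/mem_mask] r_ls; apply: ls_rs;
    by rewrite def_ls mem_cat ?inE r_ls ?orbT.
  have in_rs r : r \in [:: y; z; t] -> r \in rs.
    by move=> r_in; apply: ls_rs; rewrite def_ls mem_cat -[[:: y, z, t & Q]]/([:: y; z; t] ++ Q) mem_cat r_in orbT.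
  have newE : new \notin mask q Q ++ E.
    by apply/negP => /E_rs; apply/negP/fresh.
  have new_neq r : r \in [:: y; z; t] -> (new == r) = false.
    by move=> /in_rs r_rs; apply/negbTE/eqP => newy; move: (fresh (size P).+1); rewrite -/new newy r_rs.
  rewrite /wt; set wL := _ Leftward; set wR := _ Rightward; set wU := _ Upward; set wD := _ Downward.
  have drop0n B : good rs (new :: B) = good rs B by rewrite good_notin // fresh.
  have drop1 r B : good rs [:: r, new & B] = good rs (r :: B) by rewrite good_swap drop0n.
  have drop2 r r' B : good rs [:: r, r', new & B] = good rs [:: r, r' & B].
    by rewrite -[RHS]drop0n; apply: good_perm; apply/permP => pr /=; lia.
  have [y_rs t_rs] : y \in rs /\ t \in rs by split; apply: in_rs; rewrite !inE eqxx ?orbT.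
  have dupt r B : good rs [:: t, r, t & B] = false
    by rewrite -[RHS](good_dup (r :: B) t_rs); apply: good_perm; apply/permP => pr /=; lia.
  case: x d u {def_n} => [] [] [] /=; rewrite ?(eq_sym _ new) ?eqxx ?new_neq ?(count_memPn newE) /= ?addn0 ?addn1 ?inE ?eqxx ?orbT //=;
    rewrite ?drop2 ?drop1 ?drop0n ?dupt ?good_dup // /= ?(good_swap _ z y); rewrite ?(good_swap _ t y) ?mulr0n ?mulr0; ring.
- by rewrite /slice_op /relabel /= map_id.
Qed.

Fixpoint has_bad_cap (l : nat) (ls : seq label) (w : word) : bool :=
  if w is x :: w' then bad_cap ls x || has_bad_cap l.+1 (next_labels l ls x) w'
  else false.

(** The sum over all ways to place the dots of the remaining vertices. It also makes sense when bad
    Caps occur, so that it can be shown to vanish there independently of the operators. *)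
Fixpoint dot_sum (l : nat) (s : seq bool) (ls rs D : seq label) (w : word) : R :=
  if w is x :: w' then
    if x.2 is Vertex v then
      \sum_(sd <- [:: Leftward; Rightward; Upward; Downward])
        side_weight (nth true s x.1) (nth true s x.1.+1) v sd *
        dot_sum l.+1 (sweep s x) (next_labels l ls x) (next_classes l ls rs x)
                (side_label l ls x.1 sd :: D) w'
    else dot_sum l.+1 (sweep s x) (next_labels l ls x) (next_classes l ls rs x)
                 (map (relabel ls x) D) w'
  else (good rs D)%:R.

Lemma eval_sum (I : Type) (r : seq I) (c : I -> R) (F : I -> vec) s w n :
  eval s w (fun m => \sum_(i <- r) c i * F i m) n = \sum_(i <- r) c i * eval s w (F i) n.
Proof.
have linE := linear_eval s w.
elim: r => [|i r IH].
  rewrite big_nil -[RHS](linear_op0 linE n); congr (eval _ _ _ _).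
  by apply: functional_extensionality => m; rewrite big_nil.
rewrite big_cons -IH -linE; congr (eval _ _ _ _).
by apply: functional_extensionality => m; rewrite big_cons.
Qed.

Lemma relabel_in l s ls rs x r : consistent l s ls rs -> legal_slice s x ->
  r \in rs -> relabel ls x r \in next_classes l ls rs x.
Proof.
case: x => i [c||v|] [size_ls ls_rs _ _] /andP[/= le_i _] r_rs;
  rewrite /relabel /next_classes /bad_cap /= ?inE ?r_rs ?orbT //.
rewrite /identify; set p := nth _ _ i; set q := nth _ _ _.
have in_rs k : (k < size ls)%N -> nth (0, 0)%N ls k \in rs by move=> ?; apply/ls_rs/mem_nth.
have p_rs : p \in rs by apply: in_rs; lia.
have [_|rq] := eqVneq r q; case: eqVneq => [pq|pq] //.
  by rewrite mem_filter pq.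
by rewrite mem_filter rq.
Qed.

Lemma side_label_in l s ls rs i v sd : consistent l s ls rs ->
  legal_slice s (i, Vertex v) ->
  side_label l ls i sd \in next_classes l ls rs (i, Vertex v).
Proof.
move=> [size_ls ls_rs _ _] /andP[/= le_i _]; rewrite /next_classes /= inE.
have in_rs k : (k < size ls)%N -> nth (0, 0)%N ls k \in rs by move=> ?; apply/ls_rs/mem_nth.
by case: sd; rewrite /= ?eqxx // in_rs ?orbT //; lia.
Qed.

Lemma dot_sum_eval l s ls rs D w : consistent l s ls rs -> legal s w ->
  {subset D <= rs} -> ~~ has_bad_cap l ls w ->
  dot_sum l s ls rs D w =
  eval s w (dot_vector ls rs D) (nseq (size (foldl sweep s w)).+1 false).
Proof.
elim: w l s ls rs D => [|x w IH] l s ls rs D cons /=.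
  by move=> _ _ _; rewrite /dot_vector -[false :: _]/(nseq (size s).+1 false) mask_false cats0.
case/andP=> legx legw D_rs; rewrite negb_or => /andP[good_x good_w].
have cons' := next_consistent cons legx.
have step := slice_op_dot_vector cons legx D_rs good_x.
have eval_step f : (forall n, size n = (size (sweep s x)).+1 -> slice_op s x (dot_vector ls rs D) n = f n) ->
  eval (sweep s x) w (slice_op s x (dot_vector ls rs D))
    (nseq (size (foldl sweep (sweep s x) w)).+1 false) =
  eval (sweep s x) w f (nseq (size (foldl sweep (sweep s x) w)).+1 false).
  by move=> eqf; apply: eval_ext; rewrite ?size_nseq.
rewrite (eval_step _ step).
have other : (if x.2 is Vertex _ then False else True) ->
    dot_sum l.+1 (sweep s x) (next_labels l ls x) (next_classes l ls rs x) (map (relabel ls x) D) w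
    = eval (sweep s x) w
        (dot_vector (next_labels l ls x) (next_classes l ls rs x) (map (relabel ls x) D))
        (nseq (size (foldl sweep (sweep s x) w)).+1 false).
  move=> _; apply: IH => // r /mapP[t /D_rs t_rs ->].
  exact: relabel_in cons legx t_rs.
case def_x: x.2 other => [c||v|] other; try exact: other.
rewrite eval_sum; apply: eq_bigr => sd _; rewrite IH // => r.
case: x def_x legx {step eval_step cons' legw good_x good_w other} => i e /= -> legx.
rewrite inE => /predU1P[->|/D_rs r_rs]; first exact: side_label_in cons legx.
by rewrite /next_classes /= inE r_rs orbT.
Qed.

Lemma good_size (rs D : seq label) : uniq rs -> good rs D -> (size rs <= size D)%N.
Proof.
move=> uniq_rs /allP good_D; apply: uniq_leq_size => // r /good_D /eqP count_r.
by rewrite -has_pred1 has_count count_r.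
Qed.

(** A count in the manner of Euler: the equality [2 * size D + size s = 2 * size rs + 1] is
    preserved by every slice except a bad Cap, which removes two strands without removing a region.
    At the end, with one strand left, there are then more regions than dots. *)
Lemma dot_sum_deficient l s ls rs D w : consistent l s ls rs -> legal s w ->
  size (foldl sweep s w) = 1 ->
  (2 * size D + size s < 2 * size rs + 1 \/
   has_bad_cap l ls w /\ 2 * size D + size s = 2 * size rs + 1)%N ->
  dot_sum l s ls rs D w = 0.
Proof.
elim: w l s ls rs D => [|x w IH] l s ls rs D cons.
  move=> _ /= size_s [] lt; last by case: lt.
  case: cons => _ _ uniq_rs _; case good_D: (good rs D) => //.
  by have := good_size uniq_rs good_D; lia.
move=> /= /andP[legx legw] size_s lt; have cons' := next_consistent cons legx.
have {}IH := IH _ _ _ _ _ cons' legw size_s.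
have := size_sweep legx; move: cons' legw size_s IH; move: (sweep s x) => s' _ _ _ IH size_s'.
case: cons legx lt => size_ls ls_rs uniq_rs _ /andP[le_i _].
have in_rs k : (k < size ls)%N -> nth (0, 0)%N ls k \in rs by move=> ?; apply/ls_rs/mem_nth.
case: x le_i size_s' IH => i [c||v|] /= le_i size_s' IH lt.
- by apply: IH; rewrite size_map /next_classes /=; lia.
- apply: IH; rewrite size_map /next_classes /bad_cap /=; move: lt; rewrite /bad_cap /=.
  case: eqVneq => [_|ne] /= lt; first by lia.
  have q_rs : nth (0, 0)%N ls i.+2 \in rs by apply: in_rs; lia.
  rewrite -rem_filter // size_rem //.
  have : (0 < size rs)%N by case: (rs) q_rs.
  by move: (size rs) lt => sz lt; case: lt => lt; [left|right]; lia.
- rewrite big1 // => sd _; rewrite IH ?mulr0 // /next_classes /=.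
  by case: lt => lt; [left|right]; lia.
- by apply: IH; rewrite size_map /next_classes /=; case: lt => lt; [left|right]; lia.
Qed.

(** * Removing a missing dot: Caps which join a region to itself *)

(* Removes a missing dot at the cell g, with the same sign rule as [create]. *)
Fixpoint contract (g : nat) (f : vec) (n : seq bool) : R :=
  match g, n with
  | 0, x :: m => if x then 0 else f (true :: m)
  | g'.+1, x :: m => if x then - contract g' (fun m => f (x :: m)) m
                     else contract g' (fun m => f (x :: m)) m
  | _, _ => 0
  end.

(** The sign changes every two cells. It compensates the sign that [contract] picks up when it
    passes from the lower to the upper outer cell of a Cup, over the missing dot between them. *)
Fixpoint cell_sign (g : nat) : R := if g is g'.+2 then - cell_sign g' else 1.

Definition contraction (g : nat) (f : vec) : vec := fun n => cell_sign g * contract g f n.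

Lemma linear_contract g : linear_op (contract g).
Proof.
elim: g => [|g IH] k f h [|[] n] /=; rewrite ?mulr0 ?addr0 ?IH //.
by ring.
Qed.

Definition exchanges (F : operator) (g h : nat) (c : R) : Prop :=
  forall f n, contract g (F f) n = c * F (contract h f) n.

Lemma exchanges_at_pos i F g h c : linear_op F -> exchanges F g h c ->
  exchanges (at_pos i F) (i + g) (i + h) c.
Proof.
move=> linF ex; elim: i => [|i IH] f [|x n] //=; first by rewrite mulr0.
have linA := linear_at_pos linF i.
rewrite !IH; case: x => //; rewrite -mulrN; congr (_ * _).
rewrite -mulN1r -(linear_opZ linA); congr (at_pos _ _ _ _).
by apply: functional_extensionality => m; rewrite mulN1r.
Qed.

Lemma exchanges_below i F g : linear_op F -> (g < i)%N ->
  exchanges (at_pos i F) g g 1.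
Proof.
move=> linF lt_gi; rewrite -(subnKC lt_gi) addSnnS -[g in exchanges _ g g]addn0.
move: (i - g.+1)%N.+1 (ltn0Sn (i - g.+1)) => j j_gt0.
have -> : at_pos (g + j) F = at_pos g (at_pos j F).
  apply: functional_extensionality => f; apply: functional_extensionality => n.
  by elim: g f n {lt_gi} => [|g IH] f [|x n] //=.
apply: exchanges_at_pos; first exact: linear_at_pos.
case: j j_gt0 => // j _ f [|x n] /=; rewrite mul1r //; case: x => //.
by rewrite (linear_op0 (linear_at_pos linF _)).
Qed.

Lemma exchanges_cup0 : exchanges (cup_op) 0 0 1.
Proof. by move=> f [|[] [|[] [|[] n]]] //=; rewrite ?mulr0 ?mul1r. Qed.

Lemma exchanges_cup g : exchanges (cup_op) g.+2 g (-1).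
Proof.
have lin0 := linear_op0 (linear_contract _).
by move=> f [|[] [|[] [|[] n]]] //=; case: g => [|g] /=; rewrite ?lin0; ring.
Qed.

Lemma exchanges_cap0 : exchanges (cap_op) 0 0 1.
Proof. by move=> f [|[] n] //=; ring. Qed.

Lemma exchanges_cap2 : exchanges (cap_op) 0 2 (-1).
Proof. by move=> f [|[] n] //=; ring. Qed.

Lemma exchanges_cap g : exchanges (cap_op) g.+1 g.+3 (-1).
Proof.
have linD := linear_opD (linear_contract _).
by move=> f [|[] n] //=; rewrite ?linD; ring.
Qed.

Lemma exchanges_vertex0 wt : exchanges (vertex_op wt) 0 0 1.
Proof. by move=> f [|[] [|[] [|[] n]]] //=; ring. Qed.

Lemma exchanges_vertex wt g : exchanges (vertex_op wt) g.+2 g.+2 1.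
Proof.
have lin0 := linear_op0 (linear_contract _).
have linD := linear_opD (linear_contract _).
have linZ := linear_opZ (linear_contract _).
by move=> f [|[] [|[] [|[] n]]] //=; case: g => [|g] /=; rewrite ?(lin0, linD, linZ); ring.
Qed.

Lemma contraction_exchange F g h c f n : linear_op F -> exchanges F g h c ->
  cell_sign g * c = cell_sign h -> contraction g (F f) n = F (contraction h f) n.
Proof.
move=> linF ex sgn; rewrite /contraction ex mulrA sgn.
by rewrite (linear_opZ linF).
Qed.

Lemma cell_signS i g : cell_sign (i + g.+2) = - cell_sign (i + g).
Proof. by rewrite !addnS. Qed.

(** Behind the Cap the two outer cells have become the cell [i], and removing a dot there can be
    pulled back to either of them. *)
Lemma contraction_cap s i f n :
  slice_op s (i, Cap) (contraction i f) n = slice_op s (i, Cap) (contraction i.+2 f) n.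
Proof.
have linA := linear_at_pos (linear_cap_op) i.
have := exchanges_at_pos i (linear_cap_op) exchanges_cap0.
have := exchanges_at_pos i (linear_cap_op) exchanges_cap2.
rewrite addn0 addn2 => ex2 ex0; rewrite /slice_op /=.
rewrite -(contraction_exchange _ _ linA ex0) ?mulr1 //.
by rewrite (contraction_exchange _ _ linA ex2) //= mulrN1.
Qed.

(** A cell above a turning point is shifted by two, and the change of [cell_sign] absorbs the sign
    arising from [contract]. *)
Lemma contraction_step l ls s x g f : legal_slice s x -> size ls = (size s).+1 ->
  (g < size (next_labels l ls x))%N ->
  [/\ nth (0, 0)%N (next_labels l ls x) g = (l.+1, x.1.+1), g = x.1.+1
    & relabel ls x = id] \/
  exists h, [/\ (h < size ls)%N,
    nth (0, 0)%N (next_labels l ls x) g = relabel ls x (nth (0, 0)%N ls h)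
    & contraction g (slice_op s x f) = slice_op s x (contraction h f)].
Proof.
have low F i : linear_op F -> exchanges F 0 0 1 -> (g <= i)%N ->
    contraction g (at_pos i F f) = at_pos i F (contraction g f).
  move=> linF ex0 le_gi; apply: functional_extensionality => n.
  apply: (@contraction_exchange _ g g 1); rewrite ?mulr1 //; first exact: linear_at_pos.
  move: le_gi; rewrite leq_eqVlt => /predU1P[->|lt_gi]; last exact: exchanges_below.
  by have := exchanges_at_pos i linF ex0; rewrite addn0.
have high F i k h c : linear_op F -> exchanges F k h c -> g = (i + k)%N ->
    cell_sign (i + k) * c = cell_sign (i + h) ->
    contraction g (at_pos i F f) = at_pos i F (contraction (i + h) f).
  move=> linF ex -> sgn; apply: functional_extensionality => n.
  apply: (contraction_exchange _ _ _ _ sgn); first exact: linear_at_pos.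
  exact: exchanges_at_pos.
case: x => i [c||v|]; rewrite /legal_slice /= => /andP[le_i _] size_ls;
  rewrite /next_labels /relabel /=; last by right; exists g.
- rewrite nth_cut; last by lia.
  rewrite size_cat /= size_takel ?size_drop; last by lia.
  case: (leqP g i) => [le_gi|lt_ig] lt_g.
    by right; exists g; split; [lia| |apply: low => //; [apply: linear_cup_op|apply: exchanges_cup0]].
  case def_k: (g - i.+1)%N => [|k] /=; first by left; split=> //; lia.
  right; exists (i + k)%N; split; [lia|by rewrite nth_drop|].
  apply: (high _ _ k.+2 _ (-1)); [exact: linear_cup_op|exact: exchanges_cup|move=> /=; lia|].
  by rewrite cell_signS mulrNN mulr1.
- rewrite size_map size_cat size_takel ?size_drop; last by lia.
  move=> lt_g; right; rewrite (nth_map (0, 0)%N); last first.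
    rewrite size_cat size_takel ?size_drop; lia.
  rewrite nth_cut; last by lia.
  case: (leqP g i) => [le_gi|lt_ig].
    by exists g; split; [lia| |apply: low => //; [apply: linear_cap_op|apply: exchanges_cap0]].
  exists (i + (g - i.+1).+3)%N; split; [lia|by rewrite nth_drop !addnS|].
  apply: (high _ _ (g - i.+1)%N.+1 _ (-1)); [exact: linear_cap_op|exact: exchanges_cap|move=> /=; lia|].
  by rewrite (cell_signS i (g - i.+1).+1) mulrN1.
- rewrite nth_cut; last by lia.
  rewrite size_cat /= size_takel ?size_drop; last by lia.
  case: (leqP g i) => [le_gi|lt_ig] lt_g.
    by right; exists g; split; [lia| |apply: low => //; [apply: linear_vertex_op|apply: exchanges_vertex0]].
  case def_k: (g - i.+1)%N => [|k] /=; first by left; split=> //; lia.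
  right; exists (i + k.+2)%N; split; [lia|by rewrite nth_drop !addnS|].
  apply: (high _ _ k.+2 _ 1); [exact: linear_vertex_op|exact: exchanges_vertex|move=> /=; lia|].
  by rewrite mulr1.
Qed.

(* This is where planarity enters: it holds for the vacuum and is preserved by
   all slices, whereas a Cap joining a region to itself kills such an f. *)
Definition region_invariant (ls : seq label) (f : vec) : Prop := forall g h,
  (g < size ls)%N -> (h < size ls)%N ->
  nth (0, 0)%N ls g = nth (0, 0)%N ls h -> contraction g f = contraction h f.

Lemma region_invariant_step l s ls rs x f : consistent l s ls rs ->
  legal_slice s x -> region_invariant ls f ->
  region_invariant (next_labels l ls x) (slice_op s x f).
Proof.
move=> [size_ls ls_rs uniq_rs rs_l] legx inv g h lt_g lt_h eq_gh.
have fresh k k' : (k < size ls)%N -> nth (0, 0)%N ls k <> (l.+1, k').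
  by move=> lt_k eq_k; have := rs_l _ (ls_rs _ (mem_nth (0, 0)%N lt_k)); rewrite eq_k ltnn.
have := contraction_step f legx size_ls lt_g; have := contraction_step f legx size_ls lt_h.
case=> [[nth_h def_h idr]|[h' [lt_h' nth_h con_h]]];
case=> [[nth_g def_g idr']|[g' [lt_g' nth_g con_g]]].
- by rewrite def_h def_g.
- by move: eq_gh; rewrite nth_h nth_g idr => /fresh; case.
- by move: eq_gh; rewrite nth_h nth_g idr' => /esym/fresh; case.
rewrite con_g con_h; move: eq_gh; rewrite nth_g nth_h.
case: x legx {lt_g lt_h nth_h nth_g con_h con_g} => i e legx.
case: e legx => [c||v|] legx; rewrite /relabel /=; try by move=> /(inv _ _ lt_g' lt_h') ->.
have [lt_i lt_i2] : (i < size ls /\ i.+2 < size ls)%N by case/andP: legx => /=; lia.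
(* This links the two regions which the Cap merges: a cell of one can be traded for a cell of the
   other. *)
have cap_eq : slice_op s (i, Cap) (contraction i f) = slice_op s (i, Cap) (contraction i.+2 f).
  by apply: functional_extensionality => n; apply: contraction_cap.
rewrite /identify; case: eqP => [eq_g|_]; case: eqP => [eq_h|_].
- by rewrite (inv g' h') // eq_g eq_h.
- move=> eq_ih; rewrite (inv g' i.+2) // (inv h' i) //; exact/esym.
- move=> eq_gi; rewrite (inv h' i.+2) // (inv g' i) //.
- by move=> /(inv _ _ lt_g' lt_h') ->.
Qed.

Definition prefix_sign (P : seq bool) : R := foldr (fun x z => if x then - z else z) 1 P.

Lemma contract_cat P g f m :
  contract (size P + g) f (P ++ m) = prefix_sign P * contract g (fun m => f (P ++ m)) m.
Proof. by elim: P f => [|[] P IH] f /=; rewrite ?mul1r ?IH ?mulNr. Qed.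

Lemma sqr_prefix_sign P : prefix_sign P * prefix_sign P = 1.
Proof. by elim: P => [|[] P IH] /=; rewrite ?mulrNN ?mul1r. Qed.

Lemma sqr_cell_sign g : cell_sign g * cell_sign g = 1.
Proof.
have [k] := ubnP g; elim: k g => // k IH [|[|g]] /= lt_g; rewrite ?mul1r ?mulrNN //.
by apply: IH; lia.
Qed.

(** The cells [i] and [i.+2] lie in one region, so the contractions there agree. As [cell_sign]
    differs at them, this says that the two terms of [cap_op] are opposite when [x] is false, and
    that its only term is zero when [x] is true. *)
Lemma bad_cap_op s ls x f : legal_slice s x -> size ls = (size s).+1 ->
  bad_cap ls x -> region_invariant ls f -> forall n, slice_op s x f n = 0.
Proof.
case: x => i [c||v|] // legx size_ls; rewrite /bad_cap /= => /eqP eq_i inv n.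
have {inv} := inv i i.+2; have -> : (i < size ls)%N by case/andP: legx => /=; lia.
have -> : (i.+2 < size ls)%N by case/andP: legx => /=; lia.
move=> /(_ isT isT eq_i); rewrite /slice_op /=.
move=> eqf; case: (leqP (size n) i) => [le_ni|].
  by elim: i f n {eq_i eqf legx} le_ni => [|i IH] f [|x n] //= le_ni; apply: IH.
case/cut1=> P [x [q [-> def_i]]]; subst i.
have sqr_P := sqr_cell_sign (size P); have := sqr_prefix_sign P.
move: (prefix_sign P) (contract_cat P) => u conE sqr_u.
have eqm m : u * contract 0 (fun m => f (P ++ m)) m = - (u * contract 2 (fun m => f (P ++ m)) m).
  have := congr1 (fun h => cell_sign (size P) * h (P ++ m)) eqf.
  have := conE 0%N f m; have := conE 2%N f m; rewrite addn0 addn2 => c2 c0.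
  rewrite /contraction c0 c2 [cell_sign _.+2]/= mulNr mulrN.
  by rewrite !(mulrA (cell_sign _) (cell_sign _)) sqr_P !mul1r.
have {}eqm m : contract 0 (fun m => f (P ++ m)) m = - contract 2 (fun m => f (P ++ m)) m.
  by have := congr1 ( *%R u) (eqm m); rewrite mulrN !mulrA sqr_u !mul1r.
rewrite at_pos_split /=; case: x.
  by have := eqm [:: false, false, true & q]; rewrite /= oppr0.
by have := eqm [:: false, false, false & q]; rewrite /= => ->; rewrite addrN.
Qed.

Lemma eval_bad_cap l s ls rs w f n : consistent l s ls rs -> legal s w ->
  has_bad_cap l ls w -> region_invariant ls f -> eval s w f n = 0.
Proof.
elim: w l s ls rs f => //= x w IH l s ls rs f cons /andP[legx legw].
have [bad _ inv|_ /= bad inv] := boolP (bad_cap ls x); last first.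
  apply: IH (next_consistent cons legx) legw bad _.
  exact: region_invariant_step cons legx inv.
have -> : slice_op s x f = fun=> 0.
  by apply: functional_extensionality => m; case: cons => size_ls _ _ _; apply: bad_cap_op bad inv m.
exact: linear_op0 (linear_eval (sweep s x) w) n.
Qed.

End Transfer.

(** * Lists of choices *)

Fixpoint selections (C : Type) (os : seq (seq C)) : seq (seq C) :=
  if os is o :: os' then [seq c :: cs | c <- o, cs <- selections os'] else [:: [::]].

Lemma mem_selections (C : eqType) (os : seq (seq C)) cs :
  (cs \in selections os) = all2 (fun c (o : seq C) => c \in o) cs os.
Proof.
elim: os cs => [|o os IH] [|c cs] //=.
  by apply/allpairsP; case=> -[d ds] [].
apply/allpairsP/andP => [[[d ds] /= [d_o ds_os [-> ->]]]|[c_o]]; first by rewrite d_o -IH.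
by rewrite -IH => cs_os; exists (c, cs).
Qed.

Lemma uniq_selections (C : eqType) (os : seq (seq C)) : all uniq os -> uniq (selections os).
Proof.
elim: os => //= o os IH /andP[uniq_o /IH uniq_os].
by apply: allpairs_uniq => // -[c cs] [d ds] _ _ [-> ->].
Qed.

(** States are indexed by finite functions, or by sets, whereas the operators unfold slice by slice.
    This bridge serves both state sums, with corners and with smoothings as choices. *)
Lemma sum_ffun_selections (R : nmodType) (C : finType) (n : nat) (os : seq (seq C))
    (F : seq C -> R) : size os = n -> all uniq os ->
  \sum_(h : {ffun 'I_n -> C} | [forall j : 'I_n, h j \in nth [::] os j]) F [seq h j | j <- enum 'I_n]
  = \sum_(cs <- selections os) F cs.
Proof.
move=> size_os uniq_os.
rewrite -big_filter -(big_map (fun h : {ffun 'I_n -> C} => [seq h j | j <- enum 'I_n]) xpredT F).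
have nth_h (h : {ffun 'I_n -> C}) (j : 'I_n) c : nth c [seq h j | j <- enum 'I_n] j = h j.
  by rewrite (nth_map j) ?size_enum_ord // nth_ord_enum.
apply: perm_big; apply: uniq_perm.
- rewrite map_inj_in_uniq ?filter_uniq ?index_enum_uniq // => h h' _ _ eq_h.
  by apply/ffunP => j; rewrite -(nth_h h j (h j)) eq_h nth_h.
- exact: uniq_selections.
move=> cs; rewrite mem_selections all2E; apply/mapP/andP => [[h]|[]].
  rewrite mem_filter => /andP[/forallP h_os _] ->.
  have size_h : size [seq h j | j <- enum 'I_n] = size os by rewrite size_map size_enum_ord.
  rewrite size_h; split=> //.
  apply/allP => -[c o] /(nthP (c, o)) [j]; rewrite size_zip size_h size_os minnn.
  move=> lt_j; rewrite nth_zip // => -[<- <-] /=.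
  have -> : nth o os j = nth [::] os j by apply: set_nth_default; rewrite size_os.
  by have := nth_h h (Ordinal lt_j) c; rewrite /= => ->; apply: (h_os (Ordinal lt_j)).
rewrite size_os => /eqP size_cs /allP cs_os.
(* For [n = 0] there may be no element of [C] to serve as a default value. *)
case: n size_os size_cs nth_h => [|n] size_os size_cs nth_h.
  exists [ffun j : 'I_0 => match j with Ordinal m lt_m => False_rect C (notF lt_m) end].
    by rewrite mem_filter mem_index_enum andbT; apply/forallP => -[].
  by rewrite (size0nil size_cs) enum_ord0.
have [c0 cs0 def_cs] : exists2 c, True & c \in cs.
  by case: (cs) size_cs => // c cs' _; exists c; rewrite ?mem_head.
exists [ffun j : 'I_n.+1 => nth c0 cs j].
  rewrite mem_filter mem_index_enum andbT; apply/forallP => j; rewrite ffunE.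
  apply: (cs_os (nth c0 cs j, nth [::] os j)); rewrite -nth_zip ?size_os //.
  by apply: mem_nth; rewrite size_zip size_os size_cs minnn.
apply: (@eq_from_nth _ c0) => [|j]; first by rewrite size_map size_enum_ord.
rewrite size_cs => lt_j.
by have := nth_h [ffun j : 'I_n.+1 => nth c0 cs j] (Ordinal lt_j) c0; rewrite ffunE /= => ->.
Qed.

Lemma big_selections_cons (R : Type) (idx : R) (op : Monoid.law idx) (C : Type) o (os : seq (seq C))
    (F : seq C -> R) :
  \big[op/idx]_(cs <- selections (o :: os)) F cs
  = \big[op/idx]_(c <- o) \big[op/idx]_(cs <- selections os) F (c :: cs).
Proof. exact: big_allpairs_dep. Qed.

(** * Regions and labels *)

Section Regions.
Variable w : word.
Hypothesis legal_w : legal [:: true] w.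
Hypothesis marks_w : marks w = 0.
Local Notation N := (size w).
Local Notation lev := (level [:: true] w).
Local Notation sl := (slice_at w).
Local Notation mk := (mkcell [:: true] w).
Local Notation same := (@same_region [:: true] w).
Local Open Scope nat_scope.

(* the names of the cells at level k, and those of all the regions met so far *)
Fixpoint state (k : nat) : seq label * seq label :=
  if k is k'.+1 then
    (next_labels k' (state k').1 (sl k'), next_classes k' (state k').1 (state k').2 (sl k'))
  else ([:: (0, 0); (0, 1)], [:: (0, 0); (0, 1)]).

Local Notation labels k := (state k).1.
Local Notation classes k := (state k).2.

Lemma levelS k : k < N -> lev k.+1 = sweep (lev k) (sl k).
Proof.
by move=> lt_k; rewrite /level (take_nth (0, Mark)) // -cats1 foldl_cat.
Qed.

Lemma legal_slice_at k : k < N -> legal_slice (lev k) (sl k).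
Proof.
move=> lt_k; have := legal_w.
rewrite -{1}(cat_take_drop k w) legal_cat => /andP[_].
by rewrite (drop_nth (0, Mark)) //= => /andP[].
Qed.

Lemma state_consistent k : k <= N -> consistent k (lev k) (labels k) (classes k).
Proof.
elim: k => [|k IH] lt_k.
  rewrite /level take0 /=; split=> //.
  by move=> r; rewrite !inE => /orP[] /eqP ->.
rewrite levelS //; exact: next_consistent (IH (ltnW lt_k)) (legal_slice_at lt_k).
Qed.

Lemma not_mark k : k < N -> ~~ is_mark (sl k).2.
Proof.
move=> lt_k; apply/negP => mark_k; move: marks_w; rewrite /marks => /eqP.
rewrite -leqn0 leqNgt -has_count -(cat_take_drop k w) has_cat (drop_nth (0, Mark)) //=.
by rewrite mark_k orbT.
Qed.

Lemma tag_mk k g : k <= N -> tag (mk k g) = k :> nat.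
Proof. by move=> le_k; rewrite /= inordK. Qed.

Lemma tagged_mk k g : k <= N -> g <= size (lev k) -> tagged (mk k g) = g :> nat.
Proof. by move=> le_k le_g; rewrite /= inordK // ltnS /= inordK. Qed.

Lemma mk_tag (c : cell [:: true] w) : mk (tag c) (tagged c) = c.
Proof.
case: c => l g /=; rewrite /mkcell /=.
have eq_l : inord l = l by apply: inord_val.
rewrite [inord (val l)]eq_l; congr Tagged; exact: inord_val.
Qed.

Lemma tag_lt (c : cell [:: true] w) : tag c <= N.
Proof. by rewrite -ltnS. Qed.

Lemma tagged_le (c : cell [:: true] w) : tagged c <= size (lev (tag c)).
Proof. by rewrite -ltnS. Qed.

Lemma adjacent_mk k g g' : k < N -> g <= size (lev k) -> g' <= size (lev k.+1) ->
  g <= (sl k).1 /\ g' = g \/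
  (sl k).1 + inputs (sl k).2 <= g /\ g' + inputs (sl k).2 = g + outputs (sl k).2 ->
  same (mk k g) (mk k.+1 g').
Proof.
move=> lt_k le_g le_g' adj; apply: connect1; apply/orP; left.
rewrite /adjacent (tagged_mk (ltnW lt_k) le_g) (tagged_mk lt_k le_g') (tag_mk _ (ltnW lt_k)) (tag_mk _ lt_k).
case: (sl k) adj => i e /= adj; rewrite eqxx /=; lia.
Qed.

Lemma same_sym a b : same a b = same b a.
Proof. by apply: sym_connect_sym => x y /=; rewrite orbC. Qed.

Lemma same_trans a b c : same a b -> same b c -> same a c.
Proof. exact: connect_trans. Qed.

(** Follows a name from level [k] through [m] further slices, whose Caps may identify it with
    others. *)
Fixpoint final (m k : nat) (r : label) : label :=
  if m is m'.+1 then final m' k.+1 (relabel (labels k) (sl k) r) else r.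

Definition final_label k r := final (N - k) k r.

Lemma final_labelS k r : k < N ->
  final_label k r = final_label k.+1 (relabel (labels k) (sl k) r).
Proof. by move=> lt_k; rewrite /final_label -(subnSK lt_k). Qed.

Lemma final_label_end r : final_label N r = r.
Proof. by rewrite /final_label subnn. Qed.

Definition cell_label (c : cell [:: true] w) : label :=
  final_label (tag c) (nth (0, 0) (labels (tag c)) (tagged c)).

Lemma cell_label_mk k g : k <= N -> g <= size (lev k) ->
  cell_label (mk k g) = final_label k (nth (0, 0) (labels k) g).
Proof. by move=> le_k le_g; rewrite /cell_label (tagged_mk le_k le_g) (tag_mk _ le_k). Qed.

Lemma nth_next k g g' : k < N -> g <= size (lev k) -> g' <= size (lev k.+1) ->
  g <= (sl k).1 /\ g' = g \/
  (sl k).1 + inputs (sl k).2 <= g /\ g' + inputs (sl k).2 = g + outputs (sl k).2 ->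
  nth (0, 0) (labels k.+1) g' = relabel (labels k) (sl k) (nth (0, 0) (labels k) g).
Proof.
move=> lt_k le_g le_g' adj.
have [size_l _ _ _] := state_consistent (ltnW lt_k).
have [size_l' _ _ _] := state_consistent lt_k.
have := legal_slice_at lt_k; have := not_mark lt_k; move: adj size_l' => /=.
rewrite levelS // in le_g' *; have := size_sweep (legal_slice_at lt_k).
case: (sl k) le_g' => i [c||v|] //=; rewrite /next_labels /relabel /legal_slice /=.
- move=> le_g' sz adj size_l' _ /andP[le_i _].
  rewrite nth_cut; last by lia.
  case: adj => -[adj eq_g'].
    by rewrite eq_g' adj.
  have -> : g' = g.+2 by lia.
  have -> : (g.+2 <= i) = false by lia.
  rewrite subSS -[g.+1]addn1 -addnBAC ?addn1 /= ?nth_drop; [|lia].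
  by rewrite subnKC //; lia.
- move=> le_g' sz adj size_l' _ /andP[le_i _].
  rewrite (nth_map (0, 0)); last first.
    rewrite size_cat size_takel ?size_drop; lia.
  rewrite nth_cut; last by lia.
  have [le_gi|lt_ig] := leqP g' i.
    case: adj => -[adj eq_g']; first by rewrite eq_g'.
    have [-> ->] : g' = i /\ g = i.+2 by lia.
    by rewrite /identify eqxx; case: eqP.
  by rewrite nth_drop; congr (identify _ _ (nth _ _ _)); lia.
- move=> le_g' sz adj size_l' _ /andP[le_i _].
  rewrite nth_cut; last by lia.
  case: adj => -[adj eq_g'].
    by rewrite eq_g' adj.
  have -> : g' = i.+1 + (g - i.+2).+1 by lia.
  have -> : (i.+1 + (g - i.+2).+1 <= i) = false by lia.
  by rewrite addKn /= nth_drop; congr (nth _ _ _); lia.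
Qed.

Lemma adjacent_label (a b : cell [:: true] w) : adjacent a b -> cell_label a = cell_label b.
Proof.
rewrite /adjacent; have := tag_lt a; have := tagged_le a; have := tag_lt b; have := tagged_le b.
rewrite /cell_label.
move: (nat_of_ord (tagged a)) (nat_of_ord (tagged b)) => g g'.
move: (nat_of_ord (tag a)) (nat_of_ord (tag b)) => k k' le_g' lt_k' le_g le_k.
case def_x: (sl k) => [i e] /andP[/eqP eq_k'] adj; subst k'.
rewrite [LHS]final_labelS //; congr (final_label _ _).
by apply/esym/nth_next => //; rewrite def_x /=; lia.
Qed.

Lemma same_label a b : same a b -> cell_label a = cell_label b.
Proof.
case/connectP => p path_p ->; elim: p a path_p => //= c p IH a /andP[/orP adj /IH <-].
by case: adj => /adjacent_label.
Qed.

(** The parity of the height of a cell is the chessboard colouring of the regions. It shows that the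
    two star regions are different. *)
Lemma same_parity a b : same a b -> odd (tagged a) = odd (tagged b).
Proof.
have adj_odd (c d : cell [:: true] w) : adjacent c d -> odd (tagged c) = odd (tagged d).
  rewrite /adjacent.
  move: (nat_of_ord (tagged c)) (nat_of_ord (tagged d)) => g g'.
  move: (nat_of_ord (tag c)) (nat_of_ord (tag d)) => k k'.
  case: (sl k) => [i e] /andP[_ /orP[/andP[_ /eqP ->]//|/andP[_ /eqP]]].
  by move/(congr1 odd); rewrite !oddD; case: e => [x||v|] /=; rewrite ?addbF;
    [move=> ->|move=> ->|move=> ->|move/addIb=> ->].
case/connectP => p path_p ->; elim: p a path_p => //= c p IH a /andP[/orP adj /IH <-].
by case: adj => /adj_odd.
Qed.

Local Notation mkl r := (mk r.1 r.2).

Definition follows (x : slice) (g g' : nat) : Prop :=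
  g <= x.1 /\ g' = g \/ x.1 + inputs x.2 <= g /\ g' + inputs x.2 = g + outputs x.2.

Lemma new_label k : k < N -> (if (sl k).2 is Cap then False else True) ->
  nth (0, 0) (labels k.+1) (sl k).1.+1 = (k.+1, (sl k).1.+1).
Proof.
move=> lt_k; have [size_l _ _ _] := state_consistent (ltnW lt_k).
have := legal_slice_at lt_k; have := not_mark lt_k => /=.
case: (sl k) => i [c||v|] //=; rewrite /next_labels /legal_slice /= => _ /andP[le_i _] _;
  by rewrite nth_cut ?ltnn ?subnn //; lia.
Qed.

Lemma cell_origin k g : k < N -> g <= size (lev k.+1) ->
  (exists2 g0, g0 <= size (lev k) & follows (sl k) g0 g) \/
  g = (sl k).1.+1 /\ (if (sl k).2 is Cap then False else True).
Proof.
move=> lt_k; have := size_sweep (legal_slice_at lt_k); rewrite -levelS //.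
have := legal_slice_at lt_k; have := not_mark lt_k.
rewrite /legal_slice /follows; case: (sl k) => i e /= nm /andP[le_i _] sz le_g.
have [le_gi|lt_ig] := leqP g i; first by left; exists g; [lia|left].
have [le_ig|lt_gi] := leqP (i + outputs e) g; last first.
  by right; case: e nm le_i sz lt_gi => [c||v|] //= _ le_i sz lt_gi; split=> //; lia.
by left; exists (g + inputs e - outputs e); [lia|right; lia].
Qed.

(** A name is the position of a cell, so paths may lead to it. When a Cap identifies two names, the
    path goes around the turning point: from the cell [i] at level [k] to the cell [i] at level
    [k.+1] and back to the cell [i.+2] at level [k]. *)
Lemma same_own_label k g : k <= N -> g <= size (lev k) ->
  same (mk k g) (mkl (nth (0, 0) (labels k) g)).
Proof.
elim: k g => [|k IH] g lt_k le_g.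
  by move: le_g; rewrite /level take0; case: g => [|[|g]] //= _; apply: connect0.
have [[g0 le_g0 adj]|[-> not_cap]] := cell_origin lt_k le_g; last first.
  by rewrite new_label //; apply: connect0.
rewrite (nth_next lt_k le_g0 le_g adj).
have to_g0 := adjacent_mk lt_k le_g0 le_g adj.
rewrite same_sym in to_g0; apply: same_trans to_g0 _.
apply: same_trans (IH g0 (ltnW lt_k) le_g0) _; rewrite /relabel.
have := size_sweep (legal_slice_at lt_k); rewrite -levelS //.
have := legal_slice_at lt_k; rewrite /legal_slice => /andP[le_i _].
case def_x: (sl k) le_i => [i [c||v|]] //= le_i sz; try exact: connect0.
rewrite /identify; case: eqP => [->|_]; last exact: connect0.
have lt_i : i <= size (lev k) by lia.
have lt_i2 : i.+2 <= size (lev k) by lia.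
have lt_i' : i <= size (lev k.+1) by lia.
have own0 := IH i (ltnW lt_k) lt_i; have own2 := IH i.+2 (ltnW lt_k) lt_i2.
have up0 : same (mk k i) (mk k.+1 i) by apply: adjacent_mk; rewrite ?def_x //=; lia.
have up2 : same (mk k i.+2) (mk k.+1 i) by apply: adjacent_mk; rewrite ?def_x //=; lia.
rewrite same_sym in own0; rewrite same_sym in up2; rewrite same_sym.
exact: same_trans own0 (same_trans up0 (same_trans up2 own2)).
Qed.

Lemma same_relabel k r : k < N -> same (mkl r) (mkl (relabel (labels k) (sl k) r)).
Proof.
move=> lt_k; have := size_sweep (legal_slice_at lt_k); rewrite -levelS //.
have := legal_slice_at lt_k; rewrite /legal_slice /relabel => /andP[le_i _].
case def_x: (sl k) le_i => [i [c||v|]] //= le_i sz; try exact: connect0.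
rewrite /identify; case: eqP => [->|_]; last exact: connect0.
have lt_i : i <= size (lev k) by lia.
have lt_i2 : i.+2 <= size (lev k) by lia.
have lt_i' : i <= size (lev k.+1) by lia.
have own0 := same_own_label (ltnW lt_k) lt_i; have own2 := same_own_label (ltnW lt_k) lt_i2.
have up0 : same (mk k i) (mk k.+1 i) by apply: adjacent_mk; rewrite ?def_x //=; lia.
have up2 : same (mk k i.+2) (mk k.+1 i) by apply: adjacent_mk; rewrite ?def_x //=; lia.
rewrite same_sym in own0; rewrite same_sym in up2; rewrite same_sym.
exact: same_trans own0 (same_trans up0 (same_trans up2 own2)).
Qed.

Lemma same_final k r : k <= N -> same (mkl r) (mkl (final_label k r)).
Proof.
move=> le_k; rewrite -(subKn le_k); move: (N - k) (leq_subr k N) => m.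
elim: m r => [|m IH] r lt_m; first by rewrite subn0 final_label_end; apply: connect0.
have lt_k : N - m.+1 < N by lia.
rewrite final_labelS // (_ : (N - m.+1).+1 = N - m); last by lia.
apply: same_trans (IH _ (ltnW lt_m)); exact: same_relabel.
Qed.

Lemma same_regionP a b : same a b = (cell_label a == cell_label b).
Proof.
apply/idP/eqP => [/same_label //|eq_ab].
have to_label c : same c (mkl (cell_label c)).
  rewrite -{1}(mk_tag c); apply: same_trans (same_own_label (tag_lt c) (tagged_le c)) _.
  exact: same_final (tag_lt c).
by apply: same_trans (to_label a) _; rewrite eq_ab same_sym.
Qed.

Lemma cell_label_class c : cell_label c \in classes N.
Proof.
have step k r : k < N -> r \in classes k -> relabel (labels k) (sl k) r \in classes k.+1.
  move=> lt_k; exact: relabel_in (state_consistent (ltnW lt_k)) (legal_slice_at lt_k).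
have fin k r : k <= N -> r \in classes k -> final_label k r \in classes N.
  move=> le_k; rewrite -{1 2}(subKn le_k); move: (N - k) (leq_subr k N) => m.
  elim: m r => [|m IH] r lt_m; first by rewrite subn0 final_label_end.
  have lt_k : N - m.+1 < N by lia.
  move/(step _ _ lt_k); rewrite final_labelS // (_ : (N - m.+1).+1 = N - m); last by lia.
  by apply: IH; apply: ltnW.
have [size_l ls_rs _ _] := state_consistent (tag_lt c).
apply: fin (tag_lt c) _; apply: ls_rs; apply: mem_nth.
by rewrite size_l ltnS tagged_le.
Qed.

(** Kauffman states quantify over cells, [good] over names. A name still present at the right end
    was never dropped by a Cap, hence never relabelled, and it is the final name of the cell at its
    own position. *)
Lemma class_cell r : r \in classes N -> exists c, cell_label c = r.
Proof.
have own k : k <= N -> r \in classes k ->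
    [/\ r.1 <= k, r.2 <= size (lev r.1) & nth (0, 0) (labels r.1) r.2 = r].
  elim: k => [|k IH] lt_k; first by rewrite !inE => /orP[] /eqP -> /=; rewrite ?/level ?take0.
  have old : r \in classes k -> [/\ r.1 <= k.+1, r.2 <= size (lev r.1) & nth (0, 0) (labels r.1) r.2 = r].
    by move/(IH (ltnW lt_k)) => [/leqW].
  have new := new_label lt_k.
  have := size_sweep (legal_slice_at lt_k); rewrite -levelS //.
  have := legal_slice_at lt_k; rewrite /legal_slice => /andP[le_i _].
  rewrite /= /next_classes; case: (sl k) le_i new => i [c||v|] //= le_i new sz.
  - by rewrite inE => /predU1P[->|/old//]; split=> //=; [lia|apply: new].
  - by case: ifP => _; [move/old|rewrite mem_filter => /andP[_ /old]].
  - by rewrite inE => /predU1P[->|/old//]; split=> //=; [lia|apply: new].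
move=> r_N; have [le_r le_r2 own_r] := own N (leqnn N) r_N.
exists (mkl r); rewrite cell_label_mk // own_r.
have down k : k < N -> r.1 <= k -> r \in classes k.+1 ->
    r \in classes k /\ relabel (labels k) (sl k) r = r.
  move=> lt_k le_rk; rewrite /= /next_classes /relabel /bad_cap.
  have fresh j : (r == (k.+1, j)) = false.
    by apply/negP => /eqP def_r; move: le_rk; rewrite def_r ltnn.
  case: (sl k) => i [c||v|] //=; rewrite ?inE ?fresh //.
  rewrite /identify; case: eqVneq => [->|_]; first by move=> ->; case: eqP.
  by rewrite mem_filter => /andP[/negbTE -> ->].
suff fixed m : m <= N - r.1 -> r \in classes (N - m) /\ final_label (N - m) r = r.
  by have [_] := fixed _ (leqnn _); rewrite subKn.
elim: m => [|m IH] le_m; first by rewrite subn0 final_label_end.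
have lt_k : N - m.+1 < N by lia.
have [] := IH (ltnW le_m); rewrite (_ : N - m = (N - m.+1).+1); last by lia.
have le_rk : r.1 <= N - m.+1 by lia.
move=> /(down _ lt_k le_rk)[r_k rel_k] fin_r.
by rewrite final_labelS // rel_k.
Qed.

End Regions.

(** * Delta as an evaluation of the operators *)

Lemma vA_neq0 : vA != 0.
Proof. by rewrite /vA tofrac_eq0 polyC_eq0 polyX_eq0. Qed.

Lemma vA_mulV : vA * vA^-1 = 1.
Proof. by rewrite mulfV // vA_neq0. Qed.

Section Delta.
Variable w : word.
Hypothesis legal_w : legal [:: true] w.
Hypothesis marks_w : marks w = 0%N.
Local Notation N := (size w).
Local Notation lev := (level [:: true] w).
Local Notation sl := (slice_at w).
Local Notation mk := (mkcell [:: true] w).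
Local Notation same := (@same_region [:: true] w).
Local Notation labels k := (state w k).1.
Local Notation classes k := (state w k).2.
Local Notation final_label := (@final_label w).
Local Notation cell_label := (@cell_label w).

Definition corner_side_at (k : nat) (c : corner) : side :=
  corner_side (climbing [:: true] w k) (descending [:: true] w k) c.

Definition dot_label (k : nat) (c : corner) : label :=
  final_label k.+1 (side_label k (labels k) (sl k).1 (corner_side_at k c)).

Lemma cell_label_corner k c : (k < N)%N -> is_vertex (sl k).2 ->
  cell_label (corner_cell w k c) = dot_label k c.
Proof.
move=> lt_k vert_k; rewrite /corner_cell /dot_label /corner_side_at.
have := new_label legal_w marks_w lt_k; have := final_labelS (w := w) _ lt_k.
have := size_sweep (legal_slice_at legal_w lt_k); rewrite -levelS //.
have := legal_slice_at legal_w lt_k; rewrite /legal_slice => /andP[le_i _].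
case: corner_side; rewrite /relabel; case def_x: (sl k) vert_k le_i => [i [e||v|]] //= _ le_i sz fin new.
- by rewrite cell_label_mk ?fin //; lia.
- by rewrite cell_label_mk ?new //; lia.
- by rewrite cell_label_mk ?fin //; lia.
- by rewrite cell_label_mk ?fin //; lia.
Qed.

Definition corners := [:: North; South; West; East].

(** A slice which is not a vertex receives the dummy choice [North], so that choices can be indexed
    by all slices. *)
Definition options (k : nat) : seq corner :=
  if is_vertex (sl k).2 then corners else [:: North].

Definition corner_weight (k : nat) (c : corner) : K :=
  if is_vertex (sl k).2 then dot_weight w k c else 1.

Definition dot_labels (x : seq (nat * corner)) : seq label :=
  [seq dot_label y.1 y.2 | y <- x & is_vertex (sl y.1).2].

Local Notation dot_sum := (dot_sum vA vA^-1 vB).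

Lemma sum_sides d d' (F : side -> K) :
  \sum_(sd <- [:: Leftward; Rightward; Upward; Downward]) F sd
  = \sum_(c <- corners) F (corner_side d d' c).
Proof. by case: d d' => [] []; rewrite !big_cons !big_nil /=; ring. Qed.

Lemma dot_weight_side k v c : (sl k).2 = Vertex v ->
  side_weight vA vA^-1 vB (climbing [:: true] w k) (descending [:: true] w k) v (corner_side_at k c)
  = dot_weight w k c.
Proof.
move=> vert_k; rewrite /dot_weight vert_k /corner_side_at /positive /parallel.
case: climbing descending => [] [];
  by case: v vert_k c => [[]|] _ []; rewrite /side_weight /=; ring.
Qed.

Lemma dot_sum_selections m k D : (k + m = N)%N ->
  dot_sum k (lev k) (labels k) (classes k) D (drop k w) =
  \sum_(cs <- selections [seq options j | j <- iota k m])
    (\prod_(x <- zip (iota k m) cs) corner_weight x.1 x.2) *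
    (good (classes N) (dot_labels (zip (iota k m) cs) ++ map (final_label k) D))%:R.
Proof.
elim: m k D => [|m IH] k D eq_N.
  have -> : k = N by lia.
  rewrite drop_size /= big_seq1 big_nil mul1r /=; congr (nat_of_bool (good _ _))%:R.
  by rewrite -[LHS]map_id; apply: eq_map => r; rewrite final_label_end.
have lt_k : (k < N)%N by lia.
rewrite (drop_nth (0, Mark)%N) // -/(sl k) /= big_allpairs_dep -levelS //.
have {}IH := IH k.+1 _ ltac:(lia).
have FL r := final_labelS (w := w) r lt_k.
have rest : ~~ is_vertex (sl k).2 ->
    dot_sum k.+1 (lev k.+1) (labels k.+1) (classes k.+1) (map (relabel (labels k) (sl k)) D) (drop k.+1 w)
    = \sum_(c <- [:: North]) \sum_(cs <- selections [seq options j | j <- iota k.+1 m])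
        (\prod_(x <- (k, c) :: zip (iota k.+1 m) cs) corner_weight x.1 x.2) *
        (good (classes N) (dot_labels ((k, c) :: zip (iota k.+1 m) cs) ++ map (final_label k) D))%:R.
  move=> /negbTE vert_k; rewrite IH big_seq1; apply: eq_bigr => cs _.
  rewrite big_cons /= /corner_weight /= vert_k mul1r; congr (_ * (nat_of_bool (good _ _))%:R).
  rewrite /dot_labels /= vert_k; congr (_ ++ _); rewrite -map_comp; apply: eq_map => r.
  by rewrite FL.
case def_x: (sl k).2 rest => [c||v|] /= rest; rewrite [options k]/options def_x /=; try exact: rest.
apply: etrans (sum_sides (climbing [:: true] w k) (descending [:: true] w k) _) _.
apply: eq_bigr => c _; rewrite IH big_distrr /=; apply: eq_bigr => cs _.
rewrite big_cons /= mulrA; congr (_ * _ * (nat_of_bool _)%:R).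
  by rewrite /corner_weight def_x /= -(dot_weight_side _ def_x).
rewrite /dot_labels /= def_x /=.
have -> : map (final_label k) D = map (final_label k.+1) D.
  by apply: eq_map => r; rewrite FL /relabel def_x.
apply: good_perm; rewrite -/(dot_label k c) -[X in perm_eq X]cat0s.
by apply/permP => pr; rewrite /= !count_cat /=; lia.
Qed.

(** Each star region is given one fictitious dot, named [(0, 0)] or [(0, 1)], so that one dot can be
    required of every region; the initial vector is then the vacuum. If there is a bad Cap, the left
    side vanishes by counting dots and the right side by removing one. *)
Lemma dot_sum_eval_vacuum : lev N = [:: true] ->
  dot_sum 0 [:: true] (labels 0) (classes 0) [:: (0, 0); (0, 1)]%N w
  = eval vA vA^-1 vB [:: true] w (vacuum K) [:: false; false].
Proof.
rewrite /level take_size => end_w.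
have cons := state_consistent legal_w (leq0n N).
rewrite /level take0 /= in cons.
have [bad|good_w] := boolP (has_bad_cap 0 (labels 0) w).
  rewrite (dot_sum_deficient _ _ _ cons legal_w) ?end_w //; last by right.
  rewrite (eval_bad_cap _ _ _ _ cons legal_w) // => g h lt_g lt_h.
  by case: g h lt_g lt_h => [|[|g]] [|[|h]].
rewrite (dot_sum_eval _ _ _ cons) ?end_w //.
apply: eval_ext; rewrite ?end_w // => -[|x [|y [|z m]]] //= _.
by case: x y => [] [].
Qed.

Lemma dot_sum_word :
  dot_sum 0 [:: true] (labels 0) (classes 0) [:: (0, 0); (0, 1)]%N w =
  \sum_(h : {ffun 'I_N -> corner} | [forall j : 'I_N, h j \in options j])
    (\prod_(j : 'I_N) corner_weight j (h j)) *
    (good (classes N) ([seq dot_label j (h j) | j : 'I_N <- enum 'I_N & is_vertex (sl j).2] ++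
       [:: cell_label (mk 0 0); cell_label (mk 0 1)]))%:R.
Proof.
have := @dot_sum_selections N 0 [:: (0, 0); (0, 1)]%N (add0n N).
rewrite drop0 {1}/level take0 => ->.
rewrite -(@sum_ffun_selections K corner N [seq options j | j <- iota 0 N] (fun cs =>
  (\prod_(x <- zip (iota 0 N) cs) corner_weight x.1 x.2) *
    (good (classes N) (dot_labels (zip (iota 0 N) cs) ++ map (final_label 0) [:: (0, 0); (0, 1)]%N))%:R)).
- apply: eq_big => [h|h _].
    apply: eq_forallb => j.
    by rewrite (nth_map 0%N) ?size_iota // nth_iota.
  rewrite -val_enum_ord zip_map big_map big_enum /=; congr (_ * (nat_of_bool (good _ _))%:R).
  rewrite /dot_labels filter_map -map_comp; congr (_ ++ _).
  by rewrite /= !cell_label_mk //= /level take0.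
- by rewrite size_map size_iota.
- by apply/allP => o /mapP[j _ ->]; rewrite /options; case: ifP.
Qed.

Lemma kauffman_good (T : dots w) (h : 'I_N -> corner) :
  (forall j : vertex w, h (val j) = T j) ->
  good (classes N) ([seq dot_label j (h j) | j : 'I_N <- enum 'I_N & is_vertex (sl j).2] ++
    [:: cell_label (mk 0 0); cell_label (mk 0 1)]) = kauffman_state T.
Proof.
move=> hT; set D := [seq _ | j <- _].
have count_D c : count_mem (cell_label c) D = #|[set j : vertex w | same (corner_cell w (val j) (T j)) c]|.
  rewrite count_map count_filter -sum1_count big_enum_cond /= cardsE -sum1_card.
  rewrite (eq_bigl (fun j : 'I_N => (j \in vertices w) && (dot_label j (h j) == cell_label c))); last first.
    by move=> j; rewrite /vertices !inE andbC.
  rewrite big_sub_cond; apply: eq_bigl => j.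
  rewrite hT -[RHS]/(same (corner_cell w (val j) (T j)) c).
  rewrite same_regionP // cell_label_corner //.
  by have := valP j; rewrite /vertices inE.
have size0 : size (lev 0) = 1%N by rewrite /level take0.
have star_neq : ~~ same (mk 0 0) (mk 0 1).
  by apply/negP => /same_parity; rewrite !tagged_mk ?size0.
have count_star c : count_mem (cell_label c) [:: cell_label (mk 0 0); cell_label (mk 0 1)] = in_star c.
  rewrite /in_star !same_regionP // /= addn0.
  case: eqVneq => [eq0|//]; case: eqVneq => [eq1|//].
  by case/negP: star_neq; rewrite same_regionP // eq0 eq1.
have count_all c : (count_mem (cell_label c) (D ++ [:: cell_label (mk 0 0); cell_label (mk 0 1)]) == 1%N)
    = (#|[set j : vertex w | same (corner_cell w (val j) (T j)) c]| == ~~ in_star c :> nat).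
  by rewrite count_cat count_star count_D; case: (in_star c); rewrite ?addn0 // addn1.
apply/allP/forallP => [good_D c|good_T r /(class_cell legal_w marks_w) [c <-]].
  by rewrite -count_all good_D // cell_label_class.
by rewrite count_all.
Qed.

Lemma Delta_dot_sum :
  Delta w = dot_sum 0 [:: true] (labels 0) (classes 0) [:: (0, 0); (0, 1)]%N w.
Proof.
rewrite dot_sum_word /Delta.
pose g (T : dots w) : {ffun 'I_N -> corner} := [ffun j => oapp T North (insub j)].
pose f (h : {ffun 'I_N -> corner}) : dots w := [ffun v => h (val v)].
have fK T : f (g T) = T.
  by apply/ffunP => v; rewrite !ffunE valK.
rewrite [LHS](reindex_onto f g) /=; last by move=> T _; apply: fK.
rewrite [RHS]big_mkcond [LHS]big_mkcond; apply: eq_bigr => h _ /=.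
have gfh : (g (f h) == h) = [forall j : 'I_N, h j \in options j].
  apply/eqP/forallP => [<- j|opt_h].
    rewrite /options; case: ifP => vert_j; first by case: (g _ j).
    by rewrite ffunE insubN // /vertices inE vert_j.
  apply/ffunP => j; rewrite ffunE; case: insubP => [v _ <-|] /=; first by rewrite ffunE.
  by rewrite /vertices inE => /negbTE vert_j; have := opt_h j; rewrite /options vert_j inE => /eqP ->.
rewrite gfh; case: [forall j, _]; rewrite ?andbF // andbT.
rewrite -(@kauffman_good (f h) h) => [|j]; last by rewrite ffunE.
case: good; rewrite ?mulr0 // mulr1.
rewrite (eq_bigr (fun v : vertex w => corner_weight (val v) (h (val v)))) => [|v _]; last first.
  by rewrite ffunE /corner_weight; have := valP v; rewrite /vertices inE => ->.
rewrite -(big_sub (vertices w) (fun j : 'I_N => corner_weight j (h j))) big_mkcond /=.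
by apply: eq_bigr => j _; rewrite /vertices inE /corner_weight; case: (is_vertex _).
Qed.

End Delta.

Lemma Delta_eval w : long_diagram w ->
  Delta w = eval vA vA^-1 vB [:: true] w (vacuum K) [:: false; false].
Proof.
case/andP=> /andP[legal_w /eqP end_w] /eqP marks_w.
by rewrite Delta_dot_sum // dot_sum_eval_vacuum // /level take_size.
Qed.

Lemma vA_cancel (x : K) : (vA - vA^-1) * x = 0 -> x = 0.
Proof.
move=> /eqP; rewrite mulf_eq0 => /orP[|/eqP //].
rewrite subr_eq0 => /eqP eqA; have := vA_mulV; rewrite -eqA => /eqP.
rewrite -subr_eq0 /vA -tofracM -tofrac1 -tofracB tofrac_eq0 -polyCM -polyC1 -polyCB polyC_eq0.
(* If A were its own inverse, A^2 - 1 would be zero, which its coefficient in degree 2 refutes. *)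
move=> /eqP/(congr1 (fun p : {poly int} => p`_2)).
by rewrite -expr2 coefB coefXn coef1 coef0.
Qed.

Lemma Delta_invariant D D' :
  long_diagram D -> long_diagram D' -> long_isotopic D D' -> Delta D = Delta D'.
Proof.
move=> longD longD' iso; rewrite !Delta_eval //.
rewrite -!(closed_value_close_up vA vA^-1 vB) //.
exact: isotopic_value vA_mulV vA_cancel _ _ iso.
Qed.

(** * Circles and two-colourings *)

Section Circles.
Local Open Scope nat_scope.

(** A colouring constant on components amounts to the set of those component representatives which
    are coloured [true]. *)
Lemma card_component_colourings (T : finType) (e : rel T) : connect_sym e ->
  #|[set f : {ffun T -> bool} | [forall x, forall y, e x y ==> (f x == f y)]]| = 2 ^ n_comp e T.
Proof.
move=> sym_e; set F := [set f | _].
have const (f : {ffun T -> bool}) x y : f \in F -> connect e x y -> f x = f y.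
  rewrite inE => /forallP f_e /connectP[p path_p ->].
  elim: p x path_p => //= z p IH x /andP[e_xz /IH <-].
  by have /forallP/(_ z) := f_e x; rewrite e_xz => /eqP.
pose R := [set x | roots e x].
have -> : n_comp e T = #|R|.
  by apply: eq_card => x; rewrite !inE andbT.
rewrite -card_powerset -(card_in_imset (f := fun f : {ffun T -> bool} => [set x in R | f x])).
  apply: eq_card => A; rewrite powersetE; apply/imsetP/idP => [[f _ ->]|sub_A].
    by apply/subsetP => x; rewrite inE => /andP[].
  exists [ffun x => fingraph.root e x \in A].
    rewrite inE; apply/forallP => x; apply/forallP => y; apply/implyP => e_xy.
    by rewrite !ffunE (fingraph.rootP sym_e (connect1 e_xy)).
  apply/setP => x; rewrite inE ffunE inE.
  have [|] := boolP (roots e x); first by move=> /eqP ->.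
  by move=> not_root; apply/negbTE; apply: contra not_root => /(subsetP sub_A); rewrite inE.
move=> f g f_F g_F /setP eq_fg; apply/ffunP => x.
rewrite (const f _ _ f_F (connect_root e x)) (const g _ _ g_F (connect_root e x)).
by have := eq_fg (fingraph.root e x); rewrite !inE roots_root.
Qed.

(* The two-colourings of the strands after the slice x which extend n. *)
Definition successors (x : slice) (n : seq bool) : seq (seq bool) :=
  match x.2 with
  | Cup _ => [seq take x.1 n ++ [:: c, c & drop x.1 n] | c <- [:: true; false]]
  | Cap => if nth true n x.1 == nth true n x.1.+1 then [:: take x.1 n ++ drop x.1.+2 n] else [::]
  | _ => [:: n]
  end.

Fixpoint colourings (w : word) (n : seq bool) : nat :=
  if w is x :: w' then \sum_(n' <- successors x n) colourings w' n' else 1.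

Definition bits (m : nat) : seq (seq bool) := selections (nseq m [:: true; false]).

Lemma mem_bits m n : (n \in bits m) = (size n == m).
Proof.
rewrite mem_selections; elim: m n => [|m IH] [|x n] //=.
by rewrite IH eqSS; case: x.
Qed.

Lemma uniq_bits m : uniq (bits m).
Proof. by apply: uniq_selections; elim: m. Qed.

(** Replaces [legal] for smoothed words: they are not coherently oriented, so only the numbers of
    strands can be checked. *)
Fixpoint fits (m : nat) (w : word) : bool :=
  if w is x :: w' then
    [&& x.1 + inputs x.2 <= m, ~~ is_vertex x.2 & fits (m - inputs x.2 + outputs x.2) w']
  else true.

Fixpoint widths (m : nat) (w : word) : seq nat :=
  m :: if w is x :: w' then widths (m - inputs x.2 + outputs x.2) w' else [::].

Fixpoint consistent_rows (w : word) (rs : seq (seq bool)) : bool :=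
  if w is x :: w' then
    (head [::] (behead rs) \in successors x (head [::] rs)) && consistent_rows w' (behead rs)
  else true.

Lemma size_successors x n n' : x.1 + inputs x.2 <= size n -> ~~ is_vertex x.2 ->
  n' \in successors x n -> size n' = size n - inputs x.2 + outputs x.2.
Proof.
case: x => i [c||v|] //= le_i _; rewrite /successors /=.
- rewrite !inE => /orP[] /eqP ->; rewrite size_cat /= size_take size_drop; case: ltnP; lia.
- by case: eqP => // _; rewrite inE => /eqP ->; rewrite size_cat size_take size_drop; case: ltnP; lia.
- by rewrite inE => /eqP ->; lia.
Qed.

Lemma uniq_successors x n : uniq (successors x n).
Proof.
case: x => i [c||v|]; rewrite /successors //=; last by case: ifP.
by rewrite andbT inE eqseq_cat //= andbF.
Qed.

Lemma sum_sublist (T : eqType) (r r' : seq T) (F : T -> nat) :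
  uniq r -> uniq r' -> {subset r' <= r} ->
  \sum_(x <- r | x \in r') F x = \sum_(x <- r') F x.
Proof.
move=> uniq_r uniq_r' sub; rewrite -big_filter; apply: perm_big.
apply: uniq_perm; rewrite ?filter_uniq // => x; rewrite mem_filter.
by case: (boolP (x \in r')) => // /sub.
Qed.

(** The conditions link consecutive rows only. The weight [g] on the first row lets the induction
    carry the link to the row before it. *)
Lemma sum_consistent_rows w m (g : seq bool -> nat) : fits m w ->
  \sum_(rs <- selections (map bits (widths m w)) | consistent_rows w rs) g (head [::] rs)
  = \sum_(n <- bits m) g n * colourings w n.
Proof.
elim: w m g => [|x w IH] m g fits_w.
  rewrite big_mkcond [map _ _]/= big_selections_cons; apply: eq_bigr => n _.
  by rewrite big_seq1 muln1.
have {fits_w} /and3P[le_x vert_x fits_w] : fits m (x :: w) := fits_w.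
rewrite big_mkcond [map _ _]/= big_selections_cons [RHS]big_seq [LHS]big_seq; apply: eq_bigr => n.
rewrite mem_bits => /eqP size_n.
rewrite (eq_bigr (fun rs => if consistent_rows w rs then (head [::] rs \in successors x n) * g n else 0)); last first.
  by move=> rs _ /=; case: consistent_rows; rewrite ?andbF ?andbT //; case: ifP; rewrite ?mul1n.
rewrite -big_mkcond (IH _ (fun n' => (n' \in successors x n) * g n)) //=.
rewrite big_distrr /= -(@sum_sublist _ (bits (m - inputs x.2 + outputs x.2)) (successors x n)) ?uniq_bits ?uniq_successors //.
  rewrite [RHS]big_mkcond; apply: eq_bigr => n' _; case: ifP => _; lia.
move=> n' /size_successors; rewrite size_n mem_bits => -> //.
Qed.

Definition arcs_agree (j : nat) (x : slice) (n n' : seq bool) : Prop :=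
  [/\ forall p q, p < size n -> q < size n' -> arc_at j x (j, p) (j.+1, q) ->
        nth true n p = nth true n' q,
      forall p q, p < size n' -> q < size n' -> arc_at j x (j.+1, p) (j.+1, q) ->
        nth true n' p = nth true n' q
    & forall p q, p < size n -> q < size n -> arc_at j x (j, p) (j, q) ->
        nth true n p = nth true n q].

Lemma successorsP j x n n' : x.1 + inputs x.2 <= size n -> ~~ is_vertex x.2 ->
  size n' = size n - inputs x.2 + outputs x.2 ->
  n' \in successors x n <-> arcs_agree j x n n'.
Proof.
have neq1 : (j == j.+1) = false by lia.
have neq2 : (j.+1 == j) = false by lia.
case: x => i [c||v|] //= le_i _ size_n'; rewrite /successors /arcs_agree /= ?neq1 ?neq2 ?eqxx /=; split.
- have get d p : p < size n' -> n' = take i n ++ [:: d, d & drop i n] ->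
      nth true n' p = if p < i then nth true n p else if p < i.+2 then d else nth true n (p - 2).
    move=> lt_p ->; rewrite nth_cat size_takel; last by lia.
    case: ltnP => [lt_pi|le_ip]; first by rewrite nth_take.
    case def_k: (p - i) => [|[|k]] /=.
    + by have -> : p < i.+2 by lia.
    + by have -> : p < i.+2 by lia.
    + have -> : (p < i.+2) = false by lia.
      by rewrite nth_drop; congr (nth _ _ _); lia.
  move=> n'_in; have [d def_n'] : exists d, n' = take i n ++ [:: d, d & drop i n].
    by move: n'_in; rewrite !inE => /orP[] /eqP; [exists true|exists false].
  split=> p q lt_p lt_q arc; last by exfalso; lia.
    rewrite (get d q) //; case: ltnP => lt_qi; first by congr (nth _ _ _); lia.
    by case: ltnP => lt_qi2; [exfalso; lia|congr (nth _ _ _); lia].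
  have [eq_p eq_q] : p = i /\ q = i.+1 by lia.
  subst p q; rewrite (get d i) // (get d i.+1) //.
  have [-> -> -> ->] : [/\ (i < i) = false, (i.+1 < i) = false, (i < i.+2) = true & (i.+1 < i.+2) = true].
    by split; lia.
  by [].
- case=> thr cup _.
  have -> : n' = take i n ++ [:: nth true n' i, nth true n' i & drop i n].
    apply: (@eq_from_nth _ true) => [|p lt_p].
      by rewrite size_cat /= size_takel ?size_drop; lia.
    rewrite nth_cat size_takel; last by lia.
    have [lt_pi|le_ip] := ltnP p i.
      by rewrite nth_take //; apply/esym/thr; lia.
    case def_k: (p - i) => [|[|k]] /=.
    + by have -> : p = i by lia.
    + have -> : p = i.+1 by lia.
      by apply/esym/cup; lia.
    + by rewrite nth_drop; apply/esym/thr; lia.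
  by rewrite !inE; case: (nth true n' i); rewrite eqxx ?orbT.
- case: eqP => // eq_i; rewrite inE => /eqP def_n'; split=> p q lt_p lt_q arc; last first.
  + by have [-> ->] : p = i /\ q = i.+1 by lia.
  + by exfalso; lia.
  rewrite def_n' nth_cat size_takel; last by lia.
  case: ltnP => [lt_qi|le_iq]; first by rewrite nth_take //; congr (nth _ _ _); lia.
  by rewrite nth_drop; congr (nth _ _ _); lia.
- case=> thr _ cap; rewrite (cap i i.+1) ?eqxx //; try lia.
  rewrite inE; apply/eqP; apply: (@eq_from_nth _ true) => [|p lt_p].
    by rewrite size_cat /= size_takel ?size_drop; lia.
  rewrite nth_cat size_takel; last by lia.
  have [lt_pi|le_ip] := ltnP p i.
    by rewrite nth_take //; apply/esym/thr; lia.
  by rewrite nth_drop; apply/esym/thr; lia.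
- rewrite inE => /eqP ->; split=> p q _ _ arc; [congr (nth _ _ _)|exfalso|exfalso]; lia.
- case=> thr _ _; rewrite inE; apply/eqP; apply: (@eq_from_nth _ true) => [|p lt_p]; first by lia.
  by apply/esym/thr; lia.
Qed.

Lemma consistent_rowsP w rs : size rs = (size w).+1 ->
  consistent_rows w rs <->
  (forall j, j < size w -> nth [::] rs j.+1 \in successors (slice_at w j) (nth [::] rs j)).
Proof.
elim: w rs => [|x w IH] [|n rs] //= [size_rs].
split=> [/andP[n_x /(IH _ size_rs) ok] [|j] lt_j|ok].
- by rewrite /slice_at /=; case: (rs) n_x.
- exact: ok.
apply/andP; split; first by have := ok 0 (ltn0Sn _); case: (rs).
by apply/(IH _ size_rs) => j lt_j; apply: (ok j.+1).
Qed.

(** * Colourings of the points as lists of rows *)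

Section Colourings.
Variable w : word.
Hypothesis fits_w : fits 0 w.
Local Notation N := (size w).
Local Notation lev := (level [::] w).

Lemma size_sweep_fits s x : x.1 + inputs x.2 <= size s -> ~~ is_vertex x.2 ->
  size (sweep s x) = size s - inputs x.2 + outputs x.2.
Proof.
case: x => i e; rewrite /sweep !size_cat !size_drop /= => le_i _.
rewrite size_takel; last by lia.
have size_in : size (take (inputs e) (drop i s)) = inputs e.
  by rewrite size_takel // size_drop; lia.
by case: e le_i size_in => [b0||v|] /= le_i size_in; rewrite ?size_rev ?size_in; lia.
Qed.

Lemma widthsE s v : fits (size s) v ->
  widths (size s) v = [seq size (level s v l) | l <- iota 0 (size v).+1].
Proof.
have iotaS k : iota 0 k.+1 = 0 :: map succn (iota 0 k) by rewrite -(iotaDl 1).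
elim: v s => [|x v IH] s // /and3P[le_x vert_x fits_v].
rewrite -size_sweep_fits // in fits_v; rewrite iotaS [LHS]/= -size_sweep_fits // IH //.
by rewrite map_cons -map_comp.
Qed.

Lemma fits_level j : j < N ->
  [/\ (slice_at w j).1 + inputs (slice_at w j).2 <= size (lev j), ~~ is_vertex (slice_at w j).2
    & size (lev j.+1) = size (lev j) - inputs (slice_at w j).2 + outputs (slice_at w j).2].
Proof.
suff gen s v : fits (size s) v -> j < size v ->
  [/\ (slice_at v j).1 + inputs (slice_at v j).2 <= size (level s v j), ~~ is_vertex (slice_at v j).2
    & size (level s v j.+1) = size (level s v j) - inputs (slice_at v j).2 + outputs (slice_at v j).2].
  exact: (gen [::]).
elim: v s j => [|x v IH] s [|j] //= /and3P[le_x vert_x fits_v] lt_j.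
  by rewrite /level /slice_at /= take0 /= size_sweep_fits.
by rewrite -size_sweep_fits // in fits_v; apply: (IH (sweep s x)).
Qed.

Definition row (f : {ffun point [::] w -> bool}) (l : 'I_N.+1) : seq bool :=
  [seq f (Tagged (fun l : 'I_N.+1 => 'I_(size (lev l))) p) | p <- enum 'I_(size (lev l))].

Definition rows f : seq (seq bool) := [seq row f l | l <- enum 'I_N.+1].

Lemma nth_rows f (l : 'I_N.+1) : nth [::] (rows f) l = row f l.
Proof. by rewrite (nth_map l) ?size_enum_ord // nth_ord_enum. Qed.

Lemma size_row f l : size (row f l) = size (lev l).
Proof. by rewrite size_map size_enum_ord. Qed.

Lemma nth_row f (a : point [::] w) : nth true (nth [::] (rows f) (tag a)) (tagged a) = f a.
Proof.
rewrite nth_rows (nth_map (tagged a)) ?size_enum_ord // nth_ord_enum.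
by case: a.
Qed.

Lemma perm_rows : perm_eq [seq rows f | f <- index_enum {ffun point [::] w -> bool}]
  (selections (map bits (widths 0 w))).
Proof.
have def_widths := widthsE (s := [::]) fits_w; rewrite [size _]/= in def_widths.
apply: uniq_perm.
- rewrite map_inj_uniq ?index_enum_uniq // => f g eq_fg.
  by apply/ffunP => a; rewrite -!nth_row eq_fg.
- by apply: uniq_selections; apply/allP => o /mapP[m _ ->]; apply: uniq_bits.
move=> rs; rewrite mem_selections all2E size_map def_widths size_map size_iota.
apply/mapP/andP => [[f _ ->]|[/eqP size_rs all_rs]].
  rewrite size_map size_enum_ord; split=> //.
  have -> : map bits [seq size (lev l) | l <- iota 0 N.+1] = [seq bits (size (lev (val l))) | l <- enum 'I_N.+1].
    by rewrite -val_enum_ord -2!map_comp.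
  rewrite /rows zip_map all_map; apply/allP => l _ /=.
  by rewrite mem_bits size_row.
have size_nth l : l <= N -> size (nth [::] rs l) = size (lev l).
  move=> le_l; move/(all_nthP ([::], [::]))/(_ l): all_rs.
  rewrite size_zip size_rs !size_map size_iota minnn ltnS => /(_ le_l).
  rewrite nth_zip ?size_rs ?size_map ?size_iota // => mem_l.
  have {mem_l} : nth [::] rs l \in nth [::] (map bits [seq size (lev l) | l <- iota 0 N.+1]) l := mem_l.
  rewrite (nth_map 0) ?size_map ?size_iota //.
  by rewrite (nth_map 0) ?size_iota // nth_iota // mem_bits => /eqP.
exists [ffun a : point [::] w => nth true (nth [::] rs (tag a)) (tagged a)]; first exact: mem_index_enum.
apply: (@eq_from_nth _ [::]); first by rewrite size_map size_enum_ord.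
move=> l; rewrite size_rs => lt_l; have -> : l = Ordinal lt_l by [].
rewrite nth_rows; apply: (@eq_from_nth _ true); first by rewrite size_row size_nth.
move=> p; rewrite size_nth // => lt_p.
by rewrite (nth_map (Ordinal lt_p)) ?size_enum_ord // ffunE /= nth_enum_ord.
Qed.

Lemma rows_consistent (f : {ffun point [::] w -> bool}) :
  [forall x, forall y, (@joined [::] w x y || @joined [::] w y x) ==> (f x == f y)] = consistent_rows w (rows f).
Proof.
have size_rows : size (rows f) = N.+1 by rewrite size_map size_enum_ord.
have size_nth l : l <= N -> size (nth [::] (rows f) l) = size (lev l).
  by rewrite -ltnS => lt_l; rewrite (nth_rows f (Ordinal lt_l)) size_row.
have agree j : j < N ->
   nth [::] (rows f) j.+1 \in successors (slice_at w j) (nth [::] (rows f) j) <->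
   arcs_agree j (slice_at w j) (nth [::] (rows f) j) (nth [::] (rows f) j.+1).
  move=> lt_j; have [le_j vert_j size_j] := fits_level lt_j.
  by apply: successorsP; rewrite ?size_nth // ltnW.
apply/idP/idP => [/forallP const|/(consistent_rowsP size_rows) ok].
  apply/(consistent_rowsP size_rows) => j lt_j.
  have {}const l p l' q (lt_l : l < N.+1) (lt_l' : l' < N.+1)
      (lt_p : p < size (nth [::] (rows f) l)) (lt_q : q < size (nth [::] (rows f) l')) :
      arc_at j (slice_at w j) (l, p) (l', q) ->
      nth true (nth [::] (rows f) l) p = nth true (nth [::] (rows f) l') q.
    move=> arc; rewrite size_nth // in lt_p; rewrite size_nth // in lt_q.
    pose x : point [::] w := @Tagged _ (Ordinal lt_l) (fun l : 'I_N.+1 => 'I_(size (lev l))) (Ordinal lt_p).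
    pose y : point [::] w := @Tagged _ (Ordinal lt_l') (fun l : 'I_N.+1 => 'I_(size (lev l))) (Ordinal lt_q).
    have := const x => /forallP/(_ y); rewrite -(nth_row f x) -(nth_row f y) => /implyP/(_ _)/eqP; apply.
    apply/orP; left; apply/existsP; exists (Ordinal lt_j); exact: arc.
  have lt0 : j < N.+1 by exact: ltnW.
  have lt1 : j.+1 < N.+1 by [].
  apply/(agree j lt_j); split=> p q lt_p lt_q.
  - exact: (const j p j.+1 q lt0 lt1 lt_p lt_q).
  - exact: (const j.+1 p j.+1 q lt1 lt1 lt_p lt_q).
  - exact: (const j p j q lt0 lt0 lt_p lt_q).
have joined_eq x y : joined x y -> f x = f y.
  case/existsP => j arc; have /(agree j (ltn_ord j))[thr cup cap] := ok j (ltn_ord j).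
  have lt_x : tagged x < size (nth [::] (rows f) (tag x)) by rewrite size_nth ?ltn_ord // -ltnS.
  have lt_y : tagged y < size (nth [::] (rows f) (tag y)) by rewrite size_nth ?ltn_ord // -ltnS.
  rewrite -(nth_row f x) -(nth_row f y).
  move: arc lt_x lt_y; move: (nat_of_ord (tagged x)) (nat_of_ord (tagged y)) => p q.
  move: (nat_of_ord (tag x)) (nat_of_ord (tag y)) => l l' arc lt_p lt_q.
  have arc' := arc; move: arc'; rewrite /arc_at; case def_x: (slice_at w j) => [i e].
  case/orP => [/and3P[/eqP el /eqP el' _]|].
    by subst l l'; apply: thr.
  case: e def_x => // [c|] def_x /and4P[/eqP el /eqP el' _ _]; subst l l'; [exact: cup|exact: cap].
apply/forallP => x; apply/forallP => y; apply/implyP => /orP[/joined_eq ->//|/joined_eq ->//].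
Qed.

Lemma colourings_components : 2 ^ components [::] w = colourings w [::].
Proof.
rewrite /components -card_component_colourings; last first.
  by apply: sym_connect_sym => x y /=; rewrite orbC.
have := @sum_consistent_rows w 0 (fun=> 1) fits_w.
rewrite big_seq1 mul1n => <-; rewrite -(perm_big _ perm_rows) big_map /=.
rewrite -sum1_card; apply: eq_bigl => f; rewrite inE; exact: rows_consistent.
Qed.

End Colourings.

(** * Temperley-Lieb relations for two-colourings *)

Fixpoint transfer (w : word) (f : seq bool -> nat) (n : seq bool) : nat :=
  if w is x :: w' then \sum_(n' <- successors x n) transfer w' f n' else f n.

Lemma colouringsE w n : colourings w n = transfer w (fun=> 1) n.
Proof. by elim: w n => //= x w IH n; apply: eq_bigr => n' _. Qed.

Lemma transfer_cat u v f n : transfer (u ++ v) f n = transfer u (transfer v f) n.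
Proof. by elim: u n => //= x u IH n; apply: eq_bigr => n' _. Qed.

Lemma successors_cat P x n :
  successors (size P + x.1, x.2) (P ++ n) = map (cat P) (successors x n).
Proof.
case: x => i [c||v|]; rewrite /successors /= -?addnS ?take_split ?drop_split ?nth_split -?catA //.
by case: ifP.
Qed.

Lemma transfer_shift P w f n :
  transfer (shift (size P) w) f (P ++ n) = transfer w (fun m => f (P ++ m)) n.
Proof.
elim: w n => //= x w IH n; rewrite successors_cat big_map.
by apply: eq_bigr => n' _; apply: IH.
Qed.

Fixpoint width (m : nat) (w : word) : nat :=
  if w is x :: w' then width (m - inputs x.2 + outputs x.2) w' else m.

Lemma transfer_ext m w f g n : fits m w -> size n = m ->
  (forall n, size n = width m w -> f n = g n) -> transfer w f n = transfer w g n.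
Proof.
elim: w m n => [|x w IH] m n /=; first by move=> _ sz; apply.
case/and3P=> le_x vert_x fits_w size_n fg; rewrite [LHS]big_seq [RHS]big_seq.
apply: eq_bigr => n' n'_x; apply: IH fits_w _ fg.
by rewrite (size_successors _ vert_x n'_x) size_n.
Qed.

Lemma transferZ w k f n : transfer w (fun n => k * f n) n = k * transfer w f n.
Proof.
elim: w n => //= x w IH n; rewrite big_distrr /=.
by apply: eq_bigr => n' _; apply: IH.
Qed.

(* t and t' have the same two-colourings with given ends, up to k circles. *)
Definition same_transfer (m k : nat) (t t' : word) : Prop :=
  forall f n, size n = m -> transfer t f n = 2 ^ k * transfer t' f n.

Lemma same_transfer_cat m k p t t' q : fits m p -> same_transfer (width m p) k t t' ->
  same_transfer m k (p ++ t ++ q) (p ++ t' ++ q).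
Proof.
move=> fits_p tt' f n size_n; rewrite !transfer_cat -transferZ.
apply: transfer_ext fits_p size_n _ => n' size_n'.
by rewrite !transfer_cat tt'.
Qed.

Lemma same_transfer_shift m k i t t' : same_transfer m k t t' ->
  same_transfer (i + m) k (shift i t) (shift i t').
Proof.
move=> tt' f n size_n.
have [p [q [def_n size_p]]] : exists p q, n = p ++ q /\ size p = i.
  by exists (take i n), (drop i n); rewrite cat_take_drop size_takel // size_n leq_addr.
rewrite def_n -size_p !transfer_shift tt' //.
by apply/(@addnI i); rewrite -size_n def_n size_cat size_p.
Qed.

Lemma same_transfer_loop m b : same_transfer m 1 [:: (0, Cup b); (0, Cap)] [::].
Proof.
move=> f n _; rewrite /= /successors /= !big_cons !big_nil /= take0 drop0 /=.
by rewrite !big_cons !big_nil /= drop0; lia.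
Qed.

Lemma same_transfer_zigzag_up m b : 0 < m -> same_transfer m 0 [:: (0, Cup b); (1, Cap)] [::].
Proof.
move=> m_gt0 f [|x n] size_n; first by rewrite -size_n in m_gt0.
rewrite /= /successors /= !big_cons !big_nil /=.
by case: x {size_n}; rewrite /= ?big_cons ?big_nil /= ?drop0; lia.
Qed.

Lemma same_transfer_zigzag_down m b : 0 < m -> same_transfer m 0 [:: (1, Cup b); (0, Cap)] [::].
Proof.
move=> m_gt0 f [|x n] size_n; first by rewrite -size_n in m_gt0.
rewrite /= /successors /= !big_cons !big_nil /= take0 drop0.
by case: x {size_n}; rewrite /= ?big_cons ?big_nil /= ?drop0; lia.
Qed.

Lemma same_transfer_cup m i b b' : same_transfer m 0 [:: (i, Cup b)] [:: (i, Cup b')].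
Proof. by move=> f n _; rewrite mul1n. Qed.

Lemma same_transfer_mark m i : same_transfer m 0 [:: (i, Mark)] [::].
Proof. by move=> f n _; rewrite /= /successors /= big_seq1 mul1n. Qed.

Lemma same_transfer_exchange m k e g : ~~ is_vertex e -> inputs e <= m ->
  same_transfer m 0 [:: (0, e); (outputs e + k, g)] [:: (inputs e + k, g); (0, e)].
Proof.
move=> vert_e le_m f n size_n; rewrite mul1n /=.
case: e vert_e le_m => [b||v|] //= _ le_m.
- rewrite add0n {1}/successors /= !big_cons big_nil take0 drop0 /=.
  rewrite !(successors_cat [:: _; _] (k, g)) !big_map addn0.
  rewrite [RHS](eq_bigr (fun n' => f [:: true, true & n'] + f [:: false, false & n'])).
    by rewrite big_split.
  by move=> n' _; rewrite /successors /= !big_cons big_nil take0 drop0 addn0.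
- case: n size_n => [|x [|y n]] /= size_n; try lia.
  have capE n' : successors (0, Cap) [:: x, y & n'] = if x == y then [:: n'] else [::].
    by rewrite /successors /= drop0.
  rewrite (successors_cat [:: x; y] (k, g)) big_map capE add0n.
  case: (x == y) capE => capE.
    by rewrite big_seq1; apply: eq_bigr => n' _; rewrite capE big_seq1.
  by rewrite big_nil big1 // => n' _; rewrite capE big_nil.
- by rewrite big_seq1; apply: eq_bigr => n' _; rewrite big_seq1.
Qed.

End Circles.

(** * The bracket *)

Section Bracket.
Variables (R : comNzRingType) (a a' b b' : R).
Hypothesis aa : a * a' = 1.

Definition loop_value : R := - a ^+ 2 - a' ^+ 2.

(** The weight of the horizontal smoothing. At an ordinary crossing it does not depend on the
    directions: reversing one strand changes both the sign of the crossing and which smoothing is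
    the oriented one. Only a double point needs [par]. *)
Definition flat_weight (par : bool) (v : vertex_kind) : R :=
  match v with
  | Crossing c => if c then a' else a
  | DoublePoint => if par then b else b'
  end.

Definition turn_weight (par : bool) (v : vertex_kind) : R :=
  match v with
  | Crossing c => if c then a else a'
  | DoublePoint => if par then b' else b
  end.

(** [F] is the value assigned to a smoothed word. Passing it as a continuation allows a piece to be
    expanded inside an arbitrary diagram. *)
Fixpoint expand (s : seq bool) (w : word) (F : word -> R) : R :=
  if w is x :: w' then
    if x.2 is Vertex v then
      let par := nth true s x.1 == nth true s x.1.+1 in
      flat_weight par v * expand (sweep s x) w' F
      + turn_weight par v *
        expand (sweep s x) w' (fun t => F [:: (x.1, Cap), (x.1, Cup true) & t])
    else expand (sweep s x) w' (fun t => F (x :: t))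
  else F [::].

(* F satisfies the Temperley-Lieb relations. *)
Definition respects (m : nat) (F : word -> R) : Prop :=
  forall k t t', same_transfer m k t t' -> F t = loop_value ^+ k * F t'.

Lemma expand_cat s u v F :
  expand s (u ++ v) F = expand s u (fun t => expand (foldl sweep s u) v (fun t' => F (t ++ t'))).
Proof. by elim: u s F => //= x u IH s F; rewrite !IH; case: (x.2). Qed.

Lemma expandZ s w k F : expand s w (fun t => k * F t) = k * expand s w F.
Proof.
elim: w s F => //= x w IH s F; case: (x.2) => [c||v|]; rewrite ?IH //.
ring.
Qed.

Lemma expand_ext s w F F' : legal s w ->
  (forall t, fits (size s) t -> width (size s) t = size (foldl sweep s w) -> F t = F' t) ->
  expand s w F = expand s w F'.
Proof.
elim: w s F F' => [|x w IH] s F F' /=; first by move=> _; apply.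
case/andP=> legx legw FF'; have sz := size_sweep legx.
have le_x : (x.1 + inputs x.2 <= size s)%N by case/andP: legx.
have size_s' : size (sweep s x) = (size s - inputs x.2 + outputs x.2)%N by lia.
case: x legx legw FF' sz le_x size_s' => i [c||v|] legx legw FF' sz le_x size_s' /=.
- by apply: IH legw _ => t; rewrite size_s' => fits_t width_t; apply: FF' => //=; rewrite le_x.
- by apply: IH legw _ => t; rewrite size_s' => fits_t width_t; apply: FF' => //=; rewrite le_x.
- have le2 : (2 <= size s)%N by move: le_x => /=; lia.
  rewrite /= subnK // in size_s'.
  congr (_ * _ + _ * _); apply: IH legw _ => t; rewrite size_s' => fits_t width_t; apply: FF' => //=;
    rewrite ?addn0 ?subn0 ?subnK // ?le_x ?fits_t ?andbT; move: le_x => /=; lia.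
- by apply: IH legw _ => t; rewrite size_s' => fits_t width_t; apply: FF' => //=; rewrite le_x.
Qed.

Lemma expand_shift P s w F :
  expand (P ++ s) (shift (size P) w) F = expand s w (fun t => F (shift (size P) t)).
Proof.
elim: w s F => //= -[i e] w IH s F; rewrite sweep_cat !IH.
by case: e => [c||v|] //=; rewrite -addnS !nth_split.
Qed.

Lemma respects_cat m F k p t t' q : respects m F -> fits m p ->
  same_transfer (width m p) k t t' -> F (p ++ t ++ q) = loop_value ^+ k * F (p ++ t' ++ q).
Proof. by move=> hF fits_p tt'; apply: hF; apply: same_transfer_cat. Qed.

Lemma respects_shift i m F : respects (i + m) F -> respects m (fun t => F (shift i t)).
Proof. by move=> hF k t t' tt'; apply: hF; apply: same_transfer_shift. Qed.

Lemma respects_loop m F p q i c : respects m F -> fits m p -> (i <= width m p)%N ->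
  F (p ++ [:: (i, Cup c), (i, Cap) & q]) = loop_value * F (p ++ q).
Proof.
move=> hF fits_p le_i.
apply: (respects_cat (k := 1) (t := [:: _; _]) (t' := [::]) q hF fits_p).
have := same_transfer_shift (i := i) (@same_transfer_loop (width m p - i) c).
by rewrite /shift /= addn0 subnKC.
Qed.

Lemma respects_zigzag_up m F p q i c : respects m F -> fits m p -> (i < width m p)%N ->
  F (p ++ [:: (i, Cup c), (i.+1, Cap) & q]) = F (p ++ q).
Proof.
move=> hF fits_p lt_i.
have := respects_cat (k := 0) (t := [:: (i, Cup c); (i.+1, Cap)]) (t' := [::]) q hF fits_p.
rewrite mul1r; apply.
have := same_transfer_shift (i := i) (@same_transfer_zigzag_up (width m p - i) c ltac:(lia)).
by rewrite /shift /= addn0 addn1 subnKC // ltnW.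
Qed.

Lemma respects_zigzag_down m F p q i c : respects m F -> fits m p -> (i < width m p)%N ->
  F (p ++ [:: (i.+1, Cup c), (i, Cap) & q]) = F (p ++ q).
Proof.
move=> hF fits_p lt_i.
have := respects_cat (k := 0) (t := [:: (i.+1, Cup c); (i, Cap)]) (t' := [::]) q hF fits_p.
rewrite mul1r; apply.
have := same_transfer_shift (i := i) (@same_transfer_zigzag_down (width m p - i) c ltac:(lia)).
by rewrite /shift /= addn0 addn1 subnKC // ltnW.
Qed.

Lemma respects_cup m F p q i c c' : respects m F -> fits m p ->
  F (p ++ (i, Cup c) :: q) = F (p ++ (i, Cup c') :: q).
Proof.
move=> hF fits_p.
have := respects_cat (k := 0) (t := [:: (i, Cup c)]) (t' := [:: (i, Cup c')]) q hF fits_p.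
by rewrite mul1r; apply; apply: same_transfer_cup.
Qed.

Lemma respects_mark m F p q i : respects m F -> fits m p ->
  F (p ++ (i, Mark) :: q) = F (p ++ q).
Proof.
move=> hF fits_p.
have := respects_cat (k := 0) (t := [:: (i, Mark)]) (t' := [::]) q hF fits_p.
by rewrite mul1r; apply; apply: same_transfer_mark.
Qed.

Definition same_expand (k : R) (l r : word) : Prop := forall s F,
  legal s l -> legal s r -> respects (size s) F -> expand s l F = k * expand s r F.

Local Notation cup i := (i%N, Cup true).
Local Notation cap i := (i%N, Cap).

Lemma same_expand_R2 c :
  same_expand 1 [:: (0, Vertex (Crossing c)); (0, Vertex (Crossing (~~ c)))]%N [::].
Proof.
move=> [|a1 [|a2 s]] F; rewrite /= ?sweepE // => _ _ hF.
rewrite (respects_loop (p := [:: cap 0]) (i := 0) [:: cup 0] true hF) //=.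
by rewrite /loop_value; case: c => /=; ring: aa.
Qed.

Lemma same_expand_S2 c :
  same_expand 1 [:: (0, Vertex (Crossing c)); (0, Vertex DoublePoint)]%N
    [:: (0, Vertex DoublePoint); (0, Vertex (Crossing c))]%N.
Proof.
move=> [|a1 [|a2 s]] F; rewrite /= ?sweepE // => _ _ hF /=.
by rewrite (eq_sym a2); ring.
Qed.

Lemma same_expand_vertex_cap v :
  same_expand 1 [:: (0, Vertex v); (1, Cap)]%N [:: (1, Vertex (mirror v)); (0, Cap)]%N.
Proof.
move=> [|a1 [|a2 [|a3 s]]] F; rewrite /= ?sweepE // /legal_slice /= andbT => ne _ hF.
rewrite (respects_zigzag_up (p := [:: cap 0]) (i := 0) [::] true hF) //=.
rewrite (respects_zigzag_down (p := [:: cap 1]) (i := 0) [::] true hF) //=.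
case: v => [c|] /=; first by case: c => /=; ring.
by move: ne; case: a1 a2 a3 {hF} => [] [] [] //= _; ring.
Qed.

Lemma same_expand_vertex_cup b0 v :
  same_expand 1 [:: (1, Cup b0); (0, Vertex v)]%N [:: (0, Cup b0); (1, Vertex (mirror v))]%N.
Proof.
move=> [|a1 s] F; rewrite /= ?sweepE // => _ _ hF /=.
rewrite (respects_zigzag_down (p := [::]) (i := 0) [:: cup 0] b0 hF) //=.
rewrite (respects_zigzag_up (p := [::]) (i := 0) [:: cup 1] b0 hF) //=.
rewrite (respects_cup (p := [::]) [::] 0 b0 true hF) // (respects_cup (p := [::]) [::] 1 b0 true hF) //=.
rewrite ?addn0 ?take0 ?drop0 /=; case: v => [c|] /=; first by case: c => /=; ring.
by case: a1 b0 => [] [] /=; ring.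
Qed.

(** Both smoothings of the kink leave a straight strand, one of them with an additional circle; for
    [c] true this gives a' (- a^2 - a'^2) + a = - a'^3. *)
Lemma same_expand_R1_up b0 c :
  same_expand (if c then - a' ^+ 3 else - a ^+ 3)
    [:: (1, Cup b0); (0, Vertex (Crossing c)); (1, Cap)]%N [::].
Proof.
move=> [|a1 s] F; rewrite /= ?sweepE // /legal_slice /= andbT => ne _ hF /=.
rewrite (respects_loop (p := [::]) (i := 1) [::] b0 hF) //=.
rewrite (respects_zigzag_down (p := [::]) (i := 0) [:: cup 0; cap 1] b0 hF) //=.
rewrite (respects_zigzag_up (p := [::]) (i := 0) [::] true hF) //=.
by rewrite /loop_value; case: c {ne}; ring: aa.
Qed.

Lemma same_expand_R1_down b0 c :
  same_expand (if c then - a' ^+ 3 else - a ^+ 3)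
    [:: (0, Cup b0); (1, Vertex (Crossing c)); (0, Cap)]%N [::].
Proof.
move=> [|a1 s] F; rewrite /= ?sweepE // /legal_slice /= andbT => ne _ hF /=.
rewrite (respects_loop (p := [::]) (i := 0) [::] b0 hF) //=.
rewrite (respects_zigzag_up (p := [::]) (i := 0) [:: cup 1; cap 0] b0 hF) //=.
rewrite (respects_zigzag_down (p := [::]) (i := 0) [::] true hF) //=.
by rewrite /loop_value; case: c {ne}; ring: aa.
Qed.

Section R3.
Variables (m : nat) (F : word -> R).
Hypothesis hF : respects m.+3 F.

(** Writing e_i for the pair [cap i; cup i], this and the next three lemmas are the relations e_i^2
    = loop e_i and e_i e_j e_i = e_i on three strands. *)
Lemma respects_00 : F [:: cap 0; cup 0; cap 0; cup 0] = loop_value * F [:: cap 0; cup 0].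
Proof. exact: (respects_loop (p := [:: cap 0]) (i := 0) [:: cup 0] true hF). Qed.

Lemma respects_11 : F [:: cap 1; cup 1; cap 1; cup 1] = loop_value * F [:: cap 1; cup 1].
Proof. exact: (respects_loop (p := [:: cap 1]) (i := 1) [:: cup 1] true hF). Qed.

Lemma respects_010 : F [:: cap 0; cup 0; cap 1; cup 1; cap 0; cup 0] = F [:: cap 0; cup 0].
Proof.
rewrite (respects_zigzag_up (p := [:: cap 0]) (i := 0) [:: cup 1; cap 0; cup 0] true hF) //.
exact: (respects_zigzag_down (p := [:: cap 0]) (i := 0) [:: cup 0] true hF).
Qed.

Lemma respects_101 : F [:: cap 1; cup 1; cap 0; cup 0; cap 1; cup 1] = F [:: cap 1; cup 1].
Proof.
rewrite (respects_zigzag_down (p := [:: cap 1]) (i := 0) [:: cup 0; cap 1; cup 1] true hF) //.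
exact: (respects_zigzag_up (p := [:: cap 1]) (i := 0) [:: cup 1] true hF).
Qed.

End R3.

Lemma same_expand_R3_bottom c v :
  same_expand 1 [:: (0, Vertex (Crossing c)); (1, Vertex (Crossing c)); (0, Vertex v)]%N
         [:: (1, Vertex v); (0, Vertex (Crossing c)); (1, Vertex (Crossing c))]%N.
Proof.
move=> [|a1 [|a2 [|a3 s]]] F; rewrite /= ?sweepE // => _ _ hF /=.
rewrite (respects_00 hF) (respects_11 hF) (respects_010 hF) (respects_101 hF) /loop_value.
rewrite ?addn0 ?take0 ?drop0 /=.
(* The two weights of [v] stay unknown, since the identity holds for each smoothing of [v]
   separately; this covers SIII. *)
move: (flat_weight _ v) (turn_weight _ v) => x y.
by case: c => /=; ring: aa.
Qed.

Lemma same_expand_R3_top c v :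
  same_expand 1 [:: (0, Vertex v); (1, Vertex (Crossing c)); (0, Vertex (Crossing c))]%N
         [:: (1, Vertex (Crossing c)); (0, Vertex (Crossing c)); (1, Vertex v)]%N.
Proof.
move=> [|a1 [|a2 [|a3 s]]] F; rewrite /= ?sweepE // => _ _ hF /=.
rewrite (respects_00 hF) (respects_11 hF) (respects_010 hF) (respects_101 hF) /loop_value.
rewrite ?addn0 ?take0 ?drop0 /=.
move: (flat_weight _ v) (turn_weight _ v) => x y.
by case: c => /=; ring: aa.
Qed.

Lemma same_expand_R3_middle c v :
  same_expand 1 [:: (0, Vertex (Crossing c)); (1, Vertex v); (0, Vertex (Crossing (~~ c)))]%N
         [:: (1, Vertex (Crossing (~~ c))); (0, Vertex v); (1, Vertex (Crossing c))]%N.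
Proof.
move=> [|a1 [|a2 [|a3 s]]] F; rewrite /= ?sweepE // => _ _ hF /=.
rewrite (respects_00 hF) (respects_11 hF) (respects_010 hF) (respects_101 hF) /loop_value.
rewrite ?addn0 ?take0 ?drop0 /=.
move: (flat_weight _ v) (turn_weight _ v) => x y.
by case: c => /=; ring: aa.
Qed.

Lemma same_expand_mark_cup b0 :
  same_expand 1 [:: (0, Cup b0); (0, Mark)]%N [:: (0, Cup b0); (1, Mark)]%N.
Proof.
move=> s F _ _ hF /=.
rewrite (respects_mark (p := [:: (0, Cup b0)]%N) [::] 0 hF) //.
by rewrite (respects_mark (p := [:: (0, Cup b0)]%N) [::] 1 hF) // mul1r.
Qed.

Lemma same_expand_mark_cap :
  same_expand 1 [:: (0, Mark); (0, Cap)]%N [:: (1, Mark); (0, Cap)]%N.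
Proof.
move=> s F _ _ hF /=.
rewrite (respects_mark (p := [::]) [:: cap 0] 0 hF) //.
by rewrite (respects_mark (p := [::]) [:: cap 0] 1 hF) // mul1r.
Qed.

Lemma same_expand_mark_climb v :
  same_expand 1 [:: (0, Mark); (0, Vertex v)]%N [:: (0, Vertex v); (1, Mark)]%N.
Proof.
move=> [|a1 [|a2 s]] F; rewrite /= ?sweepE // => _ _ hF /=.
rewrite (respects_mark (p := [::]) [:: cap 0; cup 0] 0 hF) // (respects_mark (p := [::]) [::] 0 hF) //.
rewrite (respects_mark (p := [:: cap 0; cup 0]) [::] 1 hF) // (respects_mark (p := [::]) [::] 1 hF) //.
by rewrite mul1r.
Qed.

Lemma same_expand_mark_descend v :
  same_expand 1 [:: (1, Mark); (0, Vertex v)]%N [:: (0, Vertex v); (0, Mark)]%N.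
Proof.
move=> [|a1 [|a2 s]] F; rewrite /= ?sweepE // => _ _ hF /=.
rewrite (respects_mark (p := [::]) [:: cap 0; cup 0] 1 hF) // (respects_mark (p := [::]) [::] 1 hF) //.
rewrite (respects_mark (p := [:: cap 0; cup 0]) [::] 0 hF) // (respects_mark (p := [::]) [::] 0 hF) //.
by rewrite mul1r.
Qed.

Lemma fits_cat m u v : fits m (u ++ v) = fits m u && fits (width m u) v.
Proof. by elim: u m => //= x u IH m; rewrite IH !andbA. Qed.

Lemma respects_exchange m F p q k e g : respects m F -> fits m p ->
  ~~ is_vertex e -> (inputs e <= width m p)%N ->
  F (p ++ [:: (0, e), (outputs e + k, g) & q]%N) = F (p ++ [:: (inputs e + k, g), (0, e) & q]%N).
Proof.
move=> hF fits_p vert_e le_e.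
have := respects_cat (k := 0) (t := [:: (0, e); (outputs e + k, g)]%N)
  (t' := [:: (inputs e + k, g); (0, e)]%N) q hF fits_p.
by rewrite mul1r; apply; apply: same_transfer_exchange.
Qed.

Lemma same_expand_exchange k e g :
  same_expand 1 [:: (0, e); (outputs e + k, g)]%N [:: (inputs e + k, g); (0, e)]%N.
Proof.
move=> s F legl legr hF; rewrite mul1r.
have le_e : (inputs e <= size s)%N by case/andP: legl => /andP[].
have le_g : (inputs e + k + inputs g <= size s)%N by case/andP: legr => /andP[].
have swap g' : ~~ is_vertex e ->
    F [:: (0, e); (outputs e + k, g')]%N = F [:: (inputs e + k, g'); (0, e)]%N.
  by move=> vert_e; apply: (respects_exchange (p := [::]) [::] k g' hF).
have turn_g : ~~ is_vertex e -> (2 <= inputs g)%N ->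
    F [:: (0, e); (outputs e + k, Cap); (outputs e + k, Cup true)]%N
    = F [:: (inputs e + k, Cap); (inputs e + k, Cup true); (0, e)]%N.
  move=> vert_e g2; rewrite (respects_exchange (p := [::]) [:: cup (outputs e + k)] k Cap hF) //.
  apply: (respects_exchange (p := [:: cap (inputs e + k)]) [::] k (Cup true) hF) => //=; rewrite ?andbT; lia.
(* A smoothed vertex is a Cap followed by a Cup, and the other event passes them one at a time. *)
have turn_e p g' q : fits (size s) p -> (2 <= width (size s) p)%N ->
    F (p ++ [:: cap 0, cup 0, (k.+2, g') & q]%N) = F (p ++ [:: (k.+2, g'), cap 0, cup 0 & q]%N).
  move=> fits_p le2.
  have fits_p' : fits (size s) (rcons p (cap 0)) by rewrite -cats1 fits_cat fits_p /= le2.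
  have := respects_exchange (p := rcons p (cap 0)) q k g' (e := Cup true) hF.
  rewrite !cat_rcons /= => -> //.
  exact: (respects_exchange (p := p) (cup 0 :: q) k g' (e := Cap) hF).
case: e le_e le_g legl legr swap turn_g => [c||v|] /= le_e le_g legl legr swap turn_g.
- case: g le_g legl legr turn_g => [d||v|] le_g legl legr turn_g /=; rewrite ?turn_g ?swap ?sweepE ?add0n ?addn0 //.
- case: s le_e le_g legl legr hF turn_e swap turn_g => [|x [|y s]] // le_e le_g legl legr hF turn_e swap turn_g.
  by case: g le_g legl legr turn_g => [d||v|] le_g legl legr turn_g /=; rewrite ?turn_g ?swap ?sweepE.
- case: s le_e le_g legl legr hF turn_e swap turn_g => [|x [|y s]] // le_e le_g legl legr hF turn_e swap turn_g.
  rewrite !add2n sweepE; case: g le_g legl legr turn_g => [d||w|] le_g legl legr turn_g /=; rewrite ?sweepE /= ?(turn_e [::]) //.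
  rewrite (turn_e [:: cap k.+2] (Cup true) [::]) /= ?andbT //; last by move: le_g => /=; lia.
  ring.
- case: s le_e le_g legl legr hF turn_e swap turn_g => [|x s] // le_e le_g legl legr hF turn_e swap turn_g.
  by rewrite sweepE; case: g le_g legl legr turn_g => [d||v|] le_g legl legr turn_g; rewrite ?turn_g ?swap /=.
Qed.
End Bracket.

(** * Writhe and its correction of the bracket *)

Definition slice_sign (s : seq bool) (x : slice) : int :=
  if x.2 is Vertex (Crossing c) then
    if c != (nth true s x.1 == nth true s x.1.+1) then 1 else -1
  else 0.

Fixpoint total_sign (s : seq bool) (w : word) : int :=
  if w is x :: w' then slice_sign s x + total_sign (sweep s x) w' else 0.

Lemma writheE s w : writhe s w = total_sign s w.
Proof.
elim: w s => [|x w IH] s; first by rewrite /writhe big_ord0.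
by rewrite /= -IH /writhe big_ord_recl.
Qed.

Lemma total_sign_cat s u v :
  total_sign s (u ++ v) = total_sign s u + total_sign (foldl sweep s u) v.
Proof. by elim: u s => [|x u IH] s; rewrite /= ?add0r // IH addrA. Qed.

Lemma total_sign_shift P s w : total_sign (P ++ s) (shift (size P) w) = total_sign s w.
Proof.
elim: w s => //= -[i e] w IH s; rewrite sweep_cat IH; congr (_ + _).
by rewrite /slice_sign /= -addnS !nth_split.
Qed.

Lemma total_sign_exchange k e g s :
  legal s [:: (0, e); (outputs e + k, g)]%N -> legal s [:: (inputs e + k, g); (0, e)]%N ->
  total_sign s [:: (0, e); (outputs e + k, g)]%N = total_sign s [:: (inputs e + k, g); (0, e)]%N.
Proof.
case: e => [b0||v|].
- by move=> _ _; rewrite /= sweepE /slice_sign /= add0n; case: g => [d||[c|]|]; rewrite ?addr0 ?add0r.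
- case: s => [|x [|y s]] // _ _.
  by rewrite /= sweepE !add2n /slice_sign /=; case: g => [d||[c|]|]; rewrite ?addr0 ?add0r.
- case: s => [|x [|y s]] // _ _.
  by rewrite /= !add2n !sweepE /slice_sign /= !addr0 addrC.
- case: s => [|x s] // _ _.
  by rewrite /= sweepE !add1n /slice_sign /=; case: g => [d||[c|]|]; rewrite ?addr0 ?add0r.
Qed.

Section Twist.
Variables (R : fieldType) (a b : R).
Hypothesis a_neq0 : a != 0.
Let a' := a^-1.
Let b' := b^-1.
Let aa : a * a' = 1. Proof. exact: divff. Qed.
Notation loop_value := (loop_value a a').
Notation expand := (expand a a' b b').
Notation respects := (respects a a').
Notation same_expand := (same_expand a a' b b').
Implicit Type F : word -> R.

Definition twisted (s : seq bool) (w : word) (F : word -> R) : R :=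
  (- a) ^ (- 3%:Z * total_sign s w) * expand s w F.

Definition same_twisted (l r : word) : Prop := forall s F,
  legal s l -> legal s r -> respects (size s) F -> twisted s l F = twisted s r F.

Lemma same_twisted_shift i l r : same_twisted l r -> forall s F, (i <= size s)%N ->
  legal s (shift i l) -> legal s (shift i r) -> respects (size s) F ->
  twisted s (shift i l) F = twisted s (shift i r) F.
Proof.
move=> lr s F le_is.
have [P [Q [-> <-]]] : exists P Q, s = P ++ Q /\ size P = i.
  by exists (take i s), (drop i s); rewrite cat_take_drop size_takel.
rewrite !legal_shift size_cat /twisted !total_sign_shift !expand_shift => legl legr hF.
exact: lr legl legr (respects_shift hF).
Qed.

Lemma same_expand_twisted l r : same_expand 1 l r ->
  (forall s, legal s l -> legal s r -> total_sign s l = total_sign s r) -> same_twisted l r.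
Proof.
by move=> lr sign s F legl legr hF; rewrite /twisted sign // lr // mul1r.
Qed.

(** The kink changes the writhe by one, and the corresponding power of [- a] cancels the factor of
    the kink; all other moves preserve both the writhe and the expansion. *)
Lemma same_twisted_R1 l c : same_expand (if c then - a' ^+ 3 else - a ^+ 3) l [::] ->
  (forall s, legal s l -> total_sign s l = if c then -1 else 1) -> same_twisted l [::].
Proof.
move=> l_nil sign s F legl _ hF; rewrite /twisted sign // l_nil //= mulr0 expr0z mul1r mulrA.
suff -> : (- a) ^ (- 3%:Z * (if c then -1 else 1)) * (if c then - a' ^+ 3 else - a ^+ 3) = 1.
  by rewrite mul1r.
case: c {l_nil sign}.
  rewrite mulrN1 opprK -[(- a) ^ 3]/((- a) ^+ 3).
  by ring: aa.
rewrite mulr1 -[(- a) ^ (- 3%:Z)]/((- a) ^- 3) -exprVn invrN -/a'.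
by ring: aa.
Qed.

Lemma local_move_twisted l r : local_move l r -> forall s F,
  legal s l -> legal s r -> respects (size s) F -> twisted s l F = twisted s r F.
Proof.
have base i l0 r0 : (forall s, legal s (shift i l0) -> (i <= size s)%N) ->
  same_twisted l0 r0 -> forall s F,
  legal s (shift i l0) -> legal s (shift i r0) -> respects (size s) F ->
  twisted s (shift i l0) F = twisted s (shift i r0) F.
  by move=> le lr s F legl legr hF; apply: same_twisted_shift (le _ legl) _ _ _.
case=> {l r}.
- move=> i k e g.
  have := base i [:: (0, e); (outputs e + k, g)]%N [:: (inputs e + k, g); (0, e)]%N.
  rewrite /shift /= !addnA addn0; apply.
  + by move=> s; rewrite /legal_slice /=; lia.
  + apply: same_expand_twisted; [exact: same_expand_exchange | exact: total_sign_exchange].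
- move=> i b0; have := base i [:: (0, Cup b0); (1, Cap)]%N [::].
  rewrite /shift /= addn0 addn1; apply; first by move=> s; rewrite /legal_slice /=; lia.
  apply: same_expand_twisted => [s F legl _ hF|s _ _]; last by [].
  rewrite mul1r /=; apply: (respects_zigzag_up (p := [::]) (i := 0) [::] b0 hF) => //.
  by move: legl; rewrite /= sweepE /legal_slice /=; lia.
- move=> i b0; have := base i [:: (1, Cup b0); (0, Cap)]%N [::].
  rewrite /shift /= addn0 addn1; apply; first by move=> s; rewrite /legal_slice /=; lia.
  apply: same_expand_twisted => [s F legl _ hF|s _ _]; last by [].
  rewrite mul1r /=; apply: (respects_zigzag_down (p := [::]) (i := 0) [::] b0 hF) => //.
  by move: legl; rewrite /= /legal_slice /=; lia.
- move=> i v; have := base i [:: (0, Vertex v); (1, Cap)]%N [:: (1, Vertex (mirror v)); (0, Cap)]%N.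
  rewrite /shift /= addn0 addn1; apply; first by move=> s; rewrite /legal_slice /=; lia.
  apply: same_expand_twisted => [|[|c [|d [|e s]]]]; rewrite ?sweepE //; first exact: same_expand_vertex_cap.
  by rewrite /= sweepE /legal_slice /= /slice_sign /=; case: v => [f|] //; case: c d e f => [] [] [] [].
- move=> i b0 v; have := base i [:: (1, Cup b0); (0, Vertex v)]%N [:: (0, Cup b0); (1, Vertex (mirror v))]%N.
  rewrite /shift /= addn0 addn1; apply; first by move=> s; rewrite /legal_slice /=; lia.
  apply: same_expand_twisted => [|[|c s]]; rewrite //; first exact: same_expand_vertex_cup.
  by rewrite /= !sweepE /legal_slice /= /slice_sign /=; case: v => [f|] //; case: c b0 f => [] [] [].
- move=> i b0 c; have := base i [:: (1, Cup b0); (0, Vertex (Crossing c)); (1, Cap)]%N [::].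
  rewrite /shift /= addn0 addn1; apply; first by move=> s; rewrite /legal_slice /=; lia.
  apply: (same_twisted_R1 (c := c)) => [|[|d s]] //; first exact: same_expand_R1_up.
  by rewrite /= !sweepE /legal_slice /= /slice_sign /=; case: b0 c d => [] [] [].
- move=> i b0 c; have := base i [:: (0, Cup b0); (1, Vertex (Crossing c)); (0, Cap)]%N [::].
  rewrite /shift /= addn0 addn1; apply; first by move=> s; rewrite /legal_slice /=; lia.
  apply: (same_twisted_R1 (c := c)) => [|[|d s]] //; first exact: same_expand_R1_down.
  by rewrite /= !sweepE /legal_slice /= /slice_sign /=; case: b0 c d => [] [] [].
- move=> i c; have := base i [:: (0, Vertex (Crossing c)); (0, Vertex (Crossing (~~ c)))]%N [::].
  rewrite /shift /= addn0; apply; first by move=> s; rewrite /legal_slice /=; lia.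
  apply: same_expand_twisted => [|[|d [|e s]]] //; first exact: same_expand_R2.
  by rewrite /= !sweepE /slice_sign /=; case: c d e => [] [] [].
- move=> i c v; have := base i [:: (0, Vertex (Crossing c)); (1, Vertex (Crossing c)); (0, Vertex v)]%N
    [:: (1, Vertex v); (0, Vertex (Crossing c)); (1, Vertex (Crossing c))]%N.
  rewrite /shift /= addn0 addn1; apply; first by move=> s; rewrite /legal_slice /=; lia.
  apply: same_expand_twisted => [|[|d [|e [|f s]]]] //; first exact: same_expand_R3_bottom.
  by rewrite /= !sweepE /slice_sign /=; case: v => [g|]; lia.
- move=> i c v; have := base i [:: (0, Vertex v); (1, Vertex (Crossing c)); (0, Vertex (Crossing c))]%N
    [:: (1, Vertex (Crossing c)); (0, Vertex (Crossing c)); (1, Vertex v)]%N.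
  rewrite /shift /= addn0 addn1; apply; first by move=> s; rewrite /legal_slice /=; lia.
  apply: same_expand_twisted => [|[|d [|e [|f s]]]] //; first exact: same_expand_R3_top.
  by rewrite /= !sweepE /slice_sign /=; case: v => [g|]; lia.
- move=> i c v; have := base i [:: (0, Vertex (Crossing c)); (1, Vertex v); (0, Vertex (Crossing (~~ c)))]%N
    [:: (1, Vertex (Crossing (~~ c))); (0, Vertex v); (1, Vertex (Crossing c))]%N.
  rewrite /shift /= addn0 addn1; apply; first by move=> s; rewrite /legal_slice /=; lia.
  apply: same_expand_twisted => [|[|d [|e [|f s]]]] //; first exact: same_expand_R3_middle.
  by rewrite /= !sweepE /slice_sign /=; case: v => [g|]; case: c d e f => [] [] [] []; rewrite /=; lia.
- move=> i c; have := base i [:: (0, Vertex (Crossing c)); (0, Vertex DoublePoint)]%N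
    [:: (0, Vertex DoublePoint); (0, Vertex (Crossing c))]%N.
  rewrite /shift /= addn0; apply; first by move=> s; rewrite /legal_slice /=; lia.
  apply: same_expand_twisted => [|[|d [|e s]]] //; first exact: same_expand_S2.
  by rewrite /= !sweepE /slice_sign /=; case: c d e => [] [] [].
- move=> i b0; have := base i [:: (0, Cup b0); (0, Mark)]%N [:: (0, Cup b0); (1, Mark)]%N.
  rewrite /shift /= addn0 addn1; apply; first by move=> s; rewrite /legal_slice /=; lia.
  by apply: same_expand_twisted => //; apply: same_expand_mark_cup.
- move=> i; have := base i [:: (0, Mark); (0, Cap)]%N [:: (1, Mark); (0, Cap)]%N.
  rewrite /shift /= addn0 addn1; apply; first by move=> s; rewrite /legal_slice /=; lia.
  by apply: same_expand_twisted => //; apply: same_expand_mark_cap.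
- move=> i v; have := base i [:: (0, Mark); (0, Vertex v)]%N [:: (0, Vertex v); (1, Mark)]%N.
  rewrite /shift /= addn0 addn1; apply; first by move=> s; rewrite /legal_slice /=; lia.
  apply: same_expand_twisted => [|[|d [|e s]]] //; first exact: same_expand_mark_climb.
  by rewrite /= !sweepE /slice_sign /= addr0 add0r.
- move=> i v; have := base i [:: (1, Mark); (0, Vertex v)]%N [:: (0, Vertex v); (0, Mark)]%N.
  rewrite /shift /= addn0 addn1; apply; first by move=> s; rewrite /legal_slice /=; lia.
  apply: same_expand_twisted => [|[|d [|e s]]] //; first exact: same_expand_mark_descend.
  by rewrite /= !sweepE /slice_sign /= addr0 add0r.
Qed.

End Twist.

(** * Recovering the number of circles *)

(** The colouring with all strands [true] always extends. Logarithms of numbers of colourings are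
    therefore meaningful even for words not known to fit. *)
Lemma transfer_gt0 w n : all id n -> (0 < transfer w (fun=> 1) n)%N.
Proof.
elim: w n => //= x w IH n n1.
have split_n i : all id (take i n) && all id (drop i n) by rewrite -all_cat cat_take_drop.
have nth_n i : nth true n i = true.
  by have [/(all_nthP true n1)|/(nth_default true)] := ltnP i (size n).
have [n' n'_x n'1] : exists2 n', n' \in successors x n & all id n'.
  case: x => i [c||v|]; rewrite /successors /=; have /andP[take_n drop_n] := split_n i.
  - by exists (take i n ++ [:: true, true & drop i n]); rewrite ?inE ?eqxx // all_cat take_n.
  - exists (take i n ++ drop i.+2 n); first by rewrite !nth_n inE.
    by rewrite all_cat take_n; case/andP: (split_n i.+2).
  - by exists n; rewrite ?inE.
  - by exists n; rewrite ?inE.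
by rewrite (big_rem _ n'_x) /= addn_gt0 IH.
Qed.

(* The number of circles of t; unlike [components], it is well-behaved when a
   piece of t is replaced by another one, whatever the rest of t. *)
Definition log_circles (t : word) : nat := trunc_log 2 (transfer t (fun=> 1%N) [::]).

Lemma log_circlesE t : fits 0 t -> log_circles t = components [::] t.
Proof. by move=> fits_t; rewrite /log_circles -colouringsE -colourings_components // trunc_expnK. Qed.

Lemma trunc_log_mul k n : (0 < n)%N -> trunc_log 2 (2 ^ k * n) = (k + trunc_log 2 n)%N.
Proof.
move=> n_gt0; apply: trunc_log_eq => //; rewrite -addnS !expnD leq_pmul2l ?expn_gt0 //.
rewrite ltn_pmul2l ?expn_gt0 //; exact: trunc_log_bounds.
Qed.

(** Ensures that the predecessor in the exponent of the bracket is a true subtraction. *)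
Lemma components_cup b t : (0 < components [::] ((0%N, Cup b) :: t))%N.
Proof.
set w := _ :: _; set e := [rel x y | joined (s := [::]) (w := w) x y || joined y x].
have sym_e : connect_sym e by apply: sym_connect_sym => x y; rewrite /= orbC.
have lt0 : (0 < size (level [::] w (inord 1 : 'I_(size w).+1)))%N.
  by rewrite inordK /level /= ?take0.
pose pt : point [::] w :=
  existT (fun l : 'I_(size w).+1 => 'I_(size (level [::] w l))) (inord 1) (Ordinal lt0).
apply/card_gt0P; exists (fingraph.root e pt).
by rewrite inE /= roots_root.
Qed.

(** * The bracket as an expansion *)

Section States.
Variables (R : comNzRingType) (a a' b b' : R).
Notation flat_weight := (flat_weight a a' b b').
Notation turn_weight := (turn_weight a a' b b').
Notation expand := (expand a a' b b').
Implicit Type F : word -> R.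

Definition smooth_slice (s : seq bool) (x : slice) (oriented : bool) : word :=
  if x.2 is Vertex _ then
    if oriented == (nth true s x.1 == nth true s x.1.+1) then [::] else [:: (x.1, Cap); (x.1, Cup true)]
  else [:: x].

Definition slice_weight (s : seq bool) (x : slice) (oriented : bool) : R :=
  match x.2 with
  | Vertex (Crossing c) =>
      if (c != (nth true s x.1 == nth true s x.1.+1)) == oriented then a else a'
  | Vertex DoublePoint => if oriented then b else b'
  | _ => 1
  end.

(** A state is a set of vertices, so a slice which is not a vertex has the single choice [false]. *)
Definition smoothings (x : slice) : seq bool :=
  if is_vertex x.2 then [:: true; false] else [:: false].

Lemma expand_selections s w F :
  \sum_(cs <- selections [seq smoothings x | x <- w])
    (\prod_(j < size w) slice_weight (level s w j) (slice_at w j) (nth false cs j)) *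
    F (flatten [seq smooth_slice (level s w j) (slice_at w j) (nth false cs j) | j <- iota 0 (size w)])
  = expand s w F.
Proof.
elim: w s F => [|x w IH] s F; first by rewrite /= big_seq1 big_ord0 mul1r.
rewrite [map _ _]/= big_selections_cons.
have step c : \sum_(cs <- selections [seq smoothings x | x <- w])
    (\prod_(j < size (x :: w)) slice_weight (level s (x :: w) j) (slice_at (x :: w) j) (nth false (c :: cs) j)) *
    F (flatten [seq smooth_slice (level s (x :: w) j) (slice_at (x :: w) j) (nth false (c :: cs) j)
               | j <- iota 0 (size (x :: w))])
  = slice_weight s x c * expand (sweep s x) w (fun t => F (smooth_slice s x c ++ t)).
  rewrite -IH big_distrr /=; apply: eq_bigr => cs _; rewrite big_ord_recl mulrA; congr (_ * F (_ ++ flatten _)).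
  by rewrite (iotaDl 1 0) -map_comp.
rewrite (eq_bigr _ (fun c _ => step c)) {step}.
case: x => i [c||v|]; rewrite /smoothings /= ?big_cons big_nil ?addr0 /slice_weight /smooth_slice /= ?mul1r //.
case: (nth _ _ _ == nth _ _ _) => /=.
  by case: v => [c|] //=; case: c.
by rewrite addrC; case: v => [c|] //=; case: c.
Qed.

End States.

Local Notation loop := (loop_value vA vA^-1).
Local Notation vexpand := (expand vA vA^-1 vB vB^-1).

Lemma bracket_expand w :
  bracket w = vexpand [::] w (fun t => loop ^+ (components [::] t).-1).
Proof.
pose F (cs : seq bool) : K :=
  (\prod_(j < size w) slice_weight vA vA^-1 vB vB^-1 (level [::] w j) (slice_at w j) (nth false cs j)) *
  loop ^+ (components [::] (flatten [seq smooth_slice (level [::] w j) (slice_at w j) (nth false cs j)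
                                    | j <- iota 0 (size w)])).-1.
rewrite -expand_selections -[RHS]/(\sum_(cs <- selections [seq smoothings x | x <- w]) F cs).
rewrite -(@sum_ffun_selections _ _ (size w) _ F) ?size_map //; last first.
  by elim: (w) => //= x u ->; rewrite /smoothings; case: ifP.
rewrite /bracket (reindex (fun h : {ffun 'I_(size w) -> bool} => [set j | h j])); last first.
  exists (fun S : {set 'I_(size w)} => [ffun j => j \in S]) => x _.
    by apply/ffunP => j; rewrite ffunE inE.
  by apply/setP => j; rewrite inE ffunE.
apply: eq_big => [h|h _].
  apply/subsetP/forallP => h_vert j.
    have := h_vert j; rewrite !inE (nth_map (0%N, Mark)) // /smoothings.
    by case: (is_vertex _) => //; case: (h j) => // /(_ isT).
  have := h_vert j; rewrite !inE (nth_map (0%N, Mark)) // /smoothings -/(slice_at w j).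
  by case: (is_vertex _) => //; rewrite inE => /eqP ->.
have nth_h (j : 'I_(size w)) : nth false [seq h j | j <- enum 'I_(size w)] j = h j.
  by rewrite (nth_map j) ?size_enum_ord // nth_ord_enum.
rewrite /F; congr (_ * _).
  rewrite big_mkcond; apply: eq_bigr => j _; rewrite nth_h inE /smoothing_weight /slice_weight inE.
  rewrite /positive /parallel /climbing /descending.
  by case: (slice_at w j) => i [c||[c|]|].
congr (_ ^+ (components _ _).-1); first by rewrite /loop_value exprVn.
rewrite /circles /smooth -val_enum_ord -map_comp; congr flatten; apply: eq_map => j.
rewrite /smooth_at /smooth_slice /= nth_h inE /parallel /climbing /descending.
by case: (slice_at w j) => i [|||].
Qed.

Lemma loop_neq0 : loop != 0.
Proof.
apply/eqP => loop0; have : vA ^+ 4 + 1 = 0.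
  have AV := vA_mulV; have -> : vA ^+ 4 + 1 = - vA ^+ 2 * loop by rewrite /loop_value; ring: AV.
  by rewrite loop0 mulr0.
rewrite /vA -tofracXn -tofrac1 -tofracD => /eqP; rewrite tofrac_eq0 -rmorphXn -polyC1 -polyCD polyC_eq0.
move=> /eqP/(congr1 (fun p : {poly int} => p`_0)).
by rewrite coefD coefXn coef1 coef0.
Qed.

(** One more loop turns the exponent c - 1 into c, which changes by k when a piece is replaced. The
    empty word is excluded: its bracket is 1, without any circle. *)
Lemma bracket_log w : legal [::] w -> w <> [::] ->
  loop * bracket w = vexpand [::] w (fun t => loop ^+ log_circles t).
Proof.
case: w => // x w legw _; have /andP[legx legw'] := legw; have [c def_x] := first_slice legx.
move: legw'; rewrite bracket_expand -expandZ {x legx legw}def_x sweepE /= sweepE => legw.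
apply: expand_ext legw _ => t fits_t _.
by rewrite log_circlesE //= -exprS prednK // components_cup.
Qed.

(** Replacing [t] by [t'] divides the number of colourings of the whole smoothed diagram by 2^k, so
    the logarithm drops by k whatever surrounds the piece. *)
Lemma respects_circles (s s' : seq bool) v p : fits 0 p -> width 0 p = size s ->
  respects vA vA^-1 (size s) (fun t => vexpand s' v (fun q => loop ^+ log_circles (p ++ t ++ q))).
Proof.
move=> fits_p width_p k t t' tt'; rewrite -expandZ; congr (vexpand _ _ _).
apply: functional_extensionality => q; rewrite -exprD; congr (_ ^+ _).
rewrite -trunc_log_mul ?transfer_gt0 //; congr trunc_log.
by rewrite -width_p in tt'; apply: (same_transfer_cat q fits_p tt').
Qed.

(** Shows that no move creates or destroys the empty diagram, so [bracket_log] applies to both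
    sides. *)
Lemma local_move_nonempty l r : local_move l r -> legal [::] l -> l <> [::] /\ r <> [::].
Proof.
case=> {l r} //.
- by move=> i b0 legl; legal_sizes legl; simpl in *; lia.
- by move=> i b0 c legl; legal_sizes legl; simpl in *; lia.
- by move=> i c legl; legal_sizes legl; simpl in *; lia.
Qed.

Lemma one_move_bracket w w' : one_move w w' ->
  (- vA) ^ (- 3%:Z * writhe [::] w) * bracket w =
  (- vA) ^ (- 3%:Z * writhe [::] w') * bracket w'.
Proof.
case=> u l r v lm /andP[legl /eqP end_l] /andP[legr /eqP end_r].
have [legu legl'] : legal [::] u /\ legal (foldl sweep [::] u) l.
  by move: legl; rewrite !legal_cat => /and3P[].
have legr' : legal (foldl sweep [::] u) r by move: legr; rewrite !legal_cat => /and3P[].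
have nonempty : u ++ l ++ v <> [::] /\ u ++ r ++ v <> [::].
  by case: (u) legl' => // legl'; have [] := local_move_nonempty lm legl'; case: (l) (r) => [|? ?] [].
apply: (mulfI loop_neq0); rewrite !(mulrCA loop) !bracket_log //; try by case: nonempty.
have [ends _] := local_moveP vB vA_mulV lm.
rewrite !writheE !total_sign_cat (ends _ legl' legr').
(* The signs of the slices outside the piece are common to both sides and are factored out; the
   piece keeps its own power of [- vA]. *)
rewrite !(addrCA (total_sign [::] u)) !mulrDr !expfzDr ?oppr_eq0 ?vA_neq0 // -!mulrA.
rewrite !(mulrCA (_ ^ (- 3%:Z * total_sign (foldl sweep [::] u) _))).
congr (_ * (_ * _)).
rewrite !expand_cat -!expandZ; apply: expand_ext legu _ => t fits_t width_t.
rewrite !expand_cat -(ends _ legl' legr').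
exact: (local_move_twisted vB vA_neq0 lm legl' legr' (respects_circles _ _ fits_t width_t)).
Qed.

Lemma bracket_invariant D D' : isotopic D D' ->
  (- vA) ^ (- 3%:Z * writhe [::] D) * bracket D =
  (- vA) ^ (- 3%:Z * writhe [::] D') * bracket D'.
Proof. by elim=> [x y|//|x y _ ->|x y z _ -> _ ->] //; apply: one_move_bracket. Qed.

Theorem theorem1 :
  (forall D D' : word,
     link_diagram D -> link_diagram D' -> isotopic D D' ->
     (- vA) ^ (- 3%:Z * writhe [::] D) * bracket D =
     (- vA) ^ (- 3%:Z * writhe [::] D') * bracket D') /\
  (forall D D' : word,
     long_diagram D -> long_diagram D' -> long_isotopic D D' ->
     Delta D = Delta D').
Proof.
split; last exact: Delta_invariant.
by move=> D D' _ _; apply: bracket_invariant.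
Qed.
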